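(* (Ergodic capacity of the direct link.) Let $h$ be the fading coefficient of a single direct link with turbulence/pointing-error parameters $\psi,\phi,P,\zeta_l,C_l,a_{l,w},b_{l,w},m,n,p,q$ of one of the models $\mathcal{GG},\mathcal M,\mathcal F$ and fog parameters $v>0$, $k$ a positive integer, as described in the context. Let $t\in\{1,2\}$, $\gamma_0>0$, $\mu_1=1$, $\mu_2=\frac e{2\pi}$, and let $\gamma=\gamma_0h^t$ be the SNR. Then $\bar\eta^{\rm DL}=\mathbb E[\log_2(1+\mu_t\gamma)]$ is given by $$\bar\eta^{\rm DL}=\log_2(e)\frac{\psi v^k}{t}\sum_{l=1}^P\zeta_lC_l^{-\phi}\,H^{m+k+2,n+1}_{p+k+2,q+k+2}\left[C_l\Big(\frac1{\mu_t\gamma_0}\Big)^{1/t}\middle|\begin{array}{c} V_1,(0,\frac1t),(1,\frac1t),V_2 \\ V_3,(0,\frac1t),(0,\frac1t),V_4 \end{array}\right],$$ where $V_1=\{(\phi+a_{l,w},1)\}_{w=1}^n$, $V_2=\{(\phi+a_{l,w},1)\}_{w=n+1}^p,\{(v+1,1)\}_1^k$, $V_3=\{(\phi+b_{l,w},1)\}_{w=1}^m,\{(v,1)\}_1^k$ and $V_4=\{(\phi+b_{l,w},1)\}_{w=m+1}^q$.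
   Context: Notation: $\{c\}_1^k$ denotes $c$ repeated $k$ times. Fox's H-function: $H_{p,q}^{m,n}\left[x\middle|\begin{array}{c} (a_1,A_1),\dots,(a_p,A_p) \\ (b_1,B_1),\dots,(b_q,B_q) \end{array}\right]=\frac1{2\pi\jmath}\int_{\mathcal L}\frac{\prod_{j=1}^m\Gamma(b_j-B_js)\prod_{j=1}^n\Gamma(1-a_j+A_js)}{\prod_{j=n+1}^p\Gamma(a_j-A_js)\prod_{j=m+1}^q\Gamma(1-b_j+B_js)}x^s\,ds$, where $\jmath$ is the imaginary unit and $\mathcal L$ runs from $-\jmath\infty$ to $+\jmath\infty$ with the poles of $\Gamma(b_j-B_js)$ ($j\le m$) on its right and those of $\Gamma(1-a_j+A_js)$ ($j\le n$) on its left. Meijer's G-function $G^{m,n}_{p,q}\left(x\middle|\begin{array}{c} a_1,\dots,a_p \\ b_1,\dots,b_q \end{array}\right)$ is the case in which all $A_j=B_j=1$. Fading coefficient of a link: $h=h^{(tp)}h^{(f)}$ with $h^{(tp)}$, $h^{(f)}$ independent. The fog gain $h^{(f)}$ has density $\frac{v^k}{\Gamma(k)}[\ln(1/x)]^{k-1}x^{v-1}$ on $(0,1]$, $v>0$, $k$ a positive integer. The turbulence/pointing-error gain $h^{(tp)}$ has density $\psi x^{\phi-1}\sum_{l=1}^{P}\zeta_lG_{p,q}^{m,n}\left(C_lx\middle|\begin{array}{c} \{a_{l,w}\}_{w=1}^p \\ \{b_{l,w}\}_{w=1}^q \end{array}\right)$, $x>0$, with parameters of one of the following models ($\rho>0$,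 $A_0>0$ pointing-error parameters): $\mathcal{GG}$ (Gamma-Gamma), $\alpha,\beta>0$: $\psi=\frac{\alpha\beta\rho^2}{A_0\Gamma(\alpha)\Gamma(\beta)}$, $\phi=1$, $P=1$, $\zeta_1=1$, $C_1=\frac{\alpha\beta}{A_0}$, $(m,n,p,q)=(3,0,1,3)$, $a=\{\rho^2\}$, $b=\{\rho^2-1,\alpha-1,\beta-1\}$. $\mathcal{M}$ (Málaga), $\alpha>0$, $\beta$ a positive integer, $g,\Omega'>0$: $\psi=\frac{\rho^2A_{mg}}{2}$, $\phi=0$, $P=\beta$, $\zeta_l=b_l$, $C_l=\frac{\alpha\beta}{(g\beta+\Omega')A_0}$, $(m,n,p,q)=(3,0,1,3)$, $a_l=\{\rho^2+1\}$, $\{b_{l,w}\}=\{\rho^2,\alpha,l\}$, where $A_{mg}=\frac{2\alpha^{\alpha/2}}{g^{1+\alpha/2}\Gamma(\alpha)}\left(\frac{g\beta}{g\beta+\Omega'}\right)^{\beta+\alpha/2}$ and $b_l=\binom{\beta-1}{l-1}\frac{(g\beta+\Omega')^{1-l/2}}{(l-1)!}\left(\frac{\Omega'}{g}\right)^{l-1}\left(\frac{\alpha}{\beta}\right)^{l/2}\left(\frac{\alpha\beta}{g\beta+\Omega'}\right)^{-(\alpha+l)/2}$. $\mathcal{F}$ (Fisher–Snedecor), $\alpha>0$, $\beta>1$: $\psi=\frac{\alpha\rho^2}{(\beta-1)A_0\Gamma(\alpha)\Gamma(\beta)}$, $\phi=1$, $P=1$, $\zeta_1=1$, $C_1=\frac{\alpha}{(\beta-1)A_0}$,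 $(m,n,p,q)=(2,1,2,2)$, $a=\{-\beta,\rho^2\}$, $b=\{\alpha-1,\rho^2-1\}$. *)

(* Defs.v *)
From HB Require Import structures.
From mathcomp Require Import all_boot all_order all_algebra.
From mathcomp Require Import complex.
From mathcomp Require Import all_classical all_reals all_analysis.

Set Implicit Arguments.
Unset Strict Implicit.
Unset Printing Implicit Defensive.

Import Order.TTheory GRing.Theory Num.Theory.
Import numFieldNormedType.Exports.

Local Open Scope classical_set_scope.
Local Open Scope ring_scope.
Local Open Scope complex_scope.

Section ComplexAnalysis.
Variable R : realType.
Implicit Types (z w s : R[i]) (x : R).

Definition Cexp z : R[i] :=
  (expR (complex.Re z))%:C * (cos (complex.Im z) +i* sin (complex.Im z)).

(* Principal power of a real base; only meaningful for 0 < x. *)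
Definition Cpow x w : R[i] := Cexp (w * (ln x)%:C).

Definition Cintegral (D : set R) (f : R -> R[i]) : R[i] :=
  Rintegral lebesgue_measure D (fun y => complex.Re (f y))
  +i* Rintegral lebesgue_measure D (fun y => complex.Im (f y)).

(* Euler's integral, convergent for 0 < Re z. *)
Definition Gamma_Euler z : R[i] :=
  Cintegral `]0, +oo[ (fun u => Cpow u (z - 1) * (expR (- u))%:C).

(* Analytic continuation of Euler's integral by Gamma (z + 1) = z * Gamma z.
   The shift N is 0 iff 0 < Re z, and always 0 < Re (z + N).  At the poles
   0, -1, -2, ... the product vanishes, so Gamma z = 0 and (Gamma z)^-1 = 0,
   the latter being the value there of the entire function 1 / Gamma. *)
Definition Gamma z : R[i] :=
  let N := Num.truncn (1 - complex.Re z) in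
  Gamma_Euler (z + N%:R) / \prod_(i < N) (z + i%:R).

Definition Gamma_pole z : Prop := exists nu : nat, z = - nu%:R.

Definition rGamma x : R := complex.Re (Gamma x%:C).

End ComplexAnalysis.

Section FoxH.
Variable R : realType.
Implicit Types (m n : nat) (a b : seq (R * R)) (c : R -> R) (s : R[i]) (x : R).

(* A contour from -i oo to +i oo is given by c as y |-> c y + i y; it is C^1
   and stays, with its slope, in a bounded strip.  A point s lies on its right
   (resp. left) when c (Im s) < Re s (resp. Re s < c (Im s)). *)
Definition is_contour c : Prop :=
  [/\ forall y, derivable c y 1, continuous (derive1 c)
    & exists M : R, forall y, `|c y| <= M /\ `|derive1 c y| <= M].

Definition contour_integral c (f : R[i] -> R[i]) : R[i] :=
  Cintegral setT (fun y => f (c y +i* y) * (derive1 c y +i* 1)).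

(* In H^{m,n}_{p,q}[x | a; b] the orders p and q are size a and size b, and
   a pair u in a or b is (a_j, A_j) or (b_j, B_j). *)
Definition foxH_kernel m n a b s : R[i] :=
  (\prod_(u <- take m b) Gamma (u.1%:C - u.2%:C * s))
  * (\prod_(u <- take n a) Gamma (1 - u.1%:C + u.2%:C * s))
  / ((\prod_(u <- drop n a) Gamma (u.1%:C - u.2%:C * s))
     * (\prod_(u <- drop m b) Gamma (1 - u.1%:C + u.2%:C * s))).

Definition separates m n a b c : Prop :=
  (forall u s, u \in take m b -> Gamma_pole (u.1%:C - u.2%:C * s) ->
     c (complex.Im s) < complex.Re s)
  /\ (forall u s, u \in take n a -> Gamma_pole (1 - u.1%:C + u.2%:C * s) ->
     complex.Re s < c (complex.Im s)).

(* An arbitrary separating contour; by Cauchy's theorem the value of the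
   H-function does not depend on it when the kernel decays fast enough in
   bounded vertical strips. *)
Definition foxH_contour m n a b : R -> R :=
  xget (cst 0) [set c | is_contour c /\ separates m n a b c].

(* Only meaningful for 0 < x, when all A_j, B_j are positive. *)
Definition foxH m n a b x : R[i] :=
  contour_integral (foxH_contour m n a b)
    (fun s => foxH_kernel m n a b s * Cpow x s)
  / (0 +i* (2 * pi)).

Definition meijerG m n (a b : seq R) x : R[i] :=
  foxH m n [seq (u, 1) | u <- a] [seq (u, 1) | u <- b] x.

End FoxH.

Section Channel.
Variable R : realType.

(* The indices l of the families start at 1; p = size (tp_a l) and
   q = size (tp_b l). *)
Record tp_params := TPParams {
  tp_psi : R;
  tp_phi : R;
  tp_P : nat;
  tp_zeta : nat -> R;
  tp_C : nat -> R;
  tp_m : nat;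
  tp_n : nat;
  tp_a : nat -> seq R;
  tp_b : nat -> seq R
}.

Definition GammaGamma_params (alpha beta rho A0 : R) : tp_params := {|
  tp_psi := alpha * beta * rho ^+ 2 / (A0 * rGamma alpha * rGamma beta);
  tp_phi := 1;
  tp_P := 1;
  tp_zeta := fun=> 1;
  tp_C := fun=> alpha * beta / A0;
  tp_m := 3; tp_n := 0;
  tp_a := fun=> [:: rho ^+ 2];
  tp_b := fun=> [:: rho ^+ 2 - 1; alpha - 1; beta - 1]
|}.

Definition Malaga_A (alpha : R) (beta : nat) (g Om : R) : R :=
  2 * alpha `^ (alpha / 2) / (g `^ (1 + alpha / 2) * rGamma alpha)
  * (g * beta%:R / (g * beta%:R + Om)) `^ (beta%:R + alpha / 2).

Definition Malaga_b (alpha : R) (beta : nat) (g Om : R) (l : nat) : R :=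
  'C(beta.-1, l.-1)%:R
  * ((g * beta%:R + Om) `^ (1 - l%:R / 2) / (l.-1)`!%:R)
  * (Om / g) ^+ l.-1
  * (alpha / beta%:R) `^ (l%:R / 2)
  * (alpha * beta%:R / (g * beta%:R + Om)) `^ (- ((alpha + l%:R) / 2)).

Definition Malaga_params (alpha : R) (beta : nat) (g Om rho A0 : R)
  : tp_params := {|
  tp_psi := rho ^+ 2 * Malaga_A alpha beta g Om / 2;
  tp_phi := 0;
  tp_P := beta;
  tp_zeta := Malaga_b alpha beta g Om;
  tp_C := fun=> alpha * beta%:R / ((g * beta%:R + Om) * A0);
  tp_m := 3; tp_n := 0;
  tp_a := fun=> [:: rho ^+ 2 + 1];
  tp_b := fun l => [:: rho ^+ 2; alpha; l%:R]
|}.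

Definition Fisher_params (alpha beta rho A0 : R) : tp_params := {|
  tp_psi := alpha * rho ^+ 2
            / ((beta - 1) * A0 * rGamma alpha * rGamma beta);
  tp_phi := 1;
  tp_P := 1;
  tp_zeta := fun=> 1;
  tp_C := fun=> alpha / ((beta - 1) * A0);
  tp_m := 2; tp_n := 1;
  tp_a := fun=> [:: - beta; rho ^+ 2];
  tp_b := fun=> [:: alpha - 1; rho ^+ 2 - 1]
|}.

Inductive tp_model : tp_params -> Prop :=
| GammaGamma_model alpha beta rho A0 :
    0 < alpha -> 0 < beta -> 0 < rho -> 0 < A0 ->
    tp_model (GammaGamma_params alpha beta rho A0)
| Malaga_model alpha (beta : nat) g Om rho A0 :
    0 < alpha -> (0 < beta)%N -> 0 < g -> 0 < Om -> 0 < rho -> 0 < A0 ->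
    tp_model (Malaga_params alpha beta g Om rho A0)
| Fisher_model alpha beta rho A0 :
    0 < alpha -> 1 < beta -> 0 < rho -> 0 < A0 ->
    tp_model (Fisher_params alpha beta rho A0).

Definition tp_density_expr (pr : tp_params) (x : R) : R[i] :=
  (tp_psi pr * x `^ (tp_phi pr - 1))%:C
  * \sum_(1 <= l < (tp_P pr).+1)
      (tp_zeta pr l)%:C
      * meijerG (tp_m pr) (tp_n pr) (tp_a pr l) (tp_b pr l) (tp_C pr l * x).

(* The Meijer G-values above are complex by definition; f is the real density
   they represent on the positive half-line. *)
Definition is_tp_density (pr : tp_params) (f : R -> R) : Prop :=
  (forall x, x <= 0 -> f x = 0)
  /\ (forall x, 0 < x -> (f x)%:C = tp_density_expr pr x).

Definition fog_density (v : R) (k : nat) (x : R) : R :=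
  if (0 < x) && (x <= 1) then
    v ^+ k / rGamma k%:R * ln (1 / x) ^+ k.-1 * x `^ (v - 1)
  else 0.

Definition log2 (x : R) : R := ln x / ln 2.

(* Used only at t = 1 and t = 2. *)
Definition mu_ (t : nat) : R := if t == 1%N then 1 else expR 1 / (2 * pi).

Section CapacityParameters.
Variables (pr : tp_params) (v : R) (k l : nat).

Definition V1 : seq (R * R) :=
  [seq (tp_phi pr + u, 1) | u <- take (tp_n pr) (tp_a pr l)].
Definition V2 : seq (R * R) :=
  [seq (tp_phi pr + u, 1) | u <- drop (tp_n pr) (tp_a pr l)]
  ++ nseq k (v + 1, 1).
Definition V3 : seq (R * R) :=
  [seq (tp_phi pr + u, 1) | u <- take (tp_m pr) (tp_b pr l)]
  ++ nseq k (v, 1).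
Definition V4 : seq (R * R) :=
  [seq (tp_phi pr + u, 1) | u <- drop (tp_m pr) (tp_b pr l)].

End CapacityParameters.

End Channel.

Section Probability.
Variables (d : measure_display) (T : measurableType d) (R : realType).
Variable P : probability T R.

Definition independent_RV (X Y : {RV P >-> R}) : Prop :=
  forall A B : set R, measurable A -> measurable B ->
    P (X @^-1` A `&` Y @^-1` B) = (P (X @^-1` A) * P (Y @^-1` B))%E.

Definition has_density (X : {RV P >-> R}) (f : R -> R) : Prop :=
  [/\ measurable_fun setT f, forall x, 0 <= f x
    & forall A : set R, measurable A ->
        distribution P X A = (\int[lebesgue_measure]_(x in A) (f x)%:E)%E].

End Probability.

(* Main.v *)
Require Import Defs.
From HB Require Import structures.
From mathcomp Require Import all_boot all_order all_algebra.
From mathcomp Require Import complex.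
From mathcomp Require Import all_classical all_reals all_analysis.
From mathcomp Require Import measurable_realfun.
From mathcomp Require Import ring lra.

Set Implicit Arguments.
Unset Strict Implicit.
Unset Printing Implicit Defensive.

Import Order.TTheory GRing.Theory Num.Theory.
Import numFieldNormedType.Exports.

Local Open Scope classical_set_scope.
Local Open Scope ring_scope.
Local Open Scope complex_scope.

(** By Cauchy's theorem the G-functions in the turbulence density are integrals
    along a vertical line: the t-derivative of the integral over a homotopy from
    the contour to the line is an exact y-derivative, and the kernel decays
    quadratically in vertical strips.  By independence the capacity is the
    integral of that density against W(x) = E[log2(1 + mu gamma0 (x hf)^t)], and
    Fubini's theorem turns it into the integral along the line of the kernel
    times the Mellin transform of W.  The latter factors: averaging over the fog
    is a multiplicative convolution and gives (v / (v - s))^k, the power t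
    rescales the variable to z = s / t, and ln(1 + x), again a multiplicative
    convolution, gives Gamma(1 + z) Gamma(- z) / (- z).  Writing 1 / (v - s) and
    1 / (- z) as quotients of values of Gamma, one recognizes the kernel of the
    H-function.  The line Re s = -1/2 suits the three models. *)

(** * Complex numbers and complex derivatives *)

(** Two facts about Gamma shape the estimates. Continuation by the functional equation makes Gamma,
    in a given strip, a bounded Euler integral divided by as many linear factors as desired, hence
    the quadratic decay. And every reciprocal Gamma in the kernels has an argument exactly one above
    that of some numerator Gamma, so that the quotient is 1 / z. This simplification requires that
    Gamma have no zeros, and it fails at the poles, where Gamma is 0 by convention: a kernel as
    defined may jump at real points where its formula is analytic. Regularity is therefore claimed
    only off the real axis and in the gap of that axis between the two families of poles. This is
    enough because a contour is a graph over the imaginary axis: it meets the real axis once, inside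
    the gap, and a horizontal homotopy to a vertical line stays there. As for the abscissa, the
    logarithm imposes -t < Re s < 0 and the fog Re s < v; -1/2 meets both for t = 1 and t = 2, and
    positivity of the model parameters (with beta > 1 for Fisher-Snedecor) puts -1/2 - phi in the
    gap of each density. *)

HB.instance Definition _ (R : rcfType) := NormedModule.copy R[i] (R[i]^o).

Notation Re := (@complex.Re _).
Notation Im := (@complex.Im _).
Notation normc := (@ComplexField.Normc.normc _).
Notation normc0 := ComplexField.Normc.normc0 (only parsing).
Notation normc1 := ComplexField.Normc.normc1 (only parsing).
Notation normcM := ComplexField.Normc.normcM (only parsing).
Notation normcV := ComplexField.Normc.normcV (only parsing).

Section ComplexModulus.
Variable R : realType.
Implicit Types (z w s : R[i]) (x y : R).

Lemma ReD z w : Re (z + w) = Re z + Re w.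
Proof. by case: z w => [a b] [c d]. Qed.
Lemma ImD z w : Im (z + w) = Im z + Im w.
Proof. by case: z w => [a b] [c d]. Qed.
Lemma ReN z : Re (- z) = - Re z.
Proof. by case: z. Qed.
Lemma ImN z : Im (- z) = - Im z.
Proof. by case: z. Qed.
Lemma ReM z w : Re (z * w)
  = Re z * Re w - Im z * Im w.
Proof. by case: z w => [a b] [c d]. Qed.
Lemma ImM z w : Im (z * w)
  = Re z * Im w + Im z * Re w.
Proof. by case: z w => [a b] [c d]. Qed.
Lemma Re_nat n : Re (n%:R : R[i]) = n%:R.
Proof. by rewrite -[n%:R](rmorph_nat (real_complex R)). Qed.
Lemma Im_nat n : Im (n%:R : R[i]) = 0.
Proof. by rewrite -[n%:R](rmorph_nat (real_complex R)). Qed.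
Lemma complex_ext z w : Re z = Re w ->
  Im z = Im w -> z = w.
Proof. by case: z w => [a b] [c d] /= -> ->. Qed.

Definition ReImE := (ReD, ImD, ReN, ImN, ReM, ImM, Re_nat, Im_nat).

Lemma normc_ge0 z : 0 <= normc z.
Proof. by case: z => a b; rewrite /= sqrtr_ge0. Qed.

Lemma normcD z w : normc (z + w) <= normc z + normc w.
Proof.
have := ler_normD z w.
have nE u : `|u| = (normc u)%:C by [].
by rewrite !nE -rmorphD lecR.
Qed.

Lemma normcN z : normc (- z) = normc z.
Proof. by case: z => a b /=; rewrite !sqrrN. Qed.

Lemma normcB z w : normc (z - w) <= normc z + normc w.
Proof. by have := normcD z (- w); rewrite normcN. Qed.

Lemma normc_sub z w : normc (z - w) = normc (w - z).
Proof. by rewrite -normcN opprB. Qed.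

Lemma normc_real x : normc x%:C = `|x|.
Proof. by rewrite /= expr0n /= addr0 sqrtr_sqr. Qed.

Lemma normc_Re z : `|Re z| <= normc z.
Proof. by case: z => a b /=; rewrite -sqrtr_sqr ler_sqrt ?addr_ge0 ?sqr_ge0// lerDl sqr_ge0. Qed.

Lemma normc_Im z : `|Im z| <= normc z.
Proof. by case: z => a b /=; rewrite -sqrtr_sqr ler_sqrt ?addr_ge0 ?sqr_ge0// lerDr sqr_ge0. Qed.

Lemma normc_i x : normc (0 +i* x) = `|x|.
Proof. by rewrite /= expr0n /= add0r sqrtr_sqr. Qed.

Lemma normc_le z : normc z <= `|Re z| + `|Im z|.
Proof.
have {1}-> : z = (Re z)%:C + (0 +i* Im z).
  by case: z => a b; apply: complex_ext; rewrite ReImE /= ?addr0 ?add0r.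
by apply: le_trans (normcD _ _) _; rewrite normc_real normc_i.
Qed.

Lemma normc_sqr z : normc z ^+ 2 = Re z ^+ 2 + Im z ^+ 2.
Proof. by case: z => a b; rewrite /= sqr_sqrtr ?addr_ge0 ?sqr_ge0. Qed.

Lemma normc_prod I (r : seq I) (P : pred I) (F : I -> R[i]) :
  normc (\prod_(i <- r | P i) F i) = \prod_(i <- r | P i) normc (F i).
Proof.
by apply: (big_morph normc (@normcM _)); exact: normc1.
Qed.

Lemma normc_eq0 z : (normc z == 0) = (z == 0).
Proof.
apply/eqP/eqP => [/ComplexField.Normc.eq0_normc//|->]; exact: normc0.
Qed.

Lemma normc_gt0 z : z != 0 -> 0 < normc z.
Proof. by move=> z0; rewrite lt_def normc_ge0 andbT normc_eq0. Qed.

Lemma Cexp0 : Cexp (0 : R[i]) = 1.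
Proof. by rewrite /Cexp /= expR0 cos0 sin0 mul1r. Qed.

Lemma CexpD z w : Cexp (z + w) = Cexp z * Cexp w.
Proof.
rewrite /Cexp ReD ImD expRD cosD sinD; apply: complex_ext; rewrite !ReImE /=; ring.
Qed.

Lemma normc_Cexp z : normc (Cexp z) = expR (Re z).
Proof.
rewrite /Cexp normcM normc_real ger0_norm ?expR_ge0 //.
by rewrite /= cos2Dsin2 sqrtr1 mulr1.
Qed.

Lemma Cexp_neq0 z : Cexp z != 0.
Proof.
apply/eqP => z0; have := expR_gt0 (Re z).
by rewrite -normc_Cexp z0 normc0 ltxx.
Qed.

Lemma Cexp_real x : Cexp x%:C = (expR x)%:C.
Proof. by rewrite /Cexp /= cos0 sin0; apply: complex_ext; rewrite !ReImE /=; ring. Qed.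

Lemma CpowE x z : Cpow x z = Cexp (z * (ln x)%:C). Proof. by []. Qed.

Lemma CexpE z : Cexp z = (expR (Re z))%:C * (cos (Im z) +i* sin (Im z)). Proof. by []. Qed.

Lemma CpowD x z w : Cpow x (z + w) = Cpow x z * Cpow x w.
Proof. by rewrite /Cpow mulrDl CexpD. Qed.

Lemma Cpow0 x : Cpow x 0 = 1.
Proof. by rewrite /Cpow mul0r Cexp0. Qed.

Lemma Cpow_neq0 x z : Cpow x z != 0. Proof. exact: Cexp_neq0. Qed.

Lemma CpowN x z : Cpow x (- z) = (Cpow x z)^-1.
Proof.
apply: (mulfI (Cpow_neq0 x z)); rewrite mulfV ?Cpow_neq0//.
by rewrite -CpowD subrr Cpow0.
Qed.

Lemma normc_Cpow x z : 0 < x -> normc (Cpow x z) = x `^ Re z.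
Proof.
move=> x0; rewrite normc_Cexp ReM /= mulr0 subr0 /powR gt_eqF //.
Qed.

Lemma Cpow_real x y : 0 < x -> Cpow x y%:C = (x `^ y)%:C.
Proof. by move=> x0; rewrite /Cpow -rmorphM Cexp_real /powR gt_eqF. Qed.

Lemma CpowM x y z : 0 < x -> 0 < y -> Cpow (x * y) z = Cpow x z * Cpow y z.
Proof. by move=> x0 y0; rewrite /Cpow lnM ?posrE// rmorphD mulrDr CexpD. Qed.

Lemma Cpow_powR x r z : Cpow (x `^ r) z = Cpow x (r%:C * z).
Proof. by rewrite /Cpow ln_powR rmorphM mulrCA mulrA. Qed.

Lemma Cpow1 x : 0 < x -> Cpow x 1 = x%:C.
Proof. by move=> x0; rewrite (Cpow_real 1)// powRr1// ltW. Qed.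

Lemma Cpow1l z : Cpow 1 z = 1.
Proof. by rewrite /Cpow ln1 mulr0 Cexp0. Qed.

End ComplexModulus.

Section ComplexTopology.
Variable R : realType.

Lemma cvg_complexP (T : Type) (F : set_system T) {FF : Filter F} (f : T -> R[i]) z :
  f x @[x --> F] --> z <->
  Re (f x) @[x --> F] --> Re z /\
  Im (f x) @[x --> F] --> Im z.
Proof.
have nE (u : R[i]) : `|u| = (normc u)%:C by [].
split=> [/cvgrPdist_lt fz|[/cvgrPdist_lt fr /cvgrPdist_lt fi]].
  have H e : 0 < e -> \forall t \near F, normc (z - f t) < e.
    move=> e0; have := fz e%:C; rewrite ltcR => /(_ e0).
    by apply: filterS => t; rewrite nE ltcR.
  split; apply/cvgrPdist_lt => e e0; have := H _ e0; apply: filterS => t;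
    apply: le_lt_trans.
  - by rewrite -ReN -ReD normc_Re.
  - by rewrite -ImN -ImD normc_Im.
(* In the order of [R[i]] a positive radius has zero imaginary part, so it amounts to a positive
   real number. *)
apply/cvgrPdist_lt => -[e e'] /=; rewrite ltcE /= => /andP[/eqP -> e0].
have e20 : 0 < e / 2 by rewrite divr_gt0.
apply: filterS2 (fr _ e20) (fi _ e20) => t tr ti.
rewrite nE ltcR; apply: le_lt_trans (normc_le _) _.
by rewrite [ltRHS]splitr ltrD// !ReImE.
Qed.

Lemma continuous_complexP (T : topologicalType) (f : T -> R[i]) t :
  {for t, continuous f} <->
  {for t, continuous (Re \o f)} /\ {for t, continuous (Im \o f)}.
Proof. exact: cvg_complexP. Qed.

Lemma continuous_Re : continuous (@complex.Re R).
Proof. by move=> z; have [] := (cvg_complexP id z).1 (@cvg_id _ (nbhs z)). Qed.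
Lemma continuous_Im : continuous (@complex.Im R).
Proof. by move=> z; have [] := (cvg_complexP id z).1 (@cvg_id _ (nbhs z)). Qed.

Lemma cvg_real_complex (T : Type) (F : set_system T) {FF : Filter F} (f : T -> R) x :
  f t @[t --> F] --> x -> real_complex R (f t) @[t --> F] --> real_complex R x.
Proof. by move=> fx; apply: (cvg_complexP _ _).2; split => //=; exact: cvg_cst. Qed.

Lemma cvg_normc (T : Type) (F : set_system T) {FF : Filter F} (f : T -> R[i]) z :
  f t @[t --> F] --> z -> normc (f t) @[t --> F] --> normc z.
Proof.
move=> /cvg_norm fz.
have := (cvg_complexP _ _).1 fz => -[+ _].
exact.
Qed.

Lemma continuous_Cexp : continuous (@Cexp R).
Proof.
move=> z; have cR := @continuous_Re z; have cI := @continuous_Im z.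
have H1 : real_complex R (expR (Re w)) @[w --> z] --> real_complex R (expR (Re z)).
  exact: (cvg_real_complex (continuous_comp cR (@continuous_expR R _))).
have H2 : cos (Im w) +i* sin (Im w) @[w --> z] --> cos (Im z) +i* sin (Im z).
  have H3 : cos (Im w) @[w --> z] --> cos (Im z) := continuous_comp cI (@continuous_cos R (Im z)).
  have H4 : sin (Im w) @[w --> z] --> sin (Im z) := continuous_comp cI (@continuous_sin R (Im z)).
  have [_ H] := cvg_complexP (fun w => cos (Im w) +i* sin (Im w)) (cos (Im z) +i* sin (Im z)) (F := nbhs z).
  exact: H.
exact: (cvgM H1 H2).
Qed.

Lemma ccontinuousD (T : topologicalType) (f g : T -> R[i]) x : {for x, continuous f} ->
  {for x, continuous g} -> {for x, continuous (fun t => f t + g t)}.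
Proof. by move=> cf cg; exact: (cvgD cf cg). Qed.

Lemma ccontinuousM (T : topologicalType) (f g : T -> R[i]) x : {for x, continuous f} ->
  {for x, continuous g} -> {for x, continuous (fun t => f t * g t)}.
Proof. by move=> cf cg; exact: (cvgM cf cg). Qed.

Lemma ccontinuousZ (T : topologicalType) (c : R[i]) (f : T -> R[i]) x : {for x, continuous f} ->
  {for x, continuous (fun t => c * f t)}.
Proof. by move=> cf; exact: (cvgM (cvg_cst c) cf). Qed.

Lemma continuous_re_im (d : R -> R) (y : R) : {for y, continuous d} ->
  {for y, continuous (fun u : R => d u +i* u)}.
Proof.
move=> cd; have [_ H] := @cvg_complexP _ _ (nbhs_filter y) (fun u : R => d u +i* u) (d y +i* y).
by apply: H; split => /=; [exact: cd|exact: cvg_id].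
Qed.

Lemma cvgy_normc0 (T : Type) (F : set_system T) {FF : Filter F} (f : T -> R[i]) (g : T -> R) :
  (\forall t \near F, normc (f t) <= g t) -> g t @[t --> F] --> 0 -> f t @[t --> F] --> 0.
Proof.
move=> fg /cvgr0Pnorm_lt g0; apply/cvgr0Pnorm_lt => -[e e'].
rewrite ltcE /= => /andP[/eqP -> e0].
have nE (u : R[i]) : `|u| = (normc u)%:C by [].
apply: filterS2 fg (g0 _ e0) => t h1 h2.
by rewrite nE ltcR; apply: le_lt_trans h1 _; apply: le_lt_trans h2; rewrite ler_norm.
Qed.

End ComplexTopology.

Section ComplexDerivative.
Variable R : realType.
Implicit Types (F G : R[i] -> R[i]) (z : R[i]).

(* Caratheodory's form of complex differentiability: it composes with both
   complex functions and differentiable paths without any o-calculus. *)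
Definition cderivative F z d := exists Q : R[i] -> R[i],
  [/\ forall w, F w - F z = Q w * (w - z), {for z, continuous Q} & Q z = d].

Definition path_derivative (s : R -> R[i]) (t : R) (d : R[i]) :=
  is_derive t 1 (Re \o s) (Re d) /\
  is_derive t 1 (Im \o s) (Im d).

(** Translates componentwise real derivatives into a Caratheodory factorization, in which the
    product rule and the chain rule with [cderivative] are plain algebra. *)
Lemma path_derivativeP s t d : path_derivative s t d <->
  exists q : R -> R[i],
    [/\ forall u, s u - s t = q u * (u - t)%:C, {for t, continuous q} & q t = d].
Proof.
split=> [[/is_derive1_caratheodory[g [g1 g2 g3]] /is_derive1_caratheodory[h [h1 h2 h3]]]|[q [q1 q2 q3]]].
  exists (fun u => g u +i* h u); split => //.
  - move=> u; apply: complex_ext; rewrite !ReImE /= mulr0 ?subr0 ?add0r; [exact: g1|exact: h1].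
  - by apply/continuous_complexP.
  - by rewrite g3 h3; case: (d).
have [q21 q22] := (continuous_complexP _ _).1 q2.
split; apply/is_derive1_caratheodory.
  exists (Re \o q); split => //=; rewrite ?q3 //.
  by move=> u; rewrite -ReN -ReD q1 !ReImE /= mulr0 subr0.
exists (Im \o q); split => //=; rewrite ?q3 //.
by move=> u; rewrite -ImN -ImD q1 !ReImE /= mulr0 add0r.
Qed.

Lemma path_derivative_comp F s t d d' : cderivative F (s t) d ->
  path_derivative s t d' -> path_derivative (F \o s) t (d * d').
Proof.
move=> [Q [Q1 Q2 Q3]] /path_derivativeP[q [q1 q2 q3]].
apply/path_derivativeP; exists (fun u => Q (s u) * q u); split.
- by move=> u /=; rewrite Q1 q1 mulrA.
- have cs : {for t, continuous s}; last exact: (cvgM (continuous_comp cs Q2) q2).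
  have H : (u - t) @[u --> t] --> t - t by apply: cvgB; [exact: cvg_id|exact: cvg_cst].
  have H2 := cvgD (cvg_cst (s t)) (cvgM q2 (cvg_real_complex H)).
  rewrite subrr mulr0 addr0 in H2.
  pose g u := s t + q u * (u - t)%:C.
  have gs : g = s by apply/funext => u; rewrite /g -q1 addrC subrK.
  have : g u @[u --> t] --> s t by exact: H2.
  by rewrite gs.
- by rewrite Q3 q3.
Qed.

Lemma path_derivative_continuous s t d : path_derivative s t d -> {for t, continuous s}.
Proof.
move=> [[d1 _] [d2 _]]; apply/continuous_complexP.
split; [have c := (@differentiable_continuous _ R R _ _ ((derivable1_diffP _ _).1 d1))
  |have c := (@differentiable_continuous _ R R _ _ ((derivable1_diffP _ _).1 d2))]; exact: c.
Qed.

Lemma path_derivativeM s r t ds dr : path_derivative s t ds -> path_derivative r t dr ->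
  path_derivative (fun u => s u * r u) t (ds * r t + s t * dr).
Proof.
move=> Hs /[dup] Hr /path_derivativeP[q [q1 q2 q3]].
have cs := path_derivative_continuous Hs.
move: Hs => /path_derivativeP[p [p1 p2 p3]].
apply/path_derivativeP; exists (fun u => p u * r t + s u * q u); split.
- move=> u; rewrite mulrDl -mulrA [r t * _]mulrC mulrA -p1 -mulrA -q1; ring.
- exact: (cvgD (cvgM p2 (cvg_cst (r t))) (cvgM cs q2)).
- by rewrite p3 q3.
Qed.

Lemma path_derivativeD s r t ds dr : path_derivative s t ds -> path_derivative r t dr ->
  path_derivative (fun u => s u + r u) t (ds + dr).
Proof.
move=> /path_derivativeP[p [p1 p2 p3]] /path_derivativeP[q [q1 q2 q3]].
apply/path_derivativeP; exists (fun u => p u + q u); split.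
- move=> u; rewrite mulrDl -p1 -q1; ring.
- exact: (cvgD p2 q2).
- by rewrite p3 q3.
Qed.

Lemma path_derivative_real (f : R -> R) (t d : R) : is_derive t 1 f d ->
  path_derivative (fun u => (f u)%:C) t d%:C.
Proof. by move=> fd; split => //=; exact: is_derive_cst. Qed.

Lemma path_derivative_cst (c : R[i]) t : path_derivative (fun=> c) t 0.
Proof. by split; exact: is_derive_cst. Qed.

Lemma cderivative_continuous F z d : cderivative F z d -> {for z, continuous F}.
Proof.
move=> [Q [Q1 Q2 Q3]]; rewrite /continuous_at.
have H2 := cvgD (cvg_cst (F z))
  (cvgM Q2 (cvgB (@cvg_id _ (nbhs z)) (cvg_cst z))).
rewrite subrr mulr0 addr0 in H2.
pose g u := F z + Q u * (u - z).
have gF : g = F by apply/funext => u; rewrite /g -Q1 addrC subrK.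
have : g u @[u --> z] --> F z by exact: H2.
by rewrite gF.
Qed.

(** The difference quotient, completed by [d] at [z], is a factor valid everywhere; near [z] it
    coincides with [Q] and inherits its continuity. *)
Lemma cderivative_near F z d Q : (\forall w \near z, F w - F z = Q w * (w - z)) ->
  {for z, continuous Q} -> Q z = d -> cderivative F z d.
Proof.
move=> FQ cQ Qz; exists (fun w => if w == z then d else (F w - F z) / (w - z)).
split; last by rewrite eqxx.
- by move=> w; case: eqP => [->|/eqP wz]; rewrite ?subrr ?mulr0// divfK// subr_eq0.
- pose g w := if w == z then d else (F w - F z) / (w - z).
  have gz : g z = Q z by rewrite /g eqxx.
  have gQ : \forall w \near z, g w = Q w.
    apply: filterS FQ => w Fw; rewrite /g Fw; case: eqP => [->//|/eqP wz].
    by rewrite mulfK// subr_eq0.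
  suff: g w @[w --> z] --> g z by [].
  move=> A; rewrite gz => /cQ QA.
  by apply: filterS2 gQ QA => w /= ->.
Qed.

Lemma cderivativeM F G z dF dG : cderivative F z dF -> cderivative G z dG ->
  cderivative (fun w => F w * G w) z (dF * G z + F z * dG).
Proof.
move=> Hs /[dup] Hr [q [q1 q2 q3]].
have cs := cderivative_continuous Hs.
move: Hs => [p [p1 p2 p3]].
exists (fun u => p u * G z + F u * q u); split.
- move=> u; rewrite mulrDl -mulrA [G z * _]mulrC mulrA -p1 -mulrA -q1; ring.
- exact: (cvgD (cvgM p2 (cvg_cst (G z))) (cvgM cs q2)).
- by rewrite p3 q3.
Qed.

Lemma cderivative_comp F G z dF dG : cderivative F (G z) dF -> cderivative G z dG ->
  cderivative (F \o G) z (dF * dG).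
Proof.
move=> [q [q1 q2 q3]] /[dup] HG [p [p1 p2 p3]].
exists (fun u => q (G u) * p u); split.
- by move=> u /=; rewrite q1 p1 mulrA.
- exact: (cvgM (continuous_comp (cderivative_continuous HG) q2) p2).
- by rewrite q3 p3.
Qed.

Lemma cderivative_affine (a b : R[i]) z : cderivative (fun w => a + b * w) z b.
Proof.
exists (fun=> b); split => [w||//]; first by ring.
have c := @cst_continuous R[i] R[i] b z; exact: c.
Qed.

Lemma cderivative_inv z : z != 0 -> cderivative (fun w => w^-1) z (- z ^- 2).
Proof.
move=> z0; apply: (@cderivative_near _ _ _ (fun w => - (w^-1 / z))).
- have : \forall w \near z, w != 0.
    have /cvgrPdist_lt/(_ `|z|) := @cvg_id _ (nbhs z).
    rewrite normr_gt0 z0 => /(_ isT); apply: filterS => w.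
    by apply: contraTneq => ->; rewrite subr0 ltxx.
  apply: filterS => w w0; field; exact/andP.
- exact: (cvgN (cvgM (cvgV z0 (@cvg_id _ (nbhs z))) (cvg_cst z^-1))).
- by rewrite -invfM -expr2.
Qed.

(* The second condition is what the exchange of integrals in the homotopy
   argument requires. *)
Definition C1at F F' z := cderivative F z (F' z) /\ {for z, continuous F'}.

End ComplexDerivative.

(* Otherwise [normc (z * w)] matches [normc (Cexp _)] and [normc (Cpow _ _)]. *)
#[global] Opaque Cexp Cpow.
#[global] Arguments ComplexField.Normc.normc : simpl never.

(** * Integrals of real functions *)

Section RealIntegral.
Variable R : realType.
Local Notation mu := (@lebesgue_measure R).
Implicit Types (D E : set R) (f g : R -> R).

(** Dominated convergence for the restrictions of [f] to the sets [Dn n], with majorant [|f|]. *)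
Lemma Rintegral_exhaust D (Dn : nat -> set R) f :
  measurable D -> (forall n, measurable (Dn n)) -> (forall n, Dn n `<=` D) ->
  (forall x, D x -> \forall n \near \oo, Dn n x) ->
  mu.-integrable D (EFin \o f) ->
  Rintegral mu (Dn n) f @[n --> \oo] --> Rintegral mu D f.
Proof.
move=> mD mDn DnD exh intf.
have/integrableP[mf _] := intf.
have [] := @dominated_convergence _ _ R mu D mD
  (fun n => (EFin \o f) \_ (Dn n)) (EFin \o f) (abse \o (EFin \o f)).
- move=> n; apply/(measurable_restrict _ (mDn n) mD).
  by apply: measurable_funS mf => //; exact: subIsetl.
- exact: mf.
- apply: aeW => x Dx; apply: cvg_near_cst.
  apply: filterS (exh x Dx) => n Dnx.
  by rewrite patchE mem_set.
- exact: integrable_abse.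
- apply: aeW => x n Dx; rewrite patchE; case: ifPn => _ //=; by rewrite normr0 lee_fin normr_ge0.
move=> _ _ cv.
rewrite (_ : (fun n => _) =
  fun n => fine (\int[mu]_(x in D) ((EFin \o f) \_ (Dn n)) x)%E); last first.
  by apply/funext => n; rewrite -integral_mkcondr setIidr.
apply: fine_cvg; rewrite fineK; first exact: cv.
exact: (integrable_fin_num _ intf).
Qed.

Lemma Rintegral_FTC D (a b : nat -> R) (F f : R -> R) l :
  measurable D -> (forall n, a n < b n) -> (forall n, `[a n, b n]%classic `<=` D) ->
  (forall x, D x -> \forall n \near \oo, `[a n, b n]%classic x) ->
  (forall x, D x -> is_derive x 1 F (f x)) ->
  (forall x, D x -> {for x, continuous f}) ->
  mu.-integrable D (EFin \o f) ->
  F (b n) - F (a n) @[n --> \oo] --> l -> Rintegral mu D f = l.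
Proof.
move=> mD ab abD exh dF cf intf Fl.
have H := Rintegral_exhaust mD (fun n => measurable_itv `[a n, b n]) abD exh intf.
have cF x : D x -> {for x, continuous F}.
  by move=> /dF[+ _] => /derivable1_diffP/differentiable_continuous.
suff E n : Rintegral mu `[a n, b n] f = F (b n) - F (a n).
  have HE : (fun n => Rintegral mu `[a n, b n] f) = (fun n => F (b n) - F (a n)).
    by apply/funext.
  by rewrite HE in H; exact: (norm_cvg_unique H Fl).
rewrite /Rintegral (@continuous_FTC2 _ f F)//.
- apply/continuous_in_subspaceT => x /set_mem xab; exact: (cf _ (abD n _ xab)).
- have aD : D (a n) by apply: (abD n); rewrite /= in_itv/= lexx ltW.
  have bD : D (b n) by apply: (abD n); rewrite /= in_itv/= lexx ltW.
  split.
  + move=> x /subset_itv_oo_cc xab; by have [] := dF x (abD n _ xab).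
  + by apply: cvg_at_right_filter; exact: cF.
  + by apply: cvg_at_left_filter; exact: cF.
- by move=> x /subset_itv_oo_cc xab; rewrite derive1E; have [_ ->] := dF x (abD n _ xab).
Qed.

Lemma exhaust_pos_itv (n : nat) : `[n.+1%:R^-1, n.+2%:R]%classic `<=` (`]0, +oo[%classic : set R).
Proof. by move=> x /=; rewrite !in_itv /= andbT => /andP[+ _]; apply: lt_le_trans; rewrite invr_gt0. Qed.

Lemma exhaust_pos (x : R) : `]0, +oo[%classic x ->
  \forall n \near \oo, `[n.+1%:R^-1, n.+2%:R]%classic x.
Proof.
rewrite /= in_itv/= andbT => x0.
near=> n; rewrite /= in_itv /=; apply/andP; split.
  rewrite invf_ple ?posrE//; apply: (@le_trans _ _ n%:R); last by rewrite ler_nat.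
  by near: n; exact: nbhs_infty_ger.
apply: (@le_trans _ _ n%:R); last by rewrite ler_nat ltnW.
by near: n; exact: nbhs_infty_ger.
Unshelve. all: by end_near. Qed.

Lemma Rintegral_pos_FTC (F f : R -> R) (l l' : R) :
  (forall x : R, 0 < x -> is_derive x 1 F (f x)) ->
  (forall x : R, 0 < x -> {for x, continuous f}) ->
  mu.-integrable `]0, +oo[ (EFin \o f) ->
  F x @[x --> 0^'+] --> l' -> F x @[x --> +oo%R] --> l ->
  Rintegral mu `]0, +oo[ f = l - l'.
Proof.
move=> dF cf intf F0 Fy.
apply: (@Rintegral_FTC _ (fun n => n.+1%:R^-1) (fun n => n.+2%:R) F) => //.
- move=> n; apply: (@le_lt_trans _ _ 1); last by rewrite (ltr_nat R 1).
  by rewrite invf_le1// ler1n.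
- exact: exhaust_pos_itv.
- by move=> x; exact: exhaust_pos.
- by move=> x /=; rewrite in_itv/= andbT; exact: dF.
- by move=> x /=; rewrite in_itv/= andbT; exact: cf.
- apply: cvgB.
    apply: (@cvg_comp _ _ _ (fun n : nat => n.+2%:R) F _ _ _ _ Fy).
    apply/cvgryPge => A; near=> n; apply: (@le_trans _ _ n%:R); last by rewrite ler_nat -addn2 leq_addr.
    by near: n; exact: nbhs_infty_ger.
  apply: (@cvg_comp _ _ _ (fun n : nat => n.+1%:R^-1) F _ _ _ _ F0).
  move=> A HA; suff : \forall n \near \oo, A (n.+1%:R^-1) by [].
  have [e /= e0 eA] := HA.
  have /cvgrPdist_lt/(_ e e0) := @cvg_harmonic R.
  apply: filterS => n ne; apply: eA; first exact: ne.
  by rewrite /= invr_gt0.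
Unshelve. all: by end_near. Qed.

(** Substitution on compact intervals, followed by a limit: [phi] is increasing with arbitrarily
    small and large values, so the images of the intervals that exhaust the half-line exhaust it
    again. *)
Lemma substitution_pos (phi phi' G : R -> R) :
  (forall x : R, 0 < x -> 0 < phi x) ->
  (forall x : R, 0 < x -> is_derive x 1 phi (phi' x)) ->
  (forall x : R, 0 < x -> 0 < phi' x) ->
  (forall x : R, 0 < x -> {for x, continuous phi'}) ->
  (forall y : R, 0 < y -> exists2 x, 0 < x & phi x < y) ->
  (forall y, exists2 x, 0 < x & y < phi x) ->
  (forall x : R, 0 < x -> {for x, continuous G}) ->
  mu.-integrable `]0, +oo[ (EFin \o G) ->
  mu.-integrable `]0, +oo[ (EFin \o (fun x => G (phi x) * phi' x)) /\
  Rintegral mu `]0, +oo[ (fun x => G (phi x) * phi' x) = Rintegral mu `]0, +oo[ G.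
Proof.
move=> phi0 dphi phi'0 cphi' phis phil cG intG.
pose a (n : nat) : R := n.+1%:R^-1; pose b (n : nat) : R := n.+2%:R.
have a0 n : 0 < a n by rewrite invr_gt0.
have ab n : a n < b n.
  apply: (@le_lt_trans _ _ 1); last by rewrite (ltr_nat R 1).
  by rewrite invf_le1// ler1n.
have cphi (x : R) : 0 < x -> {for x, continuous phi}.
  by move=> x0; have [+ _] := dphi x x0 => /derivable1_diffP/differentiable_continuous.
have Dphi (x : R) : 0 < x -> derive1 phi x = phi' x.
  by move=> x0; rewrite derive1E; have [_ ->] := dphi x x0.
have mono (x y : R) : 0 < x -> x < y -> phi x < phi y.
  move=> x0 xy; have := @gtr0_derive1_incr R phi x y _ _ _ x y (lexx _) xy (lexx _); apply.
  - move=> z; rewrite in_itv/= => /andP[xz _].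
    by have [] := dphi z (lt_trans x0 xz).
  - by move=> z; rewrite in_itv/= => /andP[xz _]; rewrite Dphi ?phi'0// (lt_trans x0 xz).
  - apply/continuous_in_subspaceT => z /set_mem; rewrite /= in_itv/= => /andP[xz _].
    exact/cphi/(lt_le_trans x0 xz).
(* Stated for a general [K] because it serves twice: for [|G|], to obtain integrability, and for
   [G], to compare the integrals. *)
have H (K : R -> R) n : (forall x : R, 0 < x -> {for x, continuous K}) ->
   (\int[mu]_(x in `[phi (a n), phi (b n)]) (K x)%:E =
    \int[mu]_(x in `[a n, b n]) (K (phi x) * phi' x)%:E)%E.
  move=> cK; rewrite integration_by_substitution_increasing ?(ltW (ab n))//.
  - apply: eq_integral => x /set_mem; rewrite /= in_itv/= => /andP[ax _].
    rewrite (_ : ((K \o phi) * derive1 phi) x = K (phi x) * derive1 phi x)//.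
    by rewrite Dphi// (lt_le_trans (a0 n)).
  - move=> x y; rewrite !in_itv/= => /andP[ax _] _; apply: mono.
    exact: lt_le_trans ax.
  - move=> x; rewrite in_itv/= => /andP[ax _].
    have x0 : 0 < x by apply: lt_trans ax.
    have E : \forall y \near x, phi' y = derive1 phi y.
      near=> y; rewrite Dphi//; near: y; exact: lt_nbhsr.
    have c : phi' y @[y --> x] --> phi' x := cphi' x x0.
    rewrite /continuous_at Dphi//; move=> A /c; apply: filterS2 E => y /= ->.
    by [].
  - have E : \forall y \near (a n)^'+, phi' y = derive1 phi y.
      near=> y; rewrite Dphi//; apply: (lt_trans (a0 n)); near: y; exact: nbhs_right_gt.
    have c : phi' y @[y --> (a n)^'+] --> phi' (a n).
      by apply: cvg_at_right_filter; exact: cphi'.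
    apply/cvg_ex; exists (phi' (a n)) => A /c; apply: filterS2 E => y /= ->.
    by [].
  - have b0 : 0 < b n by apply: lt_trans (ab n).
    have E : \forall y \near (b n)^'-, phi' y = derive1 phi y.
      near=> y; rewrite Dphi//; near: y; exact: nbhs_left_gt.
    have c : phi' y @[y --> (b n)^'-] --> phi' (b n).
      by apply: cvg_at_left_filter; exact: cphi'.
    apply/cvg_ex; exists (phi' (b n)) => A /c; apply: filterS2 E => y /= ->.
    by [].
  - split.
    + move=> x; rewrite in_itv/= => /andP[ax _].
      by have [] := dphi x (lt_trans (a0 n) ax).
    + by apply: cvg_at_right_filter; exact: cphi.
    + by apply: cvg_at_left_filter; apply: cphi; exact: lt_trans (ab n).
  - apply/continuous_in_subspaceT => z /set_mem; rewrite /= in_itv/= => /andP[xz _].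
    apply: cK; exact: lt_le_trans (phi0 _ (a0 n)) xz.
have EnD n : `[phi (a n), phi (b n)]%classic `<=` (`]0, +oo[%classic : set R).
  by move=> x /=; rewrite !in_itv/= andbT => /andP[+ _]; apply: lt_le_trans; exact: phi0.
have Enx (x : R) : `]0, +oo[%classic x -> \forall n \near \oo, `[phi (a n), phi (b n)]%classic x.
  rewrite /= in_itv/= andbT => x0.
  have [y1 y10 xy1] := phis _ x0; have [y2 y20 xy2] := phil x.
  have := exhaust_pos (x := y1); have := exhaust_pos (x := y2).
  rewrite /= !in_itv/= !andbT => /(_ y20) h2 /(_ y10) h1.
  apply: filterS2 h1 h2 => n /=; rewrite !in_itv/= => /andP[h11 h12] /andP[h21 h22].
  apply/andP; split.
    apply: ltW; apply: le_lt_trans xy1; move: h11; rewrite le_eqVlt => /predU1P[<-//|].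
    by move/mono => /(_ (a0 n))/ltW.
  apply: ltW; apply: (lt_le_trans xy2); move: h22; rewrite le_eqVlt => /predU1P[->//|].
  by move/mono => /(_ y20)/ltW.
pose h x := G (phi x) * phi' x.
have mpos : measurable (`]0, +oo[%classic : set R) by exact: measurable_itv.
have mh : measurable_fun (`]0, +oo[%classic : set R) h.
  apply: open_continuous_measurable_fun; first exact: interval_open.
  move=> x /set_mem; rewrite /= in_itv/= andbT => x0.
  apply: continuousM; last exact: cphi'.
  apply: continuous_comp; first exact: cphi.
  exact/cG/phi0.
have inth : mu.-integrable `]0, +oo[ (EFin \o h).
  apply/integrableP; split; first exact/measurable_EFinP.
  have bigE : \bigcup_n `[a n, b n]%classic = (`]0, +oo[%classic : set R).
    apply/seteqP; split => [x [n _ /exhaust_pos_itv//]|x /exhaust_pos[N _ HN]].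
    by exists N => //; apply: HN => /=.
  have nd : {homo (fun n => `[a n, b n]%classic) : n m / (n <= m)%N >-> (n <= m)%O}.
    move=> n m nm; rewrite subsetEset; apply: subset_itv; rewrite bnd_simp.
      by rewrite lef_pV2 ?posrE// ler_nat.
    by rewrite ler_nat ltnS ltnS.
  have cv : (\int[mu]_(x in `[a i, b i]) `|(EFin \o h) x| @[i --> \oo] -->
     \int[mu]_(x in `]0%R, +oo[) `|(EFin \o h) x|)%E.
    rewrite -bigE; apply: ge0_nondecreasing_set_cvg_integral => //.
    move=> i; apply: measurableT_comp => //; apply/measurable_EFinP.
    apply: measurable_funS mh => //; exact: exhaust_pos_itv.
  have/integrableP[_ fG] := intG; apply: le_lt_trans fG.
  rewrite -(cvg_lim (@ereal_hausdorff R) cv).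
  apply: (lime_le (cvgP _ cv)).
  apply: nearW => n.
  rewrite (_ : (\int[mu]_(x in `[a n, b n]) _ =
     \int[mu]_(x in `[a n, b n]) (`|G (phi x)| * phi' x)%:E)%E); last first.
    apply: eq_integral => x /set_mem; rewrite /= in_itv/= => /andP[ax _].
    by rewrite /h normrM [`|phi' _|]gtr0_norm// phi'0// (lt_le_trans (a0 n)).
  rewrite -(H (fun x => `|G x|)); last first.
    by move=> x x0; exact: (cvg_norm (cG x x0)).
  apply: ge0_subset_integral => //.
  have /integrableP[/measurable_EFinP mG _] := intG.
  by apply/measurable_EFinP; exact: measurableT_comp.
split; first exact: inth.
have L1 := Rintegral_exhaust mpos (fun n => measurable_itv `[phi (a n), phi (b n)]) EnD Enx intG.
have L2 := Rintegral_exhaust mpos (fun n => measurable_itv `[a n, b n]) exhaust_pos_itv exhaust_pos inth.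
rewrite (_ : (fun n => Rintegral mu `[phi (a n), phi (b n)] G) =
  (fun n => Rintegral mu `[a n, b n] h)) in L1; last first.
  by apply/funext => n; rewrite /Rintegral H.
exact: (norm_cvg_unique L2 L1).
Unshelve. all: by end_near. Qed.

End RealIntegral.

(** * Integrals of complex functions *)

Section ComplexIntegral.
Variable R : realType.
Local Notation mu := (@lebesgue_measure R).

Definition cmeasurable d (T : measurableType d) (D : set T) (f : T -> R[i]) :=
  measurable_fun D (fun x => Re (f x)) /\ measurable_fun D (fun x => Im (f x)).

Definition cintegrable (D : set R) (f : R -> R[i]) :=
  mu.-integrable D (EFin \o (fun x => Re (f x))) /\
  mu.-integrable D (EFin \o (fun x => Im (f x))).

Section Measurability.
Context d (T : measurableType d).
Implicit Types (D : set T) (f g : T -> R[i]).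

Lemma cmeasurableM D f g : cmeasurable D f -> cmeasurable D g ->
  cmeasurable D (fun x => f x * g x).
Proof.
move=> [f1 f2] [g1 g2]; split.
- under eq_fun do rewrite ReM.
  by apply: measurable_funB; apply: measurable_funM.
- under eq_fun do rewrite ImM.
  by apply: measurable_funD; apply: measurable_funM.
Qed.

Lemma cmeasurableD D f g : cmeasurable D f -> cmeasurable D g ->
  cmeasurable D (fun x => f x + g x).
Proof.
move=> [f1 f2] [g1 g2]; split.
- by under eq_fun do rewrite ReD; apply: measurable_funD.
- by under eq_fun do rewrite ImD; apply: measurable_funD.
Qed.

Lemma cmeasurable_cst D c : cmeasurable D (fun=> c).
Proof. by split; exact: measurable_cst. Qed.

Lemma cmeasurable_sum (I : eqType) (r : seq I) D (f : I -> T -> R[i]) :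
  (forall i, i \in r -> cmeasurable D (f i)) -> cmeasurable D (fun x => \sum_(i <- r) f i x).
Proof.
elim: r => [|i r IH] mf.
  by under eq_fun do rewrite big_nil; exact: cmeasurable_cst.
under eq_fun do rewrite big_cons.
apply: cmeasurableD; first by apply: mf; rewrite mem_head.
by apply: IH => j jr; apply: mf; rewrite inE jr orbT.
Qed.

Lemma cmeasurable_real D (f : T -> R) : measurable_fun D f ->
  cmeasurable D (fun x => (f x)%:C).
Proof. by move=> mf; split => //=; exact: measurable_cst. Qed.

Lemma cmeasurable_Cexp D f : cmeasurable D f -> cmeasurable D (fun x => Cexp (f x)).
Proof.
move=> [f1 f2].
have mc : measurable_fun setT (@cos R) by apply: continuous_measurable_fun; exact: continuous_cos.
have ms : measurable_fun setT (@sin R) by apply: continuous_measurable_fun; exact: continuous_sin.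
have me : measurable_fun D (fun x => expR (Re (f x))) by apply: measurableT_comp => //; exact: measurable_expR.
split.
- rewrite (_ : (fun x => _) = (fun x => expR (Re (f x)) * cos (Im (f x)))).
    by apply: measurable_funM => //; exact: (measurableT_comp mc f2).
  by apply/funext => x; rewrite !CexpE ReM /= mul0r subr0.
- rewrite (_ : (fun x => _) = (fun x => expR (Re (f x)) * sin (Im (f x)))).
    by apply: measurable_funM => //; exact: (measurableT_comp ms f2).
  by apply/funext => x; rewrite !CexpE ImM /= mul0r addr0.
Qed.

Lemma cmeasurable_Cpow D (x : T -> R) f : measurable_fun D x -> cmeasurable D f ->
  cmeasurable D (fun t => Cpow (x t) (f t)).
Proof.
move=> mx mf; apply: cmeasurable_Cexp; apply: cmeasurableM => //.
apply: cmeasurable_real; apply: measurableT_comp => //; exact: measurable_ln.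
Qed.

Lemma cmeasurable_normc D f : cmeasurable D f -> measurable_fun D (fun x => normc (f x)).
Proof.
move=> [f1 f2].
have ms : measurable_fun setT (@Num.sqrt R) by apply: continuous_measurable_fun; exact: sqrt_continuous.
rewrite (_ : (fun x => _) = (fun x => Num.sqrt (Re (f x) ^+ 2 + Im (f x) ^+ 2))).
  by apply: (measurableT_comp ms); apply: measurable_funD; exact: measurable_funX.
by apply/funext => x; case: (f x).
Qed.

End Measurability.

Lemma cmeasurable_comp d1 d2 (T1 : measurableType d1) (T2 : measurableType d2)
  (f : T2 -> R[i]) (g : T1 -> T2) D : cmeasurable setT f -> measurable_fun D g ->
  cmeasurable D (fun x => f (g x)).
Proof. by move=> [f1 f2] mg; split; [exact: (measurableT_comp f1 mg)|exact: (measurableT_comp f2 mg)]. Qed.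

Lemma cmeasurable_continuous (f : R -> R[i]) : (forall x, {for x, continuous f}) ->
  cmeasurable setT f.
Proof.
move=> cf; split; apply: continuous_measurable_fun => x; have := cf x;
  by move=> /continuous_complexP[].
Qed.

Implicit Types (D E : set R) (f g : R -> R[i]).

Lemma cintegrable_le D f (g : R -> R) : measurable D -> cmeasurable D f ->
  mu.-integrable D (EFin \o g) -> (forall x, D x -> normc (f x) <= g x) ->
  cintegrable D f.
Proof.
move=> mD [f1 f2] ig fg; split; apply: le_integrable ig => //; try exact/measurable_EFinP.
- move=> x Dx; rewrite /= lee_fin; apply: le_trans (normc_Re _) _.
  by apply: le_trans (fg _ Dx) _; rewrite ler_norm.
- move=> x Dx; rewrite /= lee_fin; apply: le_trans (normc_Im _) _.
  by apply: le_trans (fg _ Dx) _; rewrite ler_norm.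
Qed.

Lemma eq_Cintegral D f g : (forall x, D x -> f x = g x) -> Cintegral D f = Cintegral D g.
Proof.
move=> fg; rewrite /Cintegral; congr (_ +i* _); apply: eq_Rintegral => x /set_mem Dx;
  by rewrite fg.
Qed.

Lemma eq_cintegrable D f g : measurable D -> (forall x, D x -> f x = g x) -> cintegrable D f ->
  cintegrable D g.
Proof.
move=> mD fg [f1 f2]; split; [apply: eq_integrable f1|apply: eq_integrable f2] => // x /set_mem Dx /=;
  by rewrite fg.
Qed.

Lemma CintegralZl D c f : measurable D -> cintegrable D f ->
  Cintegral D (fun x => c * f x) = c * Cintegral D f.
Proof.
move=> mD [f1 f2].
have i1 k : mu.-integrable D (EFin \o (fun x => k * Re (f x))) by apply: (integrableZl _ k f1).
have i2 k : mu.-integrable D (EFin \o (fun x => k * Im (f x))) by apply: (integrableZl _ k f2).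
apply: complex_ext; rewrite ?ReM ?ImM /=.
- under eq_Rintegral do rewrite ReM.
  by rewrite RintegralB// !RintegralZl.
- under eq_Rintegral do rewrite ImM.
  by rewrite RintegralD// !RintegralZl.
Qed.

Lemma cintegrableZl D c f : measurable D -> cintegrable D f ->
  cintegrable D (fun x => c * f x).
Proof.
move=> mD [f1 f2].
have i1 k : mu.-integrable D (EFin \o (fun x => k * Re (f x))) by apply: (integrableZl _ k f1).
have i2 k : mu.-integrable D (EFin \o (fun x => k * Im (f x))) by apply: (integrableZl _ k f2).
split.
- rewrite (_ : EFin \o _ = (fun x => (Re c * Re (f x))%:E - (Im c * Im (f x))%:E)%E).
    exact: (integrableB _ (i1 _) (i2 _)).
  by apply/funext => x /=; rewrite ReM EFinB.
- rewrite (_ : EFin \o _ = (fun x => (Re c * Im (f x))%:E + (Im c * Re (f x))%:E)%E).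
    exact: (integrableD _ (i2 _) (i1 _)).
  by apply/funext => x /=; rewrite ImM EFinD.
Qed.

Lemma CintegralD D f g : measurable D -> cintegrable D f -> cintegrable D g ->
  Cintegral D (fun x => f x + g x) = Cintegral D f + Cintegral D g.
Proof.
move=> mD [f1 f2] [g1 g2]; apply: complex_ext; rewrite ?ReD ?ImD /=.
- by under eq_Rintegral do rewrite ReD; rewrite RintegralD.
- by under eq_Rintegral do rewrite ImD; rewrite RintegralD.
Qed.

Lemma cintegrableD D f g : measurable D -> cintegrable D f -> cintegrable D g ->
  cintegrable D (fun x => f x + g x).
Proof.
move=> mD [f1 f2] [g1 g2]; split.
- rewrite (_ : EFin \o _ = (fun x => (Re (f x))%:E + (Re (g x))%:E)%E); first exact: integrableD.
  by apply/funext => x /=; rewrite ReD EFinD.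
- rewrite (_ : EFin \o _ = (fun x => (Im (f x))%:E + (Im (g x))%:E)%E); first exact: integrableD.
  by apply/funext => x /=; rewrite ImD EFinD.
Qed.

Lemma Cintegral_sum (I : eqType) (r : seq I) D (f : I -> R -> R[i]) : measurable D ->
  (forall i, i \in r -> cintegrable D (f i)) ->
  cintegrable D (fun x => \sum_(i <- r) f i x) /\
  Cintegral D (fun x => \sum_(i <- r) f i x) = \sum_(i <- r) Cintegral D (f i).
Proof.
move=> mD; elim: r => [|i r IH] intf.
  split.
    apply: (@eq_cintegrable _ (fun=> 0)) => // [x _|]; first by rewrite big_nil.
    by split; exact: integrable0.
  rewrite big_nil (@eq_Cintegral _ _ (fun=> 0)); last by move=> x _; rewrite big_nil.
  by rewrite /Cintegral /= /Rintegral integral0 /=.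
have inti : cintegrable D (f i) by apply: intf; rewrite mem_head.
have [IH1 IH2] := IH (fun j jr => intf j (mem_behead (s := i :: r) jr)).
have E x : \sum_(j <- i :: r) f j x = f i x + \sum_(j <- r) f j x by rewrite big_cons.
split.
  apply: (eq_cintegrable (f := fun x => f i x + \sum_(j <- r) f j x)) => //.
  exact: cintegrableD.
rewrite big_cons -IH2 -CintegralD//; exact: eq_Cintegral.
Qed.

Lemma Cintegral_real D (f : R -> R) : Cintegral D (fun x => (f x)%:C) = (Rintegral mu D f)%:C.
Proof. by rewrite /Cintegral /= /Rintegral integral0. Qed.

(** The two components are bounded separately, whence the factor 2; the constants in the
    nonvanishing of Gamma are chosen with it in mind. *)
Lemma normc_Cintegral D f (g : R -> R) : measurable D -> cintegrable D f ->
  mu.-integrable D (EFin \o g) -> (forall x, D x -> normc (f x) <= g x) ->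
  normc (Cintegral D f) <= 2 * Rintegral mu D g.
Proof.
move=> mD [f1 f2] ig fg; apply: le_trans (normc_le _) _.
rewrite mulr_natl mulr2n lerD//=.
- apply: le_trans (le_normr_Rintegral _ _) _ => //; apply: le_Rintegral => //.
    exact: integrable_norm f1.
  by move=> x Dx; apply: le_trans (normc_Re _) (fg _ Dx).
- apply: le_trans (le_normr_Rintegral _ _) _ => //; apply: le_Rintegral => //.
    exact: integrable_norm f2.
  by move=> x Dx; apply: le_trans (normc_Im _) (fg _ Dx).
Qed.

Lemma Cintegral_FTC D (a b : nat -> R) (F f : R -> R[i]) l :
  measurable D -> (forall n, a n < b n) -> (forall n, `[a n, b n]%classic `<=` D) ->
  (forall x, D x -> \forall n \near \oo, `[a n, b n]%classic x) ->
  (forall x, D x -> path_derivative F x (f x)) ->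
  (forall x, D x -> {for x, continuous f}) ->
  cintegrable D f ->
  F (b n) - F (a n) @[n --> \oo] --> l -> Cintegral D f = l.
Proof.
move=> mD ab abD exh dF cf [f1 f2] Fl.
have [l1 l2] := (cvg_complexP (fun n => F (b n) - F (a n)) l).1 Fl.
apply: complex_ext => /=.
- apply: (Rintegral_FTC (F := fun x => Re (F x)) mD ab abD exh) => //.
  + by move=> x /dF[].
  + by move=> x /cf/continuous_complexP[].
  + by under eq_fun do rewrite -ReN -ReD.
- apply: (Rintegral_FTC (F := fun x => Im (F x)) mD ab abD exh) => //.
  + by move=> x /dF[].
  + by move=> x /cf/continuous_complexP[].
  + by under eq_fun do rewrite -ImN -ImD.
Qed.

Lemma Csubstitution_pos (phi phi' : R -> R) (G : R -> R[i]) :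
  (forall x : R, 0 < x -> 0 < phi x) ->
  (forall x : R, 0 < x -> is_derive x 1 phi (phi' x)) ->
  (forall x : R, 0 < x -> 0 < phi' x) ->
  (forall x : R, 0 < x -> {for x, continuous phi'}) ->
  (forall y : R, 0 < y -> exists2 x : R, 0 < x & phi x < y) ->
  (forall y : R, exists2 x : R, 0 < x & y < phi x) ->
  (forall x : R, 0 < x -> {for x, continuous G}) ->
  cintegrable `]0, +oo[ G ->
  cintegrable `]0, +oo[ (fun x => G (phi x) * (phi' x)%:C) /\
  Cintegral `]0, +oo[ (fun x => G (phi x) * (phi' x)%:C) = Cintegral `]0, +oo[ G.
Proof.
move=> p1 p2 p3 p4 p5 p6 cG [G1 G2].
have [i1 e1] := substitution_pos (G := fun x => Re (G x)) p1 p2 p3 p4 p5 p6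
   (fun x x0 => ((continuous_complexP _ _).1 (cG x x0)).1) G1.
have [i2 e2] := substitution_pos (G := fun x => Im (G x)) p1 p2 p3 p4 p5 p6
   (fun x x0 => ((continuous_complexP _ _).1 (cG x x0)).2) G2.
have E1 x : Re (G (phi x) * (phi' x)%:C) = Re (G (phi x)) * phi' x.
  by rewrite ReM /= mulr0 subr0.
have E2 x : Im (G (phi x) * (phi' x)%:C) = Im (G (phi x)) * phi' x.
  by rewrite ImM /= mulr0 add0r.
split.
- split; [move: i1|move: i2]; apply: eq_integrable => // x _ /=; by rewrite ?E1 ?E2.
- apply: complex_ext => /=; [rewrite -e1|rewrite -e2]; apply: eq_Rintegral => x _; by rewrite ?E1 ?E2.
Qed.

(** * Exchange of integrals for complex integrands *)

Section Fubini.
Local Notation mu2 := (mu \x mu)%E.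

Lemma integrable_prod_bound d1 d2 (T1 : measurableType d1) (T2 : measurableType d2)
  (m1 : {sigma_finite_measure set T1 -> \bar R}) (m2 : {sigma_finite_measure set T2 -> \bar R})
  (h : T1 * T2 -> \bar R) (h1 : T1 -> \bar R) (h2 : T2 -> \bar R) :
  measurable_fun setT h -> m1.-integrable setT h1 -> m2.-integrable setT h2 ->
  (forall x y, `|h (x, y)| <= `|h1 x| * `|h2 y|)%E -> (m1 \x m2)%E.-integrable setT h.
Proof.
move=> mh i1 i2 H; apply/(integrable12ltyP _ _ mh).
have /integrableP[mh1 f1] := i1; have /integrableP[mh2 f2] := i2.
have m1' : measurable_fun setT (fun x => `|h1 x|)%E by exact: measurableT_comp.
have m2' : measurable_fun setT (fun x => `|h2 x|)%E by exact: measurableT_comp.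
set I2 := (\int[m2]_y `|h2 y|)%E in f2.
have I20 : (0 <= I2)%E by exact: integral_ge0.
apply: (@le_lt_trans _ _ (\int[m1]_x (`|h1 x| * I2))%E).
  apply: ge0_le_integral => //.
  - by move=> x _; exact: integral_ge0.
  - have m0 : measurable_fun setT (abse \o h) by exact: measurableT_comp.
    exact: (measurable_fun_fubini_tonelli_F (m2 := m2) (abse \o h) m0 (fun x => abse_ge0 _)).
  - by apply: emeasurable_funM; [exact: m1'|exact: measurable_cst].
  - move=> x _; rewrite -ge0_integralZl//; apply: ge0_le_integral => //.
    + by apply: measurableT_comp => //; exact: (measurable_fun_pair2 x mh).
    + by apply: emeasurable_funM; [exact: measurable_cst|exact: m2'].
rewrite ge0_integralZr//; apply: lte_mul_pinfty => //; first exact: integral_ge0.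
by rewrite ge0_fin_numE//; exact: integral_ge0.
Qed.

Lemma prod_integrable_bound D E (f : R * R -> R) (g1 g2 : R -> R) :
  measurable D -> measurable E -> measurable_fun setT f ->
  mu.-integrable D (EFin \o g1) -> mu.-integrable E (EFin \o g2) ->
  (forall x y, D x -> E y -> `|f (x, y)| <= g1 x * g2 y) ->
  mu2.-integrable (D `*` E) (EFin \o f).
Proof.
move=> mD mE mf ig1 ig2 fg.
have mDE : measurable (D `*` E) by exact: measurableX.
apply/integrable_mkcond => //.
have mh : measurable_fun setT ((EFin \o f) \_ (D `*` E)).
  apply/(measurable_restrict _ mDE measurableT) => //.
  by rewrite setTI; apply: measurable_funTS; exact/measurable_EFinP.
have i1 : mu.-integrable setT ((EFin \o g1) \_ D).
  by have /integrable_mkcond := ig1; apply.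
have i2 : mu.-integrable setT ((EFin \o g2) \_ E).
  by have /integrable_mkcond := ig2; apply.
apply: (integrable_prod_bound _ i1 i2) => [|x y]; first exact: mh.
rewrite !patchE; case: ifPn => [/set_mem[/= Dx Ey]|]; last first.
  (* Outside its set a restriction takes the default value [point], which is 0 here. *)
  move=> _; have -> : point = 0%E :> \bar R by [].
  by rewrite abse0; apply: mule_ge0; exact: abse_ge0.
rewrite !mem_set//; suff : `|f (x, y)| <= `|g1 x| * `|g2 y| by [].
rewrite -normrM; apply: le_trans (fg _ _ Dx Ey) _; exact: ler_norm.
Qed.

(** Serves the multiplicative convolutions, where the integrand contains a function of x * y: the
    iterated integral with the x-integration inside can be computed by rescaling, whereas no
    majorant separates the variables. *)
Lemma prod_integrable21 D E (f : R * R -> R) :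
  measurable D -> measurable E -> measurable_fun setT f ->
  (\int[mu]_(y in E) \int[mu]_(x in D) `|f (x, y)|%:E < +oo)%E ->
  mu2.-integrable (D `*` E) (EFin \o f).
Proof.
move=> mD mE mf foo.
have mDE : measurable (D `*` E) by exact: measurableX.
apply/integrable_mkcond => //.
have mh : measurable_fun setT ((EFin \o f) \_ (D `*` E)).
  apply/(measurable_restrict _ mDE measurableT) => //.
  by rewrite setTI; apply: measurable_funTS; exact/measurable_EFinP.
apply/integrable21ltyP => //; apply: le_lt_trans foo.
rewrite [leRHS]integral_mkcond le_eqVlt; apply/orP; left; apply/eqP.
apply: eq_integral => y _; rewrite patchE; case: ifPn => [/set_mem Ey|nEy].
  rewrite [RHS]integral_mkcond; apply: eq_integral => x _; rewrite !patchE.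
  case: ifPn => [/set_mem[/= Dx _]|nDE]; first by rewrite mem_set.
  rewrite ifN; first by rewrite /= normr0.
  by apply: contra nDE => /set_mem Dx; exact/mem_set.
have -> : point = 0%E :> \bar R by [].
apply: integral0_eq => x _; rewrite patchE ifN; first by rewrite /= normr0.
by apply: contra nEy => /set_mem[/= _ Ey]; exact/mem_set.
Qed.

Lemma Rfubini D E (f : R -> R -> R) : measurable D -> measurable E ->
  mu2.-integrable (D `*` E) (EFin \o (fun p => f p.1 p.2)) ->
  Rintegral mu D (fun x => Rintegral mu E (f x)) =
  Rintegral mu E (fun y => Rintegral mu D (fun x => f x y)).
Proof.
move=> mD mE; have mDE : measurable (D `*` E) by exact: measurableX.
move=> /integrable_mkcond => /(_ mDE).
set h := (_ \_ _) => ih.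
have F1 x : ((fun x => Rintegral mu E (f x)) \_ D) x = fine (\int[mu]_y h (x, y))%E.
  rewrite patchE; case: ifPn => [/set_mem Dx|nDx].
    rewrite /Rintegral integral_mkcond; congr fine; apply: eq_integral => y _.
    rewrite /h !patchE; case: ifPn => [/set_mem Ey|nEy]; first by rewrite mem_set.
    by rewrite ifN//; apply: contra nEy => /set_mem[_ ?]; exact/mem_set.
  rewrite integral0_eq// => y _; rewrite /h patchE ifN//.
  by apply: contra nDx => /set_mem[? _]; exact/mem_set.
have F2 y : ((fun y => Rintegral mu D (f^~ y)) \_ E) y = fine (\int[mu]_x h (x, y))%E.
  rewrite patchE; case: ifPn => [/set_mem Ey|nEy].
    rewrite /Rintegral integral_mkcond; congr fine; apply: eq_integral => x _.
    rewrite /h !patchE; case: ifPn => [/set_mem Dx|nDx]; first by rewrite mem_set.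
    by rewrite ifN//; apply: contra nDx => /set_mem[? _]; exact/mem_set.
  rewrite integral0_eq// => x _; rewrite /h patchE ifN//.
  by apply: contra nEy => /set_mem[_ ?]; exact/mem_set.
rewrite [LHS]Rintegral_mkcond [RHS]Rintegral_mkcond (funext F1) (funext F2) /Rintegral.
congr fine.
(* The inner integrals are finite almost everywhere, so [fine] can be removed on both sides. *)
transitivity (\int[mu]_x \int[mu]_y h (x, y))%E.
  have i1 := integrable_fubini_F ih; have /integrableP[m1 _] := i1.
  apply: ae_eq_integral => //; first by apply/measurable_EFinP; exact: measurableT_comp.
  by apply: filterS (integrable_ae measurableT i1) => x fx _; rewrite fineK// fx.
rewrite Fubini//; have m1 := measurable_fubini_G ih.
apply: ae_eq_integral => //; first by apply/measurable_EFinP; exact: measurableT_comp.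
by apply: filterS (ae_integrable2 ih) => y iy _; rewrite fineK// (integrable_fin_num _ iy).
Qed.

Lemma Cfubini D E (f : R -> R -> R[i]) : measurable D -> measurable E ->
  cmeasurable setT (fun p : R * R => f p.1 p.2) ->
  mu2.-integrable (D `*` E) (EFin \o (fun p => normc (f p.1 p.2))) ->
  Cintegral D (fun x => Cintegral E (f x)) =
  Cintegral E (fun y => Cintegral D (fun x => f x y)).
Proof.
move=> mD mE [mf1 mf2] ih.
have mDE : measurable (D `*` E) by exact: measurableX.
apply: complex_ext => /=.
- apply: (@Rfubini D E (fun x y => Re (f x y))) => //.
  apply: le_integrable ih => //; first by apply/measurable_EFinP; exact: measurable_funTS.
  by move=> p _ /=; rewrite lee_fin [leRHS]ger0_norm ?normc_ge0// normc_Re.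
- apply: (@Rfubini D E (fun x y => Im (f x y))) => //.
  apply: le_integrable ih => //; first by apply/measurable_EFinP; exact: measurable_funTS.
  by move=> p _ /=; rewrite lee_fin [leRHS]ger0_norm ?normc_ge0// normc_Im.
Qed.

End Fubini.

End ComplexIntegral.

(** * Estimates *)

Section Estimates.
Variable R : realType.
Local Notation mu := (@lebesgue_measure R).

(** For a nonnegative function the integrals over the exhausting intervals increase to the full
    integral, and the increments of an antiderivative bound them. *)
Lemma integrable_antiderivative (D : set R) (a b : nat -> R) (F f : R -> R) K :
  measurable D -> (forall n, a n < b n) -> (forall n, `[a n, b n]%classic `<=` D) ->
  {homo (fun n => `[a n, b n]%classic) : n m / (n <= m)%N >-> (n <= m)%O} ->
  (forall x, D x -> \forall n \near \oo, `[a n, b n]%classic x) ->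
  (forall x, D x -> is_derive x 1 F (f x)) ->
  (forall x, D x -> {for x, continuous f}) ->
  measurable_fun D f ->
  (forall x, D x -> 0 <= f x) -> (forall n, F (b n) - F (a n) <= K) ->
  mu.-integrable D (EFin \o f).
Proof.
move=> mD ab abD nd exh dF cf mf f0 FK.
apply/integrableP; split; first exact/measurable_EFinP.
have bigE : \bigcup_n `[a n, b n]%classic = D.
  apply/seteqP; split => [x [n _ /abD//]|x /exh[N _ HN]].
  by exists N => //; apply: HN => /=.
have cv : (\int[mu]_(x in `[a i, b i]) `|(EFin \o f) x| @[i --> \oo] -->
   \int[mu]_(x in D) `|(EFin \o f) x|)%E.
  rewrite -bigE; apply: ge0_nondecreasing_set_cvg_integral => //.
  move=> i; apply: measurableT_comp => //; apply/measurable_EFinP.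
  by apply: measurable_funS mf.
apply: (@le_lt_trans _ _ K%:E); last exact: ltry.
rewrite -(cvg_lim (@ereal_hausdorff R) cv); apply: (lime_le (cvgP _ cv)).
apply: nearW => n.
rewrite (_ : (\int[mu]_(x in `[a n, b n]) _ = \int[mu]_(x in `[a n, b n]) (f x)%:E)%E); last first.
  by apply: eq_integral => x /set_mem /abD Dx; rewrite /= ger0_norm// f0.
have cF x : D x -> {for x, continuous F}.
  by move=> Dx; have [+ _] := dF x Dx => /derivable1_diffP/differentiable_continuous.
rewrite (@continuous_FTC2 _ f F)// -?EFinB ?lee_fin//.
- apply/continuous_in_subspaceT => x /set_mem xab; exact: (cf _ (abD n _ xab)).
- have aD : D (a n) by apply: (abD n); rewrite /= in_itv/= lexx ltW.
  have bD : D (b n) by apply: (abD n); rewrite /= in_itv/= lexx ltW.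
  split.
  + move=> x /subset_itv_oo_cc xab; by have [] := dF x (abD n _ xab).
  + by apply: cvg_at_right_filter; exact: cF.
  + by apply: cvg_at_left_filter; exact: cF.
- by move=> x /subset_itv_oo_cc xab; rewrite derive1E; have [_ ->] := dF x (abD n _ xab).
Qed.

Lemma is_derive_powR_div (a x : R) : a != 0 -> 0 < x ->
  is_derive x 1 (fun u => u `^ a / a) (x `^ (a - 1)).
Proof.
move=> a0 x0; have H := is_derive1_powR a x0.
have H2 := is_deriveM H (is_derive_cst a^-1 x 1); apply: (is_derive_eq H2).
by rewrite scaler0 add0r /GRing.scale /= mulrA mulVf// mul1r.
Qed.

Lemma continuous_powR (a x : R) : 0 < x -> {for x, continuous (fun u : R => u `^ a)}.
Proof.
by move=> x0; have [+ _] := is_derive1_powR a x0 => /derivable1_diffP/differentiable_continuous.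
Qed.

Lemma integrable_powR01 (a : R) : 0 < a ->
  mu.-integrable `]0, 1] (EFin \o (fun x => x `^ (a - 1))).
Proof.
move=> a0; apply: (@integrable_antiderivative _ (fun n => n.+2%:R^-1) (fun=> 1)
   (fun u => u `^ a / a) _ a^-1).
- exact: measurable_itv.
- by move=> n; rewrite invf_lt1// ltr1n.
- by move=> n x /=; rewrite !in_itv/= => /andP[+ ->]; rewrite andbT; apply: lt_le_trans; rewrite invr_gt0.
- move=> n m nm; rewrite subsetEset; apply: subset_itv; rewrite bnd_simp//.
  by rewrite lef_pV2 ?posrE// ler_nat.
- move=> x /=; rewrite in_itv/= => /andP[x0 x1]; near=> n; rewrite in_itv/= x1 andbT.
  rewrite invf_ple ?posrE//; apply: (@le_trans _ _ n%:R); last by rewrite ler_nat ltnW.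
  by near: n; exact: nbhs_infty_ger.
- by move=> x /=; rewrite in_itv/= => /andP[x0 x1]; apply: is_derive_powR_div => //; rewrite gt_eqF.
- by move=> x /=; rewrite in_itv/= => /andP[x0 x1]; exact: continuous_powR.
- by apply: measurable_funTS; exact: measurable_powR.
- by move=> x _; exact: powR_ge0.
- by move=> n; rewrite powR1 div1r gerBl divr_ge0 ?powR_ge0// ltW.
Unshelve. all: by end_near. Qed.

Lemma integrable_powR1y (a : R) : a < 0 ->
  mu.-integrable `[1, +oo[ (EFin \o (fun x => x `^ (a - 1))).
Proof.
move=> a0; apply: (@integrable_antiderivative _ (fun=> 1) (fun n => n.+2%:R)
   (fun u => u `^ a / a) _ (- a^-1)).
- exact: measurable_itv.
- by move=> n; rewrite (ltr_nat R 1).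
- by move=> n x /=; rewrite !in_itv/= => /andP[-> _].
- move=> n m nm; rewrite subsetEset; apply: subset_itv; rewrite bnd_simp//.
  by rewrite ler_nat.
- move=> x /=; rewrite in_itv/= andbT => x1; near=> n; rewrite in_itv/= x1 /=.
  apply: (@le_trans _ _ n%:R); last by rewrite ler_nat ltnW.
  by near: n; exact: nbhs_infty_ger.
- move=> x /=; rewrite in_itv/= andbT => x1; apply: is_derive_powR_div; first by rewrite lt_eqF.
  exact: lt_le_trans x1.
- by move=> x /=; rewrite in_itv/= andbT => x1; apply: continuous_powR; exact: lt_le_trans x1.
- by apply: measurable_funTS; exact: measurable_powR.
- by move=> x _; exact: powR_ge0.
- move=> n; rewrite powR1 div1r gerDr nmulr_lle0 ?powR_ge0//; by rewrite invr_lt0.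
Unshelve. all: by end_near. Qed.

(** The fundamental strip of a Mellin transform: growth like u^(-p) at 0 bounds [c] from below,
    decay like u^(-q) at infinity bounds it from above. The majorant is a sum of two restricted
    powers. *)
Lemma mellin_integrable (f : R -> R) (M p q c : R) : measurable_fun setT f ->
  (forall u : R, 0 < u -> u <= 1 -> `|f u| <= M * u `^ (- p)) ->
  (forall u, 1 <= u -> `|f u| <= M * u `^ (- q)) ->
  p < c -> c < q -> mu.-integrable `]0, +oo[ (EFin \o (fun u => u `^ (c - 1) * f u)).
Proof.
move=> mf f1 f2 pc cq.
have m0 : measurable (`]0, +oo[%classic : set R) by exact: measurable_itv.
pose h1 := (fun x : R => (x `^ (c - p - 1))%:E) \_ (`]0, 1]%classic : set R).
pose h2 := (fun x : R => (x `^ (c - q - 1))%:E) \_ (`[1, +oo[%classic : set R).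
have i1 : mu.-integrable `]0, +oo[ h1.
  apply/integrable_restrict => //; apply: integrableS (integrable_powR01 _) => //.
  - exact: measurableI.
  - by rewrite subr_gt0.
have i2 : mu.-integrable `]0, +oo[ h2.
  apply/integrable_restrict => //; apply: integrableS (integrable_powR1y _) => //.
  - exact: measurableI.
  - by rewrite subr_lt0.
have i3 : mu.-integrable `]0, +oo[ (fun u => M%:E * (h1 u + h2 u))%E.
  by apply: integrableZl => //; apply: integrableD.
apply: le_integrable i3 => //.
  have mp : measurable_fun setT (fun u : R => u `^ (c - 1)) by exact: measurable_powR.
  by apply/measurable_EFinP; apply: measurable_funTS; exact: measurable_funM.
move=> u /=; rewrite in_itv/= andbT => u0; rewrite /h1 /h2 !patchE.
have M0 : 0 <= M.
  have := f1 1 ltr01 (lexx _); rewrite powR1 mulr1; exact: le_trans.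
have E r : c - r - 1 = (c - 1) + (- r) by ring.
have P x (y : R) : 0 <= u `^ x by exact: powR_ge0.
have lem r (s : R) : 0 <= s -> `|f u| <= M * u `^ (- r) ->
    `|u `^ (c - 1) * f u| <= `|M * (u `^ (c - r - 1) + s)|.
  move=> s0 fr; rewrite normrM (ger0_norm (powR_ge0 _ _)) [leRHS]ger0_norm; last first.
    by rewrite mulr_ge0 ?addr_ge0 ?powR_ge0.
  rewrite mulrDr; apply: ler_wpDr; first by rewrite mulr_ge0.
  rewrite E [X in _ <= M * X]powRD ?(gt_eqF u0) ?implybT//.
  by rewrite mulrCA ler_wpM2l ?powR_ge0.
have [u1|u1] := leP u 1.
  rewrite (mem_set (A := `]0, 1])); last by rewrite /= in_itv/= u0.
  (* Both cases occur, since u = 1 belongs to the two intervals. *)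
  case: ifPn => _.
  - exact: (lem p (u `^ (c - q - 1)) (powR_ge0 _ _) (f1 _ u0 u1)).
  - exact: (lem p 0 (lexx _) (f1 _ u0 u1)).
rewrite (mem_set (A := `[1, +oo[)); last by rewrite /= in_itv/= ltW.
rewrite ifN; last by apply/negP => /set_mem; rewrite /= in_itv/= leNgt u1 andbF.
rewrite addeC.
exact: (lem q 0 (lexx _) (f2 _ (ltW u1))).
Qed.

Lemma ln_norm_le (e u : R) : 0 < e -> 0 < u -> `|ln u| <= (u `^ e + u `^ (- e)) / e.
Proof.
move=> e0 u0; rewrite ler_pdivlMr// mulrC /powR gt_eqF//.
have H (x : R) : x <= expR x by apply: le_trans (expR_ge1Dx x); rewrite lerDr.
have [l0|l0] := ger0P (ln u).
- by apply: le_trans (H _) _; rewrite lerDl expR_ge0.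
- rewrite mulrN -mulNr; by apply: le_trans (H _) _; rewrite lerDr expR_ge0.
Qed.

(** The mean value theorem, applied to [r] on [0, 1] and then to [r1] on [0, x]. *)
Lemma second_order_remainder (r r1 r2 : R -> R) K :
  (forall t : R, is_derive t 1 r (r1 t)) -> (forall t : R, is_derive t 1 r1 (r2 t)) ->
  (forall t, 0 <= t -> t <= 1 -> `|r2 t| <= K) -> `|r 1 - r 0 - r1 0| <= K.
Proof.
move=> d1 d2 rK.
have c (g g' : R -> R) (a b : R) : (forall t : R, is_derive t 1 g (g' t)) ->
    {within `[a, b], continuous g}.
  move=> dg; apply/continuous_in_subspaceT => x _.
  by have [+ _] := dg x => /derivable1_diffP/differentiable_continuous.
have [x + ->] := @MVT R r r1 0 1 ltr01 (fun x _ => d1 x) (c _ _ _ _ d1).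
rewrite in_itv/= => /andP[x0 x1]; rewrite subr0 mulr1.
have [y + ->] := @MVT R r1 r2 0 x x0 (fun x _ => d2 x) (c _ _ _ _ d2).
rewrite in_itv/= => /andP[y0 yx]; rewrite subr0 normrM -[leRHS]mulr1 ler_pM//.
  by apply: rK; rewrite ltW// (lt_trans yx).
by rewrite gtr0_norm// ltW.
Qed.

Lemma path_derivative_Cexp_line (z w : R[i]) (t : R) :
  path_derivative (fun u => w * Cexp (u%:C * z)) t (w * z * Cexp (t%:C * z)).
Proof.
have e1 (a : R) : is_derive t 1 (fun u : R => u * a) a.
  have H2 := is_deriveM (is_derive_id t 1) (is_derive_cst a t 1); apply: (is_derive_eq H2).
  by rewrite scaler0 add0r /GRing.scale /= mulr1.
have e2 (a : R) := @is_derive1_comp R expR (fun u => u * a) t _ _ (is_derive_expR _) (e1 a).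
have e3 (a : R) := @is_derive1_comp R cos (fun u => u * a) t _ _ (is_derive_cos _) (e1 a).
have e4 (a : R) := @is_derive1_comp R sin (fun u => u * a) t _ _ (is_derive_sin _) (e1 a).
have H : path_derivative (fun u => Cexp (u%:C * z)) t (z * Cexp (t%:C * z)).
  split.
  - rewrite (_ : _ \o _ = (expR \o *%R^~ (Re z)) * (cos \o *%R^~ (Im z))); last first.
      by apply/funext => u; rewrite /= !CexpE ReM /= !ReImE /= !mul0r !subr0 addr0.
    apply: (is_derive_eq (is_deriveM (e2 _) (e3 _))).
    by rewrite !CexpE !ReImE /= /GRing.scale /= !mul0r !subr0 !addr0; ring.
  - rewrite (_ : _ \o _ = (expR \o *%R^~ (Re z)) * (sin \o *%R^~ (Im z))); last first.
      by apply/funext => u; rewrite /= !CexpE ImM /= !ReImE /= !mul0r !subr0 !addr0.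
    apply: (is_derive_eq (is_deriveM (e2 _) (e4 _))).
    by rewrite !CexpE !ReImE /= /GRing.scale /= !mul0r !subr0 !addr0; ring.
have := path_derivativeM (path_derivative_cst w t) H.
by rewrite mul0r add0r mulrA.
Qed.

(** The exponential is followed along the segment from 0 to [z], and the real estimate is applied to
    each component, as the mean value theorem fails for complex values; this gives the factor 2. *)
Lemma Cexp_remainder (z : R[i]) :
  normc (Cexp z - 1 - z) <= 2 * (normc z ^+ 2 * expR (normc z)).
Proof.
have D1 := path_derivative_Cexp_line z 1; have D2 := path_derivative_Cexp_line z z.
have B (t : R) : 0 <= t -> t <= 1 -> normc (z * z * Cexp (t%:C * z)) <= normc z ^+ 2 * expR (normc z).
  move=> t0 t1; rewrite normcM normc_Cexp normcM -expr2.
  apply: ler_wpM2l; first exact: sqr_ge0.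
  rewrite ler_expR !ReImE /= mul0r subr0; apply: le_trans (ler_norm _) _.
  by rewrite normrM (ger0_norm t0) -[leRHS]mul1r ler_pM ?normc_Re.
have S : Cexp z - 1 - z = 1 * Cexp (1%:C * z) - 1 * Cexp (0%:C * z) - 1 * z * Cexp (0%:C * z).
  by rewrite !mul1r mul0r Cexp0 mulr1.
rewrite S; apply: le_trans (normc_le _) _; rewrite mulr_natl mulr2n lerD//.
- rewrite ReD ReN ReD ReN.
  apply: (@second_order_remainder (fun u => Re (1 * Cexp (u%:C * z)))
    (fun u => Re (1 * z * Cexp (u%:C * z))) (fun u => Re (z * z * Cexp (u%:C * z)))).
  + by move=> t; have [] := D1 t.
  + by move=> t; rewrite mul1r; have [] := D2 t.
  + by move=> t t0 t1; apply: le_trans (normc_Re _) (B _ t0 t1).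
- rewrite ImD ImN ImD ImN.
  apply: (@second_order_remainder (fun u => Im (1 * Cexp (u%:C * z)))
    (fun u => Im (1 * z * Cexp (u%:C * z))) (fun u => Im (z * z * Cexp (u%:C * z)))).
  + by move=> t; have [] := D1 t.
  + by move=> t; rewrite mul1r; have [] := D2 t.
  + by move=> t t0 t1; apply: le_trans (normc_Im _) (B _ t0 t1).
Qed.

(** Dividing by h shows that the difference quotient is within K |h| of [d], hence continuous at [z]
    once completed by [d]. *)
Lemma cderivative_quadratic (F : R[i] -> R[i]) z d (K e : R) : 0 < e ->
  (forall h, normc h < e -> normc (F (z + h) - F z - h * d) <= K * normc h ^+ 2) ->
  cderivative F z d.
Proof.
move=> e0 FK; pose Q w := if w == z then d else (F w - F z) / (w - z).
exists Q; split; last by rewrite /Q eqxx.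
- by move=> w; rewrite /Q; case: eqP => [->|/eqP wz]; rewrite ?subrr ?mulr0// divfK// subr_eq0.
have K0 : 0 <= K.
  have e2 : normc (e / 2)%:C < e.
    by rewrite normc_real gtr0_norm ?divr_gt0// ltr_pdivrMr// ltr_pMr// ltr1n.
  have := FK _ e2; have := normc_ge0 (F (z + (e / 2)%:C) - F z - (e / 2)%:C * d).
  move=> h1 h2; have := le_trans h1 h2; rewrite pmulr_lge0// exprn_gt0// normc_gt0//.
  by rewrite -normc_eq0 normc_real normr_eq0 gt_eqF// divr_gt0.
have QK w : normc (w - z) < e -> normc (Q w - d) <= K * normc (w - z).
  rewrite /Q; case: eqP => [->|/eqP wz we]; first by rewrite !subrr normc0 mulr0.
  have wz0 : w - z != 0 by rewrite subr_eq0.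
  have -> : (F w - F z) / (w - z) - d = (F (z + (w - z)) - F z - (w - z) * d) / (w - z).
    have -> : z + (w - z) = w by ring.
    by rewrite [RHS]mulrBl [(w - z) * d / _]mulrAC mulfV// mul1r.
  rewrite normcM normcV ler_pdivrMr ?normc_gt0//.
  by rewrite -mulrA -expr2 FK.
have near_e : \forall w \near z, normc (w - z) < e.
  have nE (u : R[i]) : `|u| = (normc u)%:C by [].
  have /cvgrPdist_lt/(_ e%:C) := @cvg_id _ (nbhs z).
  rewrite ltcR e0 => /(_ isT); apply: filterS => w.
  by rewrite nE ltcR normc_sub.
have Qz : Q z = d by rewrite /Q eqxx.
have H0 : normc (w - z) @[w --> z] --> normc (z - z).
  exact: (cvg_normc (cvgB (@cvg_id _ (nbhs z)) (cvg_cst z))).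
have H1 : K * normc (w - z) @[w --> z] --> K * normc (z - z).
  exact: (cvgM (cvg_cst K) H0).
rewrite subrr normc0 mulr0 in H1.
have H2 : \forall w \near z, normc (Q w - Q z) <= K * normc (w - z).
  by apply: filterS near_e => w we; rewrite Qz QK.
have H4 : (Q w - Q z) @[w --> z] --> (0 : R[i]) by exact: (cvgy_normc0 H2 H1).
have H3 : (Q z + (Q w - Q z)) @[w --> z] --> Q z + 0 by exact: (cvgD (cvg_cst (Q z)) H4).
rewrite addr0 in H3.
pose g w := Q z + (Q w - Q z).
have gQ : g = Q by apply/funext => w; rewrite /g addrC subrK.
have : g w @[w --> z] --> Q z by exact: H3.
by rewrite gQ.
Qed.

Lemma cderivative_Cexp (z : R[i]) : cderivative (@Cexp R) z (Cexp z).
Proof.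
apply: (@cderivative_quadratic _ _ _ (expR (Re z) * (2 * expR 1)) 1) => // h h1.
have -> : Cexp (z + h) - Cexp z - h * Cexp z = Cexp z * (Cexp h - 1 - h).
  by rewrite CexpD; ring.
rewrite normcM normc_Cexp -mulrA ler_wpM2l ?expR_ge0//.
apply: le_trans (Cexp_remainder h) _; rewrite -mulrA ler_wpM2l// mulrC ler_wpM2r ?sqr_ge0//.
by rewrite ler_expR ltW.
Qed.

(** A logarithm costs an arbitrarily small power on either side, and the half-line [p < c] is open:
    [c - e] is the midpoint of [p] and [c]. *)
Lemma mellin_ln (p : R) (f : R -> R) : measurable_fun setT f ->
  (forall c, p < c -> mu.-integrable `]0, +oo[ (EFin \o (fun u => u `^ (c - 1) * f u))) ->
  forall c, p < c -> mu.-integrable `]0, +oo[ (EFin \o (fun u => u `^ (c - 1) * (ln u * f u))).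
Proof.
move=> mf intf c pc; have m0 : measurable (`]0, +oo[%classic : set R) by exact: measurable_itv.
pose e := (c - p) / 2.
have e0 : 0 < e by rewrite divr_gt0// subr_gt0.
have i1 := integrable_norm (intf (c + e) (ltr_wpDr (ltW e0) pc)).
have pce : p < c - e by rewrite /e; lra.
have i2 := integrable_norm (intf (c - e) pce).
have i3 : mu.-integrable `]0, +oo[ (fun u => (e^-1)%:E * ((`|u `^ (c + e - 1) * f u|)%:E + (`|u `^ (c - e - 1) * f u|)%:E))%E.
  by apply: integrableZl => //; apply: integrableD.
apply: le_integrable i3 => //.
  have mp : measurable_fun setT (fun u : R => u `^ (c - 1)) by exact: measurable_powR.
  apply/measurable_EFinP; apply: measurable_funTS; apply: measurable_funM => //.
  by apply: measurable_funM => //; exact: measurable_ln.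
move=> u /=; rewrite in_itv/= andbT => u0; rewrite lee_fin.
rewrite [leRHS]ger0_norm; last by rewrite mulr_ge0 ?invr_ge0 ?addr_ge0// ltW.
rewrite !normrM !(ger0_norm (powR_ge0 _ _)) -mulrDl.
have E1 : c + e - 1 = (c - 1) + e by ring.
have E2 : c - e - 1 = (c - 1) + - e by ring.
rewrite E1 E2 [u `^ (c - 1 + e)]powRD ?(gt_eqF u0) ?implybT// [u `^ (c - 1 + - e)]powRD ?(gt_eqF u0) ?implybT//.
rewrite -mulrDr mulrA [leRHS]mulrA ler_wpM2r// mulrCA ler_wpM2l ?powR_ge0//.
by rewrite mulrC; exact: ln_norm_le.
Qed.

Lemma is_derive_expRN (u : R) : is_derive u 1 (fun u : R => expR (- u)) (- expR (- u)).
Proof.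
have H := @is_derive1_comp R expR -%R u _ _ (is_derive_expR _) (is_deriveN (is_derive_id u 1)).
by apply: (is_derive_eq H); rewrite mulrN1.
Qed.

Lemma measurable_expRN : measurable_fun setT (fun u : R => expR (- u)).
Proof.
apply: continuous_measurable_fun => u.
by have [+ _] := is_derive_expRN u => /derivable1_diffP/differentiable_continuous.
Qed.

Lemma expRN_le_powR (n : nat) (u : R) : 1 <= u -> expR (- u) <= n.+1`!%:R * u `^ (- n.+1%:R).
Proof.
move=> u1; have u0 : 0 < u by exact: lt_le_trans u1.
have -> : u `^ (- n.+1%:R) = (u ^+ n.+1)^-1 by rewrite powRN powR_mulrn// ltW.
have p0 : 0 < n.+1`!%:R * (u ^+ n.+1)^-1.
  by rewrite mulr_gt0 ?invr_gt0 ?exprn_gt0// ltr0n fact_gt0.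
rewrite expRN -[leRHS]invrK lef_pV2 ?posrE ?expR_gt0 ?invr_gt0//.
rewrite invfM invrK mulrC; apply: le_trans (@expR_ge1Dxn R u n (ltW u0)).
by rewrite ler_wpDl.
Qed.

Lemma gamma_integrable (c : R) : 0 < c ->
  mu.-integrable `]0, +oo[ (EFin \o (fun u => u `^ (c - 1) * expR (- u))).
Proof.
move=> c0; pose n := Num.truncn c.
apply: (@mellin_integrable _ n.+1`!%:R 0 n.+1%:R) => //.
- exact: measurable_expRN.
- move=> u u0 u1; rewrite oppr0 powRr0 mulr1 ger0_norm ?expR_ge0//.
  apply: (@le_trans _ _ 1); first by rewrite -expR0 ler_expR oppr_le0 ltW.
  by rewrite ler1n fact_gt0.
- by move=> u u1; rewrite ger0_norm ?expR_ge0//; exact: expRN_le_powR.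
- by rewrite truncnS_gt.
Qed.

End Estimates.

(** * Cauchy's theorem for contours and vertical lines *)

Section ContourShift.
Variable R : realType.
Local Notation mu := (@lebesgue_measure R).
Implicit Types (F : R[i] -> R[i]) (I : set R) (c : R -> R).

(* The strip [`|Re s| <= B] cut along the part of the real axis outside [I]. *)
Definition slit I B (s : R[i]) := `|Re s| <= B /\ (Im s != 0 \/ I (Re s)).

(** The rate y^(-2) makes the integrals along contours converge and the horizontal sides at heights
    plus and minus n vanish. Heights below 1 are left out because the poles lie on the real axis. *)
Definition quadratic_decay F := forall B : R, exists M : R, forall s : R[i],
  `|Re s| <= B -> 1 <= `|Im s| -> normc (F s) * Im s ^+ 2 <= M.

(* Strip by strip, because the formula for [Gamma] depends on the strip. *)
Definition regular I F := forall B, exists G G', forall s, slit I B s ->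
  F s = G s /\ C1at G G' s.

Lemma is_derive_Rintegral01 (f f' : R -> R -> R) (y M : R) :
  (forall u : R, mu.-integrable `[0, 1] (EFin \o f u)) ->
  (forall u t : R, 0 <= t -> t <= 1 -> is_derive u 1 (f ^~ t) (f' u t)) ->
  (forall u t : R, y - 1 < u -> u < y + 1 -> 0 <= t -> t <= 1 -> `|f' u t| <= M) ->
  is_derive y 1 (fun u : R => Rintegral mu `[0, 1] (f u)) (Rintegral mu `[0, 1] (f' y)).
Proof.
move=> intf df f'M; have m01 : measurable (`[0, 1]%classic : set R) by exact: measurable_itv.
have iM : mu.-integrable `[0, 1] (EFin \o (fun=> `|M|)).
  apply: measurable_bounded_integrable => //.
  - by rewrite /= lebesgue_measure_itv/= lte_fin ltr01 -EFinD ltry.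
  - exact: bounded_cst.
have Iy : `]y - 1, y + 1[%classic y by rewrite /= in_itv/= ltrBlDr !ltrDl ltr01.
have h1 : forall x t : R, `]y - 1, y + 1[%classic x -> `[0, 1]%classic t -> derivable (f ^~ t) x 1.
  by move=> x t _; rewrite /= in_itv/= => /andP[t0 t1]; have [] := df x t t0 t1.
have h2 : forall x t : R, `]y - 1, y + 1[%classic x -> `[0, 1]%classic t -> `|partial1of2 f x t| <= `|M|.
  move=> x t; rewrite /= !in_itv/= => /andP[x1 x2] /andP[t0 t1].
  rewrite partial1of2E; have [_ ->] := df x t t0 t1.
  by apply: le_trans (ler_norm _); exact: f'M.
have i1 (x : R) : `]y - 1, y + 1[%classic x -> mu.-integrable `[0, 1] (EFin \o f x) by [].
have dd : derivable (fun u => Rintegral mu `[0, 1] (f u)) y 1.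
  by apply: (derivable_under_integral _ Iy i1 h1 (fun=> normr_ge0 M) iM h2).
apply: DeriveDef; first exact: dd.
rewrite -derive1E (differentiation_under_integral _ Iy i1 h1 (fun=> normr_ge0 M) iM h2)//=.
apply: eq_Rintegral => t /set_mem; rewrite /= in_itv/= => /andP[t0 t1].
by rewrite partial1of2E; have [_ ->] := df y t t0 t1.
Qed.

(** * The horizontal homotopy from a vertical line to a contour *)

Section Homotopy.
Variables (I : set R) (F F' : R[i] -> R[i]) (c c' : R -> R) (c0 B : R).
Hypothesis convI : forall x y (t : R), I x -> I y -> 0 <= t -> t <= 1 -> I (x + t * (y - x)).
Hypothesis dF : forall s, slit I B s -> C1at F F' s.
Hypothesis dc : forall y : R, is_derive y 1 c (c' y).
Hypothesis cc' : continuous c'.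
Hypotheses (Ic0 : I c0) (Ic : I (c 0)).
Hypotheses (cB : forall y, `|c y| <= B) (c0B : `|c0| <= B).

(** The height y stays fixed during the homotopy, so the real axis is met only at y = 0, where
    convexity of [I] keeps the point in the gap. *)
Let Phi (t y : R) : R[i] := (c0 + t * (c y - c0)) +i* y.

Let Phi_slit (t y : R) : 0 <= t -> t <= 1 -> slit I B (Phi t y).
Proof.
move=> t0 t1; split => /=.
  by move: c0B (cB y); rewrite !ler_norml => /andP[a1 a2] /andP[b1 b2]; apply/andP; split; nra.
case: (eqVneq y 0) => [->|]; last by left.
by right; apply: convI.
Qed.

Let cc : continuous c.
Proof. by move=> y; have [+ _] := dc y => /derivable1_diffP/differentiable_continuous. Qed.

Let cc2 (p : R * R) : c q.2 @[q --> p] --> c p.2.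
Proof.
have s2 : {for p, continuous (@snd R R)} by exact: cvg_snd.
exact: (continuous_comp s2 (@cc p.2)).
Qed.

Let cc'2 (p : R * R) : c' q.2 @[q --> p] --> c' p.2.
Proof.
have s2 : {for p, continuous (@snd R R)} by exact: cvg_snd.
exact: (continuous_comp s2 (@cc' p.2)).
Qed.

Let cPhi2 : continuous (fun p : R * R => Phi p.1 p.2).
Proof.
move=> p; have [_ H] := @cvg_complexP R _ _ (nbhs_filter p) (fun p : R * R => Phi p.1 p.2) (Phi p.1 p.2).
apply: H; split => /=; last exact: cvg_snd.
apply: cvgD; first exact: cvg_cst.
apply: cvgM; first exact: cvg_fst.
apply: cvgB; last exact: cvg_cst.
exact: cc2.
Qed.

Let dPhi_y t y : path_derivative (Phi t) y ((t * c' y) +i* 1).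
Proof.
split; last exact: is_derive_id.
rewrite (_ : _ \o _ = cst c0 + (t *: (c - cst c0))); last by apply/funext.
have H1 := is_deriveB (dc y) (is_derive_cst c0 y 1).
have H2 := is_deriveD (is_derive_cst c0 y 1) (is_deriveZ t H1).
by apply: (is_derive_eq H2); rewrite add0r subr0.
Qed.

Let dPhi_t t y : path_derivative (Phi ^~ y) t (c y - c0)%:C.
Proof.
split; last exact: is_derive_cst.
rewrite (_ : _ \o _ = cst c0 + (id * cst (c y - c0))); last by apply/funext.
have H1 := is_deriveM (is_derive_id t 1) (is_derive_cst (c y - c0) t 1).
have H2 := is_deriveD (is_derive_cst c0 t 1) H1.
by apply: (is_derive_eq H2); rewrite add0r scaler0 add0r /GRing.scale /= mulr1.
Qed.

(* d/dy of F(Phi) dPhi/dt and d/dt of F(Phi) dPhi/dy coincide. *)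
Let J t y := F' (Phi t y) * ((t * c' y) +i* 1) * (c y - c0)%:C + F (Phi t y) * (c' y)%:C.

Let dFy (t y : R) : 0 <= t -> t <= 1 ->
  path_derivative (fun y => F (Phi t y) * (c y - c0)%:C) y (J t y).
Proof.
move=> t0 t1; apply: path_derivativeM.
  apply: (path_derivative_comp (s := Phi t)) (dPhi_y t y).
  by have [] := dF (Phi_slit y t0 t1).
apply: path_derivative_real.
have H1 := is_deriveB (dc y) (is_derive_cst c0 y 1).
by apply: (is_derive_eq H1); rewrite subr0.
Qed.

Let dFt (t y : R) : 0 <= t -> t <= 1 ->
  path_derivative (fun t => F (Phi t y) * ((t * c' y) +i* 1)) t (J t y).
Proof.
move=> t0 t1; rewrite (_ : J t y = F' (Phi t y) * (c y - c0)%:C * ((t * c' y) +i* 1)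
   + F (Phi t y) * (c' y)%:C); last by rewrite /J -mulrA [_ * (c y - c0)%:C]mulrC mulrA.
apply: path_derivativeM.
  apply: (path_derivative_comp (s := Phi ^~ y)) (dPhi_t t y).
  by have [] := dF (Phi_slit y t0 t1).
split; last exact: is_derive_cst.
have H1 := is_deriveM (is_derive_id t 1) (is_derive_cst (c' y) t 1).
by apply: (is_derive_eq H1); rewrite scaler0 add0r /GRing.scale /= mulr1.
Qed.

Let cJ2 (p : R * R) : 0 <= p.1 -> p.1 <= 1 -> {for p, continuous (fun p => J p.1 p.2)}.
Proof.
move=> t0 t1; have [d1 d2] := dF (Phi_slit p.2 t0 t1).
have c1 : {for Phi p.1 p.2, continuous F} := cderivative_continuous d1.
have h1 := continuous_comp (@cPhi2 p) d2.
have h2 := continuous_comp (@cPhi2 p) c1.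
have h3 : c' q.2 @[q --> p] --> c' p.2 := @cc'2 p.
have h4 : c q.2 @[q --> p] --> c p.2 := @cc2 p.
have h5 : (c q.2 - c0) @[q --> p] --> c p.2 - c0 by apply: cvgB => //; exact: cvg_cst.
have h6 : q.1 * c' q.2 @[q --> p] --> p.1 * c' p.2 by apply: cvgM => //; exact: cvg_fst.
have h7 : (q.1 * c' q.2) +i* 1 @[q --> p] --> (p.1 * c' p.2) +i* 1.
  have [_ H] := @cvg_complexP R _ _ (nbhs_filter p) (fun q : R * R => (q.1 * c' q.2) +i* 1) ((p.1 * c' p.2) +i* 1).
  by apply: H; split => //=; exact: cvg_cst.
exact: (cvgD (cvgM (cvgM h1 h7) (cvg_real_complex h5)) (cvgM h2 (cvg_real_complex h3))).
Qed.

(** The integral of [F] over the horizontal segment at height y, from the line to the contour: the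
    short side of the rectangle in Cauchy's theorem. *)
Let H y := Cintegral `[0, 1] (fun t => F (Phi t y) * (c y - c0)%:C).

Let cJt (t y : R) : 0 <= t -> t <= 1 -> {for t, continuous (J ^~ y)}.
Proof.
move=> t0 t1.
have h : {for t, continuous (fun t => (t, y))}.
  move=> A [[U V] /= [nU nV] UVA]; apply: filterS nU => u Uu; apply: UVA.
  by split => //=; exact: nbhs_singleton nV.
exact: (continuous_comp h (@cJ2 (t, y) t0 t1)).
Qed.

Let cFt (t y : R) : 0 <= t -> t <= 1 -> {for t, continuous (fun t => F (Phi t y) * (c y - c0)%:C)}.
Proof.
move=> t0 t1; have d := path_derivative_comp (s := Phi ^~ y) (dF (Phi_slit y t0 t1)).1 (dPhi_t t y).
exact: (cvgM (path_derivative_continuous d) (cvg_cst _)).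
Qed.

Let Jbound (y : R) : exists M : R, forall t u : R, 0 <= t -> t <= 1 -> y - 1 < u -> u < y + 1 ->
  normc (J t u) <= M.
Proof.
pose K : set (R * R) := `[0, 1]%classic `*` `[y - 1, y + 1]%classic.
have cK : compact K by apply: compact_setX; exact: segment_compact.
pose N (p : R * R) := normc (J p.1 p.2).
have cN : {within K, continuous N}.
  apply/continuous_in_subspaceT => p /set_mem[/=]; rewrite !in_itv/= => /andP[t0 t1] _.
  exact: (cvg_normc (@cJ2 p t0 t1)).
have [M [_ HM]] := compact_bounded (continuous_compact cN cK).
exists (M + 1) => t u t0 t1 u0 u1.
have M1 : M < M + 1 by rewrite ltrDl.
have := HM (M + 1) M1 (N (t, u)).
rewrite /= ger0_norm ?normc_ge0//; apply; exists (t, u) => //.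
by split; rewrite /= in_itv/= ?t0 ?t1// !ltW.
Qed.

Let intJ y : cintegrable `[0, 1] (J ^~ y).
Proof.
have k : compact (`[0, 1]%classic : set R) by exact: segment_compact.
by split; apply: continuous_compact_integrable => //;
  apply/continuous_in_subspaceT => t /set_mem; rewrite /= in_itv/= => /andP[t0 t1];
  have /continuous_complexP[] := @cJt t y t0 t1.
Qed.

Let intFt y : cintegrable `[0, 1] (fun t => F (Phi t y) * (c y - c0)%:C).
Proof.
have k : compact (`[0, 1]%classic : set R) by exact: segment_compact.
by split; apply: continuous_compact_integrable => //;
  apply/continuous_in_subspaceT => t /set_mem; rewrite /= in_itv/= => /andP[t0 t1];
  have /continuous_complexP[] := @cFt t y t0 t1.
Qed.

Lemma homotopy_derivative y : path_derivative H y
  (F (Phi 1 y) * (c' y +i* 1) - F (Phi 0 y) * (0 +i* 1)).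
Proof.
have m01 : measurable (`[0, 1]%classic : set R) by exact: measurable_itv.
have <- : Cintegral `[0, 1] (J ^~ y) =
    F (Phi 1 y) * (c' y +i* 1) - F (Phi 0 y) * (0 +i* 1).
  apply: (@Cintegral_FTC R _ (fun=> 0) (fun=> 1) (fun t => F (Phi t y) * ((t * c' y) +i* 1))) => //.
  - by move=> n; exact: subset_refl.
  - by move=> x x01; exists 0%N.
  - by move=> t /=; rewrite in_itv/= => /andP[t0 t1]; exact: dFt.
  - by move=> t /=; rewrite in_itv/= => /andP[t0 t1]; exact: cJt.
  - by rewrite mul1r mul0r; exact: cvg_cst.
have [M HM] := Jbound y.
split;
  [apply: (@is_derive_Rintegral01 (fun u t => Re (F (Phi t u) * (c u - c0)%:C)) (fun u t => Re (J t u)) y M)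
  |apply: (@is_derive_Rintegral01 (fun u t => Im (F (Phi t u) * (c u - c0)%:C)) (fun u t => Im (J t u)) y M)].
- by move=> u; have [] := intFt u.
- by move=> u t t0 t1; have [] := dFy u t0 t1.
- by move=> u t u0 u1 t0 t1; apply: le_trans (normc_Re _) _; exact: HM.
- by move=> u; have [] := intFt u.
- by move=> u t t0 t1; have [] := dFy u t0 t1.
- by move=> u t u0 u1 t0 t1; apply: le_trans (normc_Im _) _; exact: HM.
Qed.

Lemma homotopy_bound (M y : R) :
  (forall s : R[i], `|Re s| <= B -> 1 <= `|Im s| -> normc (F s) * Im s ^+ 2 <= M) ->
  1 <= `|y| -> normc (H y) <= 2 * (M / y ^+ 2 * (B + B)).
Proof.
move=> FM y1.
have y20 : 0 < y ^+ 2 by rewrite exprn_even_gt0//= -normr_gt0 (lt_le_trans ltr01 y1).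
have m01 : measurable (`[0, 1]%classic : set R) by exact: measurable_itv.
have l01 : lebesgue_measure (`[0, 1]%classic : set R) = 1%E.
  by rewrite lebesgue_measure_itv/= lte_fin ltr01 oppr0 adde0.
have iM k : mu.-integrable `[0, 1] (EFin \o cst k).
  apply: measurable_bounded_integrable => //; last exact: bounded_cst.
  have l01f : (mu (`[0%R, 1%R]%classic) < +oo)%E by rewrite l01 ltry.
  exact: l01f.
have := @normc_Cintegral R _ _ (cst (M / y ^+ 2 * (B + B))) m01 (intFt y) (iM _).
rewrite Rintegral_cst// (_ : fine _ = 1) ?mulr1; last by rewrite -[RHS]/(fine 1%E) -l01.
apply => t; rewrite /= in_itv/= => /andP[t0 t1].
have rB : `|c0 + t * (c y - c0)| <= B.
  move: c0B (cB y); rewrite !ler_norml => /andP[a1 a2] /andP[b1 b2]; apply/andP; split; nra.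
rewrite normcM normc_real ler_pM ?normc_ge0//.
  by rewrite ler_pdivlMr//; exact: (FM (Phi t y)).
by apply: le_trans (ler_normB _ _) _; rewrite lerD.
Qed.

End Homotopy.

Lemma integrable_inv_sqr : mu.-integrable [set: R] (EFin \o (fun y : R => (y ^+ 2 + 1)^-1)).
Proof.
have D (y : R) : is_derive y 1 (@atan R) ((1 + y ^+ 2)^-1) by exact: is_derive1_atan.
apply: (@integrable_antiderivative R _ (fun n => - n.+1%:R) (fun n => n.+1%:R) (@atan R) _ pi).
- exact: measurableT.
- by move=> n; apply: (@lt_trans _ _ 0); rewrite ?oppr_lt0 ltr0n.
- by [].
- move=> n m nm; rewrite subsetEset; apply: subset_itv; rewrite bnd_simp ?lerN2 ler_nat//.
- move=> x _; near=> n; rewrite /= in_itv/= -ler_norml; apply: (@le_trans _ _ n%:R); last by rewrite ler_nat.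
  by near: n; exact: nbhs_infty_ger.
- by move=> x _; rewrite addrC.
- move=> x _; apply: cvgV; first by rewrite gt_eqF// ltr_wpDl ?sqr_ge0.
  by apply: cvgD; [exact: exprn_continuous|exact: cvg_cst].
- apply: continuous_measurable_fun => x; apply: cvgV; first by rewrite gt_eqF// ltr_wpDl ?sqr_ge0.
  by apply: cvgD; [exact: exprn_continuous|exact: cvg_cst].
- by move=> x _; rewrite invr_ge0 addr_ge0 ?sqr_ge0.
- move=> n; have := atan_ltpi2 (n.+1%:R : R); have := atan_gtNpi2 (- n.+1%:R : R).
  by move=> h1 h2; lra.
Unshelve. all: by end_near. Qed.

Lemma decay_bound F I (c : R -> R) (B M : R) :
  (forall s : R[i], `|Re s| <= B -> 1 <= `|Im s| -> normc (F s) * Im s ^+ 2 <= M) ->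
  (forall s, slit I B s -> {for s, continuous F}) ->
  continuous c -> (forall y, `|c y| <= B) -> I (c 0) ->
  exists M : R, forall y, normc (F (c y +i* y)) <= M * (y ^+ 2 + 1)^-1.
Proof.
move=> HM cF cc cB Ic.
have cN : continuous (fun y => normc (F (c y +i* y))).
  move=> y; have sl : slit I B (c y +i* y).
    by split; rewrite //=; case: (eqVneq y 0) => [->|]; [right|left].
  have h := continuous_re_im (cc y).
  exact: (cvg_normc (continuous_comp h (cF _ sl))).
have cK : compact (`[-1, 1]%classic : set R) by exact: segment_compact.
have [M' [_ HM']] := compact_bounded (continuous_compact (continuous_subspaceT cN) cK).
have M1 : M' < M' + 1 by rewrite ltrDl.
(* The factor 2 comes from y ^ 2 + 1 <= 2 where compactness bounds [F], and from y ^ 2 + 1 <= 2 * y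
   ^ 2 where the decay does. *)
exists (2 * (`|M| + `|M' + 1|)) => y.
have d0 : 0 < y ^+ 2 + 1 by rewrite ltr_wpDl ?sqr_ge0.
rewrite ler_pdivlMr//.
have n0 := normc_ge0 (F (c y +i* y)).
have [y1|y1] := leP `|y| 1.
  have h : normc (F (c y +i* y)) <= M' + 1.
    have := HM' (M' + 1) M1 (normc (F (c y +i* y))); rewrite /= ger0_norm//; apply.
    by exists y => //; rewrite /= in_itv/= -ler_norml.
  have y2 : y ^+ 2 <= 1 by rewrite -real_normK ?num_real// expr_le1.
  have h3 : normc (F (c y +i* y)) * (y ^+ 2 + 1) <= normc (F (c y +i* y)) * 2.
    by rewrite ler_wpM2l//; lra.
  have := ler_norm (M' + 1); have := normr_ge0 M; lra.
have h := HM (c y +i* y) (cB y) (ltW y1); rewrite /= in h.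
have y2 : 1 <= y ^+ 2 by rewrite -real_normK ?num_real// expr_ge1// ltW.
have h3 : normc (F (c y +i* y)) <= normc (F (c y +i* y)) * y ^+ 2 by rewrite ler_peMr.
rewrite mulrDr mulr1; have := ler_norm M; have := normr_ge0 (M' + 1); lra.
Qed.

Lemma contour_shift_strip (I : set R) F F' (c : R -> R) (c0 B1 M : R) :
  (forall x y (t : R), I x -> I y -> 0 <= t -> t <= 1 -> I (x + t * (y - x))) ->
  (forall s, slit I B1 s -> C1at F F' s) ->
  (forall s : R[i], `|Re s| <= B1 -> 1 <= `|Im s| -> normc (F s) * Im s ^+ 2 <= M) ->
  (forall y : R, derivable c y 1) -> continuous (derive1 c) ->
  (forall y, `|c y| <= B1) -> (forall y, `|derive1 c y| <= B1) -> `|c0| <= B1 ->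
  I c0 -> I (c 0) ->
  contour_integral c F = Cintegral setT (fun y => F (c0 +i* y) * (0 +i* 1)).
Proof.
move=> cI dF HMs dc cc' cB1 c'B1 c0B1 Ic0 Ic.
pose c' := derive1 c.
have dc1 (y : R) : is_derive y 1 c (c' y) by rewrite /c' derive1E; exact: derivableP.
have cc : continuous c.
  by move=> y; have [+ _] := dc1 y => /derivable1_diffP/differentiable_continuous.
have cF s : slit I B1 s -> {for s, continuous F} by move=> /dF[/cderivative_continuous].
have cc0 : continuous (fun _ : R => c0) by move=> y; exact: cvg_cst.
have [M1 HM] := decay_bound HMs cF cc cB1 Ic.
have [M0 HM0] := decay_bound HMs cF cc0 (fun=> c0B1) Ic0.
have sl (d : R -> R) y : I (d 0) -> `|d y| <= B1 -> slit I B1 (d y +i* y).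
  by split; rewrite //=; case: (eqVneq y 0) => [->|]; [right|left].
have cont (d d' : R -> R) : continuous d -> continuous d' -> I (d 0) ->
    (forall y, `|d y| <= B1) -> forall y : R, {for y, continuous (fun y : R => F (d y +i* y) * (d' y +i* 1))}.
  move=> cd cd' Id bd y.
  have h := continuous_re_im (cd y).
  have h' : {for y, continuous (fun y => d' y +i* 1)}.
    have [_ H] := @cvg_complexP R _ _ (nbhs_filter y) (fun y => d' y +i* 1) (d' y +i* 1).
    by apply: H; split => /=; [exact: cd'|exact: cvg_cst].
  exact: (cvgM (continuous_comp h (cF _ (sl d y Id (bd y)))) h').
have int (d d' : R -> R) K : continuous d -> continuous d' -> I (d 0) ->
    (forall y, `|d y| <= B1) -> (forall y, `|d' y| <= B1) -> (forall y, normc (F (d y +i* y)) <= K * (y ^+ 2 + 1)^-1) ->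
    cintegrable setT (fun y => F (d y +i* y) * (d' y +i* 1)).
  move=> cd cd' Id bd bd' HK.
  have iK : mu.-integrable setT (EFin \o (fun y : R => (K * (B1 + 1)) * (y ^+ 2 + 1)^-1)).
    exact: (integrableZl measurableT (K * (B1 + 1)) integrable_inv_sqr).
  apply: (cintegrable_le measurableT _ iK).
    exact: (cmeasurable_continuous (cont d d' cd cd' Id bd)).
  move=> y _; rewrite normcM mulrAC ler_pM ?normc_ge0//.
  by apply: le_trans (normc_le _) _; rewrite /= normr1 lerD2r.
have cst0 : continuous (fun _ : R => 0 : R) by move=> y; exact: cvg_cst.
have i1 := int c c' M1 cc cc' Ic cB1 c'B1 HM.
have i2 := int (fun=> c0) (fun=> 0) M0 cc0 cst0 Ic0 (fun=> c0B1) _ HM0.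
have {}i2 : cintegrable setT (fun y => F (c0 +i* y) * (0 +i* 1)).
  by apply: i2 => y; rewrite normr0 (le_trans (normr_ge0 c0)).
pose H y := Cintegral `[0, 1] (fun t => F ((c0 + t * (c y - c0)) +i* y) * (c y - c0)%:C).
pose Dy (y : R) : R[i] := F (c y +i* y) * (c' y +i* 1) + (- 1) * (F (c0 +i* y) * (0 +i* 1)).
have dH y : path_derivative H y (Dy y).
  have E : c0 + (c y - c0) = c y by ring.
  by have := homotopy_derivative cI dF dc1 cc' Ic0 Ic cB1 c0B1 y; rewrite mul1r mul0r addr0 E /Dy mulN1r.
have Hb y := @homotopy_bound _ _ _ _ _ _ cI dF Ic0 Ic cB1 c0B1 _ y HMs.
have i3 := cintegrableZl (- 1) measurableT i2.
have cDy (x : R) : {for x, continuous Dy}.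
  have h1 := cont _ _ cc cc' Ic cB1 x; have h2 := cont _ _ cc0 cst0 Ic0 (fun=> c0B1) x.
  exact: (ccontinuousD h1 (ccontinuousZ (c := -1) h2)).
(* [H] is an antiderivative of [Dy], and its values at heights plus and minus n + 1 tend to 0. *)
have : Cintegral setT Dy = 0.
  apply: (@Cintegral_FTC R _ (fun n => - n.+1%:R) (fun n => n.+1%:R) H).
  - exact: measurableT.
  - by move=> n; apply: (@lt_trans _ _ 0); rewrite ?oppr_lt0 ltr0n.
  - by [].
  - move=> x _; near=> n; rewrite /= in_itv/= -ler_norml; apply: (@le_trans _ _ n%:R); last by rewrite ler_nat.
    by near: n; exact: nbhs_infty_ger.
  - by move=> x _; exact: dH.
  - by move=> x _; exact: cDy.
  - exact: (cintegrableD measurableT i1 i3).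
  - have lim0 : (4 * (`|M| * (B1 + B1))) * n.+1%:R^-1 @[n --> \oo] --> (0 : R).
      rewrite -[X in _ --> X](mulr0 (4 * (`|M| * (B1 + B1)))); apply: cvgM; first exact: cvg_cst.
      exact: cvg_harmonic.
    have B10 : 0 <= B1 by apply: le_trans (normr_ge0 c0) c0B1.
    have b (y : R) (n : nat) : `|y| = n.+1%:R -> normc (H y) <= 2 * (`|M| * (B1 + B1)) * n.+1%:R^-1.
      move=> yn; apply: le_trans (Hb y _) _; first by rewrite yn ler1n.
      rewrite -[y ^+ 2]real_normK ?num_real// yn.
      rewrite (_ : 2 * (`|M| * (B1 + B1)) / n.+1%:R = 2 * (`|M| / n.+1%:R * (B1 + B1))); last by ring.
      rewrite ler_wpM2l// ler_wpM2r ?addr_ge0//.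
      have h0 : (0 : R) < n.+1%:R by rewrite ltr0n.
      have h1 : (1 : R) <= n.+1%:R by rewrite ler1n.
      apply: (@le_trans _ _ (`|M| / n.+1%:R ^+ 2)).
        by rewrite ler_wpM2r ?invr_ge0 ?sqr_ge0// ler_norm.
      by rewrite ler_wpM2l// lef_pV2 ?posrE ?exprn_gt0// expr2 ler_peMr// ltW.
    apply: (cvgy_normc0 (F := nbhs \oo) _ lim0); apply: nearW => n.
    apply: le_trans (normcB _ _) _.
    have n1 : `|n.+1%:R| = n.+1%:R :> R by rewrite ger0_norm.
    have h1 := b n.+1%:R n n1; rewrite -normrN in n1; have h2 := b (- n.+1%:R) n n1.
    by apply: le_trans (lerD h1 h2) _; rewrite le_eqVlt; apply/orP; left; apply/eqP; ring.
rewrite CintegralD// CintegralZl// mulN1r => /eqP; rewrite subr_eq0 => /eqP.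
exact.
Unshelve. all: by end_near. Qed.

Lemma contour_shift (I : set R) F (c : R -> R) (c0 : R) :
  (forall x y (t : R), I x -> I y -> 0 <= t -> t <= 1 -> I (x + t * (y - x))) ->
  regular I F -> quadratic_decay F -> is_contour c -> I c0 -> I (c 0) ->
  contour_integral c F = Cintegral setT (fun y => F (c0 +i* y) * (0 +i* 1)).
Proof.
move=> cI rF decF [dc cc' [B HB]] Ic0 Ic.
(* One bound for the contour, its slope and the line: the whole homotopy takes place in this strip,
   where [F] has a single continuously differentiable representative [G]. *)
pose B1 := Num.max B `|c0|.
have cB1 y : `|c y| <= B1 by rewrite le_max (HB y).1.
have c'B1 y : `|derive1 c y| <= B1 by rewrite le_max (HB y).2.
have c0B1 : `|c0| <= B1 by rewrite le_max lexx orbT.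
have [G [G' HG]] := rF B1; have [M HM] := decF B1.
have sl (d : R -> R) y : I (d 0) -> `|d y| <= B1 -> slit I B1 (d y +i* y).
  by split; rewrite //=; case: (eqVneq y 0) => [->|]; [right|left].
have -> : contour_integral c F = contour_integral c G.
  by apply: eq_Cintegral => y _; rewrite (HG _ (sl c y Ic (cB1 y))).1.
have -> : Cintegral setT (fun y => F (c0 +i* y) * (0 +i* 1)) = Cintegral setT (fun y => G (c0 +i* y) * (0 +i* 1)).
  by apply: eq_Cintegral => y _; rewrite (HG _ (sl (fun=> c0) y Ic0 c0B1)).1.
have HMG (s : R[i]) : `|Re s| <= B1 -> 1 <= `|Im s| -> normc (G s) * Im s ^+ 2 <= M.
  by move=> sB s1; rewrite -(HG s _).1 ?HM//; split => //; left; rewrite -normr_gt0 (lt_le_trans ltr01 s1).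
have dG s : slit I B1 s -> C1at G G' s by move=> /HG[].
exact: (contour_shift_strip cI dG HMG dc cc' cB1 c'B1 c0B1 Ic0 Ic).
Qed.

Lemma regular_line (I : set R) F (c0 : R) : regular I F -> quadratic_decay F -> I c0 ->
  (forall y : R, {for y, continuous (fun y : R => F (c0 +i* y))}) /\
  exists M : R, forall y : R, normc (F (c0 +i* y)) <= M * (y ^+ 2 + 1)^-1.
Proof.
move=> rF decF Ic0; have [G [G' HG]] := rF `|c0|; have [M HM] := decF `|c0|.
have sl (y : R) : slit I `|c0| (c0 +i* y).
  by split; rewrite //=; case: (eqVneq y 0) => [_|]; [right|left].
have cG s : slit I `|c0| s -> {for s, continuous G} by move=> /HG[_ []/cderivative_continuous].
have -> : (fun y : R => F (c0 +i* y)) = (fun y : R => G (c0 +i* y)).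
  by apply/funext => y; rewrite (HG _ (sl y)).1.
split=> [y|].
  have h : {for y, continuous (fun y : R => c0 +i* y)} by apply: continuous_re_im; exact: cvg_cst.
  exact: (continuous_comp h (cG _ (sl y))).
have HMG (s : R[i]) : `|Re s| <= `|c0| -> 1 <= `|Im s| -> normc (G s) * Im s ^+ 2 <= M.
  by move=> sB s1; rewrite -(HG s _).1 ?HM//; split => //; left; rewrite -normr_gt0 (lt_le_trans ltr01 s1).
have cc0 : continuous (fun _ : R => c0) by move=> y; exact: cvg_cst.
have [M0 HM0] := decay_bound HMG cG cc0 (fun=> lexx _) Ic0.
by exists M0 => y; rewrite (HG _ (sl y)).1.
Qed.

End ContourShift.

(** * The Gamma function *)

Section GammaFunction.
Variable R : realType.
Local Notation mu := (@lebesgue_measure R).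
Implicit Types (z w s : R[i]).

Definition Mellin (f : R -> R) (s : R[i]) : R[i] :=
  Cintegral `]0, +oo[ (fun u => Cpow u (s - 1) * (f u)%:C).

Lemma measurable_pos : measurable (`]0, +oo[%classic : set R).
Proof. exact: measurable_itv. Qed.

Lemma pos_itv (u : R) : `]0, +oo[%classic u -> 0 < u.
Proof. by rewrite /= in_itv/= andbT. Qed.

Lemma cmeasurable_Mellin (f : R -> R) s D : measurable_fun setT f ->
  cmeasurable (D : set R) (fun u => Cpow u (s - 1) * (f u)%:C).
Proof.
move=> mf; apply: cmeasurableM; last by apply: cmeasurable_real; exact: measurable_funTS.
by apply: cmeasurable_Cpow => //; exact: cmeasurable_cst.
Qed.

Lemma normc_Mellin (f : R -> R) s (u : R) : 0 < u ->
  normc (Cpow u (s - 1) * (f u)%:C) = `|u `^ (Re s - 1) * f u|.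
Proof.
move=> u0; rewrite normcM normc_real normc_Cpow// normrM.
by rewrite (ger0_norm (powR_ge0 _ _)) ReD ReN.
Qed.

Lemma cintegrable_Mellin (f : R -> R) s : measurable_fun setT f ->
  mu.-integrable `]0, +oo[ (EFin \o (fun u => u `^ (Re s - 1) * f u)) ->
  cintegrable `]0, +oo[ (fun u => Cpow u (s - 1) * (f u)%:C).
Proof.
move=> mf intf; apply: (cintegrable_le measurable_pos _ (integrable_norm intf)).
  exact: cmeasurable_Mellin.
by move=> u /pos_itv u0; rewrite (normc_Mellin f s u0).
Qed.

Lemma expR_norm_le (a x : R) : 0 <= a -> expR (a * `|x|) <= expR (a * x) + expR (- a * x).
Proof.
move=> a0; have [x0|x0] := ger0P x; first by rewrite lerDl expR_ge0.
by rewrite mulrN -mulNr lerDr expR_ge0.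
Qed.

Lemma cderivative_Mellin (p : R) (f : R -> R) z : measurable_fun setT f ->
  (forall c, p < c -> mu.-integrable `]0, +oo[ (EFin \o (fun u => u `^ (c - 1) * f u))) ->
  p < Re z -> cderivative (Mellin f) z (Mellin (fun u => ln u * f u) z).
Proof.
move=> mf intf pz.
have mlf : measurable_fun setT (fun u => ln u * f u).
  by apply: measurable_funM => //; exact: measurable_ln.
have intlf := mellin_ln mf intf.
(* The remainder contains (ln u)^2 and exp (|h| |ln u|). Each is absorbed by exp (e |ln u|), so the
   exponent moves by 2 * e at most, and [Re z - 2 * e] is still above [p]. *)
pose e := (Re z - p) / 4.
have e0 : 0 < e by rewrite divr_gt0// subr_gt0.
have i1 := integrable_norm (intf (Re z + 2 * e) _).
have i2 := integrable_norm (intf (Re z - 2 * e) _).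
have {}i1 : mu.-integrable `]0, +oo[ (EFin \o (fun u => `|u `^ (Re z + 2 * e - 1) * f u|)).
  by apply: i1; rewrite /e; lra.
have {}i2 : mu.-integrable `]0, +oo[ (EFin \o (fun u => `|u `^ (Re z - 2 * e - 1) * f u|)).
  by apply: i2; rewrite /e; lra.
pose g u := (2 / e ^+ 2 * 2) * (`|u `^ (Re z + 2 * e - 1) * f u| + `|u `^ (Re z - 2 * e - 1) * f u|).
have ig : mu.-integrable `]0, +oo[ (EFin \o g).
  have i3 : mu.-integrable `]0, +oo[ (fun u => (2 / e ^+ 2 * 2)%:E *
     ((`|u `^ (Re z + 2 * e - 1) * f u|)%:E + (`|u `^ (Re z - 2 * e - 1) * f u|)%:E))%E.
    by apply: integrableZl => //; apply: integrableD.
  exact: i3.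
apply: (@cderivative_quadratic _ _ _ _ (2 * Rintegral mu `]0, +oo[ g) e) => // h he.
have hRe : `|Re h| < e by apply: le_lt_trans he; exact: normc_Re.
have jz : cintegrable `]0, +oo[ (fun u => Cpow u (z - 1) * (f u)%:C).
  by apply: cintegrable_Mellin => //; exact: intf.
have jzh : cintegrable `]0, +oo[ (fun u => Cpow u (z + h - 1) * (f u)%:C).
  apply: cintegrable_Mellin => //; apply: intf; rewrite ReD.
  by move: hRe; rewrite ltr_norml /e => /andP[]; lra.
have jl : cintegrable `]0, +oo[ (fun u => Cpow u (z - 1) * (ln u * f u)%:C).
  by apply: cintegrable_Mellin => //; exact: intlf.
have j2 := cintegrableZl (-1) measurable_pos jz.
have j3 := cintegrableZl (- h) measurable_pos jl.
have -> : Mellin f (z + h) - Mellin f z - h * Mellin (fun u => ln u * f u) z =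
   Cintegral `]0, +oo[ (fun u => (Cpow u (z + h - 1) * (f u)%:C + (-1) * (Cpow u (z - 1) * (f u)%:C))
      + (- h) * (Cpow u (z - 1) * (ln u * f u)%:C)).
  rewrite CintegralD; [|exact: measurable_pos|exact: (cintegrableD measurable_pos jzh j2)|exact: j3].
  rewrite CintegralD; [|exact: measurable_pos|exact: jzh|exact: j2].
  by rewrite !CintegralZl ?mulN1r ?mulNr//; exact: measurable_pos.
have jj := cintegrableD measurable_pos (cintegrableD measurable_pos jzh j2) j3.
have ig2 : mu.-integrable `]0, +oo[ (EFin \o (fun u => normc h ^+ 2 * g u)).
  by apply: (integrableZl _ (normc h ^+ 2) ig).
apply: le_trans (normc_Cintegral (g := fun u => normc h ^+ 2 * g u) measurable_pos jj ig2 _) _; last first.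
  by rewrite RintegralZl// le_eqVlt; apply/orP; left; apply/eqP; ring.
move=> u /pos_itv u0.
have -> : Cpow u (z + h - 1) * (f u)%:C + -1 * (Cpow u (z - 1) * (f u)%:C) +
    - h * (Cpow u (z - 1) * (ln u * f u)%:C) =
    (Cpow u (z - 1) * (f u)%:C) * (Cexp (h * (ln u)%:C) - 1 - h * (ln u)%:C).
  rewrite (_ : z + h - 1 = (z - 1) + h); last by ring.
  by rewrite CpowD rmorphM /= !CpowE; ring.
rewrite normcM (normc_Mellin _ _ u0).
have k1 := Cexp_remainder (h * (ln u)%:C).
rewrite normcM normc_real in k1.
have k2 : normc (Cexp (h * (ln u)%:C) - 1 - h * (ln u)%:C) <=
    normc h ^+ 2 * (2 / e ^+ 2 * 2 * (u `^ (2 * e) + u `^ (- (2 * e)))).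
  have a1 : expR (normc h * `|ln u|) <= expR (e * `|ln u|).
    by rewrite ler_expR ler_wpM2r// ltW.
  have a2 : `|ln u| ^+ 2 <= 2 / e ^+ 2 * expR (e * `|ln u|).
    have el0 : 0 <= e * `|ln u| by rewrite mulr_ge0// ltW.
    have a5 : (e * `|ln u|) ^+ 2 / 2 <= expR (e * `|ln u|).
      have := @expR_ge1Dxn R _ 1 el0; apply: le_trans.
      by rewrite lerDr.
    rewrite mulrAC ler_pdivlMr ?exprn_gt0// mulrC -exprMn -ler_pdivrMl//.
    by rewrite mulrC.
  have a3 : expR (e * `|ln u|) * expR (e * `|ln u|) <= u `^ (2 * e) + u `^ (- (2 * e)).
    rewrite -expRD -mulrDl /powR (gt_eqF u0) (_ : e + e = 2 * e); last by ring.
    by apply: expR_norm_le; rewrite mulr_ge0// ltW.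
  have a4 : `|ln u| ^+ 2 * expR (normc h * `|ln u|) <=
      2 / e ^+ 2 * (u `^ (2 * e) + u `^ (- (2 * e))).
    apply: (@le_trans _ _ (2 / e ^+ 2 * expR (e * `|ln u|) * expR (e * `|ln u|))).
      by rewrite ler_pM ?sqr_ge0 ?expR_ge0.
    by rewrite -mulrA ler_wpM2l ?divr_ge0 ?sqr_ge0.
  apply: le_trans k1 _.
  rewrite (_ : 2 * _ = normc h ^+ 2 * (2 * (`|ln u| ^+ 2 * expR (normc h * `|ln u|)))); last by ring.
  rewrite (_ : 2 / e ^+ 2 * 2 * _ = 2 * (2 / e ^+ 2 * (u `^ (2 * e) + u `^ (- (2 * e))))); last by ring.
  by rewrite ler_wpM2l ?exprn_ge0 ?normc_ge0// ler_wpM2l.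
apply: le_trans (ler_wpM2l (normr_ge0 _) k2) _.
rewrite mulrCA ler_wpM2l ?sqr_ge0// mulrCA ler_wpM2l ?mulr_ge0 ?invr_ge0 ?sqr_ge0//.
rewrite mulrDr le_eqVlt; apply/orP; left; apply/eqP.
rewrite !normrM !(ger0_norm (powR_ge0 _ _)).
rewrite (_ : Re z + 2 * e - 1 = (Re z - 1) + 2 * e); last by ring.
rewrite (_ : Re z - 2 * e - 1 = (Re z - 1) + - (2 * e)); last by ring.
rewrite [u `^ (Re z - 1 + 2 * e)]powRD ?(gt_eqF u0) ?implybT//.
rewrite [u `^ (Re z - 1 + - (2 * e))]powRD ?(gt_eqF u0) ?implybT//.
ring.
Qed.

Lemma C1at_Mellin (p : R) (f : R -> R) z : measurable_fun setT f ->
  (forall c, p < c -> mu.-integrable `]0, +oo[ (EFin \o (fun u => u `^ (c - 1) * f u))) ->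
  p < Re z -> C1at (Mellin f) (Mellin (fun u => ln u * f u)) z.
Proof.
move=> mf intf pz; split; first exact: cderivative_Mellin intf pz.
have mlf : measurable_fun setT (fun u => ln u * f u).
  by apply: measurable_funM => //; exact: measurable_ln.
exact: (cderivative_continuous (cderivative_Mellin mlf (mellin_ln mf intf) pz)).
Qed.

Lemma C1at_Gamma_Euler z : 0 < Re z ->
  C1at (@Gamma_Euler R) (Mellin (fun u => ln u * expR (- u))) z.
Proof.
by move=> z0; apply: (@C1at_Mellin 0) => //; [exact: measurable_expRN|exact: gamma_integrable].
Qed.

Lemma Gamma_Euler_bound (a b : R) : 0 < a -> exists M : R, forall z, a <= Re z -> Re z <= b ->
  normc (Gamma_Euler z) <= M.
Proof.
(* For u <= 1 the smallest exponent dominates, for u > 1 the largest; [|b| + a] is at least [b] and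
   is positive whatever the sign of [b]. *)
move=> a0; pose g u := u `^ (a - 1) * expR (- u) + u `^ (`|b| + a - 1) * expR (- u).
have i1 := gamma_integrable a0.
have i2 : mu.-integrable `]0, +oo[ (EFin \o (fun u => u `^ (`|b| + a - 1) * expR (- u))).
  by apply: gamma_integrable; rewrite ltr_wpDl.
have ig : mu.-integrable `]0, +oo[ (EFin \o g) by apply: (integrableD _ i1 i2).
exists (2 * Rintegral mu `]0, +oo[ g) => z az zb.
apply: (normc_Cintegral measurable_pos _ ig).
  by apply: cintegrable_Mellin; [exact: measurable_expRN|apply: gamma_integrable; exact: lt_le_trans az].
move=> u /pos_itv u0.
have E : normc (Cpow u (z - 1) * (expR (- u))%:C) = `|u `^ (Re z - 1) * expR (- u)| :=
  normc_Mellin (fun u => expR (- u)) z u0.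
rewrite E normrM.
rewrite (ger0_norm (powR_ge0 _ _)) (ger0_norm (expR_ge0 _)) /g -mulrDl ler_wpM2r ?expR_ge0//.
have [u1|u1] := leP u 1.
  rewrite ler_wpDr ?powR_ge0// /powR gt_eqF// ler_expR ler_wnM2r ?lerD2r//.
  by rewrite ln_le0.
rewrite ler_wpDl ?powR_ge0// /powR gt_eqF// ler_expR ler_wpM2r ?lerD2r//; last first.
  by apply: le_trans zb _; rewrite ler_wpDr ?ler_norm// ltW.
by rewrite ln_ge0// ltW.
Qed.

Lemma path_derivative_Cpow (w : R[i]) (u : R) : 0 < u ->
  path_derivative (fun u => Cpow u w) u (w * Cpow u (w - 1)).
Proof.
move=> u0; have d1 := path_derivative_real (is_derive1_ln u0).
have d2 := path_derivativeM (path_derivative_cst w u) d1.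
have := path_derivative_comp (cderivative_Cexp (w * (ln u)%:C)) d2.
rewrite mul0r add0r /= mulrCA (_ : Cexp _ * _ = Cpow u (w - 1))//.
by rewrite CpowD CpowN Cpow1// -fmorphV.
Qed.

Lemma harmonic_at_right : n.+1%:R^-1 @[n --> \oo] --> (0 : R)^'+.
Proof.
move=> A HA; suff : \forall n \near \oo, A (n.+1%:R^-1) by [].
have [e /= e0 eA] := HA.
have /cvgrPdist_lt/(_ e e0) := @cvg_harmonic R.
apply: filterS => n ne; apply: eA; first exact: ne.
by rewrite /= invr_gt0.
Qed.

Lemma cvg_harmonic_powR (x : R) : 0 < x -> (n.+1%:R^-1 : R) `^ x @[n --> \oo] --> (0 : R).
Proof. by move=> x0; exact: (cvg_comp _ _ harmonic_at_right (powR_cvg0 x0)). Qed.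

Lemma Gamma_Euler_rec z : 0 < Re z -> Gamma_Euler (z + 1) = z * Gamma_Euler z.
Proof.
(* Integration by parts: [F] is the boundary term, and its derivative is z times one integrand minus
   the other. *)
move=> z0; pose F (u : R) := Cpow u z * (expR (- u))%:C.
pose j1 (u : R) := Cpow u (z - 1) * (expR (- u))%:C.
pose j2 (u : R) := Cpow u (z + 1 - 1) * (expR (- u))%:C.
have i1 : cintegrable `]0, +oo[ j1.
  by apply: cintegrable_Mellin; [exact: measurable_expRN|exact: gamma_integrable].
have i2 : cintegrable `]0, +oo[ j2.
  apply: cintegrable_Mellin; [exact: measurable_expRN|apply: gamma_integrable].
  by rewrite ReD addr_gt0.
have i1z := cintegrableZl z measurable_pos i1.
have i2z := cintegrableZl (-1) measurable_pos i2.
suff : Cintegral `]0, +oo[ (fun u => z * j1 u + (-1) * j2 u) = 0.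
  rewrite CintegralD; [|exact: measurable_pos|exact: i1z|exact: i2z].
  rewrite !CintegralZl; [|exact: measurable_pos|exact: i2|exact: measurable_pos|exact: i1].
  by rewrite mulN1r => /eqP; rewrite subr_eq0 => /eqP.
have dF (u : R) : 0 < u -> path_derivative F u (z * j1 u + (-1) * j2 u).
  move=> u0; have d := path_derivativeM (path_derivative_Cpow z u0) (path_derivative_real (is_derive_expRN u)).
  suff -> : z * j1 u + (-1) * j2 u =
    z * Cpow u (z - 1) * (expR (- u))%:C + Cpow u z * (- expR (- u))%:C by exact: d.
  by rewrite /j1 /j2 addrK rmorphN; ring.
have dj w (u : R) : 0 < u -> exists d, path_derivative (fun x : R => Cpow x w * (expR (- x))%:C) u d.
  by move=> u0; eexists; exact: (path_derivativeM (path_derivative_Cpow w u0)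
    (path_derivative_real (is_derive_expRN u))).
have nF (u : R) : 0 < u -> normc (F u) = u `^ Re z * expR (- u).
  by move=> u0; rewrite normcM normc_Cpow// normc_real ger0_norm ?expR_ge0.
apply: (@Cintegral_FTC R _ (fun n => n.+1%:R^-1) (fun n => n.+2%:R) F).
- exact: measurable_pos.
- move=> n; apply: (@le_lt_trans _ _ 1); last by rewrite (ltr_nat R 1).
  by rewrite invf_le1// ler1n.
- exact: exhaust_pos_itv.
- by move=> x; exact: exhaust_pos.
- by move=> x /=; rewrite in_itv/= andbT; exact: dF.
- move=> x /=; rewrite in_itv/= andbT => x0.
  have [d1 D1] := dj (z - 1) x x0; have [d2 D2] := dj (z + 1 - 1) x x0.
  exact: (path_derivative_continuous (path_derivativeD
    (path_derivativeM (path_derivative_cst z x) D1) (path_derivativeM (path_derivative_cst (-1) x) D2))).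
- exact: (cintegrableD measurable_pos i1z i2z).
(* As m + 1 > Re z, bounding exp (- u) by (m + 2)! u^(- (m + 2)) leaves at most (m + 2)! / u at the
   upper end. *)
pose m := Num.truncn (Re z).
have lim : m.+2`!%:R * (n.+1%:R^-1 : R) `^ 1 + (n.+1%:R^-1 : R) `^ Re z @[n --> \oo] --> (0 : R).
  have l1 := @cvg_harmonic_powR 1 ltr01; have l2 := cvg_harmonic_powR z0.
  have l3 := cvgD (cvgM (cvg_cst (m.+2`!%:R : R)) l1) l2.
  by rewrite mulr0 addr0 in l3; exact: l3.
apply: (cvgy_normc0 (F := nbhs \oo) _ lim); apply: nearW => n.
apply: le_trans (normcB _ _) _; rewrite !nF ?invr_gt0// lerD//; last first.
  by rewrite ler_piMr ?powR_ge0// -expR0 ler_expR oppr_le0 invr_ge0.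
have n1 : 1 <= n.+2%:R :> R by rewrite ler1n.
apply: le_trans (ler_wpM2l (powR_ge0 _ _) (expRN_le_powR m.+1 n1)) _.
have n0 : (0 : R) < n.+2%:R by rewrite ltr0n.
rewrite mulrCA ler_wpM2l// -powRD ?(gt_eqF n0) ?implybT//.
apply: (@le_trans _ _ ((n.+2%:R : R) `^ (-1))).
  rewrite /powR gt_eqF// ler_expR ler_wpM2r ?ln_ge0//.
  by have := truncnS_gt (Re z); rewrite -/m => h; rewrite -[m.+2]addn1 natrD; lra.
rewrite powRr1 ?invr_ge0// powRN powRr1// lef_pV2 ?posrE// ler_nat.
exact: leqW.
Qed.

(** The formula of [Gamma] with the number of shifts frozen. In [Gamma] that number jumps with Re z,
    whereas this function is analytic away from the poles in the whole half-plane Re z > - N. *)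
Definition Gamma_shifted N z := Gamma_Euler (z + N%:R) / \prod_(i < N) (z + i%:R).

Lemma Gamma_shiftedS N z : 0 < Re z + N%:R -> Gamma_shifted N.+1 z = Gamma_shifted N z.
Proof.
move=> zN; rewrite /Gamma_shifted big_ord_recr /= -natr1 addrA Gamma_Euler_rec; last first.
  by rewrite ReD Re_nat.
have zN0 : z + N%:R != 0.
  by apply: contraTneq zN => zN; rewrite -Re_nat -ReD zN ltxx.
by rewrite [_ * (z + N%:R)]mulrC invfM mulrA [_ * Gamma_Euler _]mulrC mulfK.
Qed.

Lemma GammaE N z : 0 < Re z + N%:R -> Gamma z = Gamma_shifted N z.
Proof.
move=> zN; rewrite [LHS]/(Gamma_shifted (Num.truncn (1 - Re z)) z).
set N0 := Num.truncn (1 - Re z).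
have zN0 : 0 < Re z + N0%:R by have := truncnS_gt (1 - Re z); rewrite -/N0 -natr1; lra.
have N0N : (N0 <= N)%N.
  case: (posnP N0) => [->//|N01].
  have z1 : 0 <= 1 - Re z.
    rewrite leNgt; apply/negP => z1; have /truncn0Pn N00 : ~~ (1 <= 1 - Re z).
      by rewrite -ltNge; lra.
    by move: N01; rewrite /N0 N00.
  have := truncn_le (1 - Re z); rewrite z1 -/N0 => h; rewrite -ltnS -(ltr_nat R) -natr1; lra.
rewrite -(subnKC N0N); elim: (N - N0)%N => [|k IH]; first by rewrite addn0.
rewrite addnS Gamma_shiftedS// natrD; apply: (lt_le_trans zN0); rewrite lerD2l lerDl//.
Qed.

Lemma exists_nat_gt (x : R) : exists N : nat, x < N%:R.
Proof. by exists (Num.truncn x).+1; exact: truncnS_gt. Qed.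

(** Also true at the negative poles, where both sides are 0 by convention; at z = 0 it would read 1
    = 0. *)
Lemma Gamma_rec z : z != 0 -> Gamma (z + 1) = z * Gamma z.
Proof.
move=> z0; have [N HN] := exists_nat_gt (- Re z).
rewrite (@GammaE N); last by rewrite ReD; have : Re (1 : R[i]) = 1 by []; lra.
rewrite (@GammaE N.+1); last by rewrite -natr1; lra.
rewrite /Gamma_shifted big_ord_recl /= addr0 invfM mulrCA [z * (z^-1 * _)]mulrA mulfV// mul1r.
rewrite -addrA [1 + _]addrC natr1; congr (_ / _).
by apply: eq_bigr => i _; rewrite /bump /= add1n -natr1 -addrA [1 + _]addrC.
Qed.

(** With r = exp v the quotient (r - 1)^2 / r is 4 sinh (v / 2)^2. The bound trades a squared
    logarithm for powers of r, whose integrals against u^(x - 1) exp (- u) are again values of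
    Gamma. *)
Lemma ln_sqr_le (r : R) : 0 < r -> ln r ^+ 2 <= 4 * ((r - 1) ^+ 2 / r).
Proof.
move=> r0; have key (v : R) : 0 <= v -> v ^+ 2 <= 4 * (expR v + expR (- v) - 2).
  move=> v0; have h1 : 1 + v / 2 <= expR (v / 2) by exact: expR_ge1Dx.
  have h2 : expR (- (v / 2)) <= 1 by rewrite -expR0 ler_expR oppr_le0 divr_ge0.
  have h3 : expR (v / 2) * expR (- (v / 2)) = 1 by rewrite -expRD subrr expR0.
  have -> : expR v = expR (v / 2) ^+ 2 by rewrite -expRM_natl; congr expR; field.
  have -> : expR (- v) = expR (- (v / 2)) ^+ 2 by rewrite -expRM_natl; congr expR; field.
  have h4 := expR_gt0 (- (v / 2)).
  have h5 : 0 <= v / 2 by rewrite divr_ge0.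
  have : (v / 2) ^+ 2 <= (expR (v / 2) - expR (- (v / 2))) ^+ 2.
    by rewrite ler_sqr ?nnegrE//; lra.
  rewrite sqrrB h3; lra.
have E : (r - 1) ^+ 2 / r = expR (ln r) + expR (- ln r) - 2.
  by rewrite expRN lnK ?posrE//; field; rewrite gt_eqF.
rewrite E; have [l0|l0] := ger0P (ln r); first exact: key.
by have := key (- ln r); rewrite sqrrN opprK [expR (- _) + _]addrC; apply; rewrite oppr_ge0 ltW.
Qed.

(** The modulus n satisfies n ^ 2 <= 2 * t ^ 2, and n <= 1/4 + n ^ 2 because (n - 1/2) ^ 2 >= 0. A
    bound in t ^ 2 is the one that [ln_sqr_le] can be combined with. *)
Lemma normc_Cexp_i (t : R) : normc (Cexp (0 +i* t) - 1) <= 4^-1 + 2 * t ^+ 2.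
Proof.
have h : (normc (Cexp (0 +i* t) - 1)) ^+ 2 <= 2 * t ^+ 2.
  have -> : normc (Cexp (0 +i* t) - 1) ^+ 2 = (cos t - 1) ^+ 2 + sin t ^+ 2.
    by rewrite normc_sqr CexpE !ReImE /= expR0; ring.
  have -> : (cos t - 1) ^+ 2 + sin t ^+ 2 = 2 - 2 * cos t.
    by have := cos2Dsin2 t; rewrite sqrrB expr1n; lra.
  have e1 (u : R) : is_derive u 1 (fun u : R => u * t) t.
    have H2 := is_deriveM (is_derive_id u 1) (is_derive_cst t u 1); apply: (is_derive_eq H2).
    by rewrite scaler0 add0r /GRing.scale /= mulr1.
  have e3 (u : R) := @is_derive1_comp R cos (fun u => u * t) u _ _ (is_derive_cos _) (e1 u).
  have e4 (u : R) := @is_derive1_comp R sin (fun u => u * t) u _ _ (is_derive_sin _) (e1 u).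
  have e5 (u : R) : is_derive u 1 (fun u => - sin (u * t) * t) (- (cos (u * t) * t) * t).
    have H2 := is_deriveM (is_deriveN (e4 u)) (is_derive_cst t u 1); apply: (is_derive_eq H2).
    by rewrite scaler0 add0r /GRing.scale /= mulrC.
  have := @second_order_remainder R (fun u => cos (u * t)) _ _ (t ^+ 2) e3 e5.
  rewrite /= mul1r mul0r cos0 sin0 oppr0 mul0r subr0 => H.
  have : `|cos t - 1| <= t ^+ 2.
    apply: H => u u0 u1; rewrite mulNr normrN -mulrA -expr2 normrM [`|t ^+ 2|]ger0_norm ?sqr_ge0//.
    by rewrite ler_piMl ?sqr_ge0// ler_norml cos_geN1 cos_le1.
  by rewrite ler_norml => /andP[]; lra.
have h0 := normc_ge0 (Cexp (0 +i* t) - 1).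
have : 0 <= (normc (Cexp (0 +i* t) - 1) - 2^-1) ^+ 2 by exact: sqr_ge0.
rewrite sqrrB; lra.
Qed.

Definition rG (x : R) : R := Rintegral mu `]0, +oo[ (fun u => u `^ (x - 1) * expR (- u)).

Lemma Gamma_Euler_real (x : R) : Gamma_Euler x%:C = (rG x)%:C.
Proof.
rewrite -Cintegral_real; apply: eq_Cintegral => u; rewrite /= in_itv/= andbT => u0.
by rewrite rmorphM /= -Cpow_real// rmorphB.
Qed.

Lemma rG_rec (x : R) : 0 < x -> rG (x + 1) = x * rG x.
Proof.
move=> x0; have := @Gamma_Euler_rec x%:C x0.
by rewrite -[1]/(1%:C) -rmorphD /= !Gamma_Euler_real -rmorphM => -[].
Qed.

Lemma rG_gt0 (x : R) : 1 <= x -> 0 < rG x.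
Proof.
move=> x1; have x0 : 0 < x by exact: lt_le_trans x1.
have m12 : measurable (`[1, 2]%classic : set R) by exact: measurable_itv.
have l12 : (mu (`[1%R, 2%R]%classic : set R) = 1)%E.
  rewrite lebesgue_measure_itv/= lte_fin ltr1n -EFinB; congr (_%:E); ring.
pose g : R -> R := (fun _ : R => expR (- 2)) \_ (`[1, 2]%classic : set R).
have ig : mu.-integrable `]0, +oo[ (EFin \o g).
  have i12 : mu.-integrable `[1, 2] (EFin \o cst (expR (- 2 : R))).
    apply: measurable_bounded_integrable => //; last exact: bounded_cst.
    have l : (mu (`[1%R, 2%R]%classic : set R) < +oo)%E by rewrite l12 ltry.
    exact: l.
  have h : mu.-integrable `]0, +oo[ ((EFin \o cst (expR (- 2 : R))) \_ `[1, 2]).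
    apply/integrable_restrict => //; apply: integrableS i12 => //; exact: measurableI.
  by move: h; rewrite -restrict_EFin.
have H : expR (-2) <= rG x; last exact: lt_le_trans (expR_gt0 _) H.
have -> : expR (-2) = Rintegral mu `]0, +oo[ g.
  rewrite -Rintegral_mkcondr setIidr; last first.
    by move=> u /=; rewrite !in_itv/= andbT => /andP[+ _]; exact: lt_le_trans.
  rewrite Rintegral_cst// (_ : fine _ = 1) ?mulr1//.
  by rewrite -[RHS]/(fine 1%E) -l12.
apply: le_Rintegral => //; first exact: gamma_integrable.
move=> u /pos_itv u0; case: ifPn => [|_]; last first.
  have -> : point = 0 :> R by [].
  by rewrite mulr_ge0 ?powR_ge0 ?expR_ge0.
rewrite inE /= in_itv/= => /andP[u1 u2]; rewrite -[leLHS]mul1r ler_pM ?expR_ge0//.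
  apply: (@le_trans _ _ (u `^ 0)); first by rewrite powRr0.
  by rewrite ler_powR// subr_ge0.
by rewrite ler_expR lerN2.
Qed.

(* For large [x], [Gamma (x + iy)] is close to [x^(iy) Gamma x]; a zero of
   Gamma off the poles would propagate to all the translates by an integer. *)
Lemma Gamma_Euler_neq0_large (x y : R) : 1 + 32 * y ^+ 2 < x -> Gamma_Euler (x +i* y) != 0.
Proof.
move=> xy; have y2 := sqr_ge0 y.
have x1 : 1 < x by lra.
have x0 : 0 < x by lra.
(* [g] is u^(x - 1) exp (- u) times 1/4 + 8 y^2 (u - x)^2 / (x u), expanded so that its integral
   combines the values of Gamma at x + 1, x and x - 1. *)
pose k := 8 * y ^+ 2 / x.
pose g (u : R) := 4^-1 * (u `^ (x - 1) * expR (- u)) +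
  k * (u `^ (x + 1 - 1) * expR (- u) + (- 2 * x) * (u `^ (x - 1) * expR (- u))
       + x ^+ 2 * (u `^ (x - 1 - 1) * expR (- u))).
have j0 := gamma_integrable x0.
have j1 : mu.-integrable `]0, +oo[ (EFin \o (fun u => u `^ (x + 1 - 1) * expR (- u))).
  by apply: gamma_integrable; lra.
have j2 : mu.-integrable `]0, +oo[ (EFin \o (fun u => u `^ (x - 1 - 1) * expR (- u))).
  by apply: gamma_integrable; lra.
have Z (c : R) (h : R -> R) : mu.-integrable `]0, +oo[ (EFin \o h) ->
    mu.-integrable `]0, +oo[ (EFin \o (fun u => c * h u)).
  by move=> ih; apply: (integrableZl _ c ih).
have A (h1 h2 : R -> R) : mu.-integrable `]0, +oo[ (EFin \o h1) ->
    mu.-integrable `]0, +oo[ (EFin \o h2) ->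
    mu.-integrable `]0, +oo[ (EFin \o (fun u => h1 u + h2 u)).
  by move=> ih1 ih2; apply: (integrableD _ ih1 ih2).
have a1 := Z (-2 * x) _ j0; have a2 := A _ _ j1 a1; have a3 := Z (x ^+ 2) _ j2.
have a4 := A _ _ a2 a3; have a5 := Z k _ a4; have a6 := Z 4^-1 _ j0; have ig := A _ _ a6 a5.
have Ig : Rintegral mu `]0, +oo[ g = (4^-1 + 8 * y ^+ 2 / (x - 1)) * rG x.
  rewrite /g RintegralD// RintegralZl// RintegralZl// RintegralD// RintegralD// RintegralZl// RintegralZl//.
  rewrite -/(rG x) -/(rG (x + 1)) -/(rG (x - 1)) rG_rec//.
  have E := @rG_rec (x - 1) _; rewrite subrK in E; rewrite E ?subr_gt0// /k.
  by field; rewrite subr_eq0 !gt_eqF.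
have i1 : cintegrable `]0, +oo[ (fun u => Cpow u (x +i* y - 1) * (expR (- u))%:C).
  by apply: cintegrable_Mellin; [exact: measurable_expRN|exact: gamma_integrable].
have i2 : cintegrable `]0, +oo[ (fun u => Cpow u (x%:C - 1) * (expR (- u))%:C).
  by apply: cintegrable_Mellin; [exact: measurable_expRN|exact: gamma_integrable].
have i2' := cintegrableZl (- Cpow x (0 +i* y)) measurable_pos i2.
have B : normc (Gamma_Euler (x +i* y) - Cpow x (0 +i* y) * Gamma_Euler x%:C) <= 2 * Rintegral mu `]0, +oo[ g.
  have -> : Gamma_Euler (x +i* y) - Cpow x (0 +i* y) * Gamma_Euler x%:C =
    Cintegral `]0, +oo[ (fun u => Cpow u (x +i* y - 1) * (expR (- u))%:C +
      (- Cpow x (0 +i* y)) * (Cpow u (x%:C - 1) * (expR (- u))%:C)).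
    rewrite CintegralD; [|exact: measurable_pos|exact: i1|exact: i2'].
    by rewrite CintegralZl ?mulNr//; exact: measurable_pos.
  apply: normc_Cintegral; [exact: measurable_pos|exact: (cintegrableD measurable_pos i1 i2')|exact: ig|].
  move=> u /pos_itv u0.
  have ux0 : 0 < u / x by rewrite divr_gt0.
  have -> : Cpow u (x +i* y - 1) * (expR (- u))%:C +
      (- Cpow x (0 +i* y)) * (Cpow u (x%:C - 1) * (expR (- u))%:C) =
      Cpow u (x%:C - 1) * (expR (- u))%:C * (Cpow x (0 +i* y) * (Cpow (u / x) (0 +i* y) - 1)).
    have -> : x +i* y - 1 = (x%:C - 1) + (0 +i* y).
      by apply: complex_ext; rewrite !ReImE /=; ring.
    rewrite mulrBr mulr1 -CpowM// [x * _]mulrC divfK ?gt_eqF// CpowD; ring.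
  rewrite normcM [normc (_ * (Cpow _ _ - 1))]normcM.
  rewrite [normc (_ * (expR _)%:C)]normcM.
  rewrite !normc_Cpow// normc_real /= powRr0 mul1r.
  rewrite (ger0_norm (expR_ge0 _)).
  have c1 : normc (Cpow (u / x) (0 +i* y) - 1) <= 4^-1 + 8 * y ^+ 2 * ((u / x - 1) ^+ 2 / (u / x)).
    have -> : Cpow (u / x) (0 +i* y) = Cexp (0 +i* (y * ln (u / x))).
      by rewrite !CpowE; congr Cexp; apply: complex_ext; rewrite !ReImE /=; ring.
    apply: le_trans (normc_Cexp_i _) _; rewrite lerD2l exprMn.
    rewrite (_ : 8 * y ^+ 2 * _ = 2 * (y ^+ 2 * (4 * ((u / x - 1) ^+ 2 / (u / x))))); last by ring.
    by rewrite ler_wpM2l// ler_wpM2l// ln_sqr_le.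
  have p1 : u `^ (x + 1 - 1) = u * u `^ (x - 1).
    by rewrite (_ : x + 1 - 1 = 1 + (x - 1)) ?powRD ?(gt_eqF u0) ?implybT ?powRr1 ?ltW//; ring.
  have p2 : u `^ (x - 1 - 1) = u^-1 * u `^ (x - 1).
    rewrite (_ : x - 1 - 1 = - 1 + (x - 1)) ?powRD ?(gt_eqF u0) ?implybT//; last by ring.
    by rewrite powRN powRr1 ?ltW.
  have w0 : 0 <= u `^ (x - 1) * expR (- u) by rewrite mulr_ge0 ?powR_ge0 ?expR_ge0.
  apply: le_trans (ler_wpM2l w0 c1) _; rewrite /g p1 p2 /k le_eqVlt; apply/orP; left; apply/eqP.
  by field; rewrite !gt_eqF.
have Gx := rG_gt0 (ltW x1).
(* A zero would give Gamma x <= 2 (1/4 + 8 y^2 / (x - 1)) Gamma x; the constant 32 in the hypothesis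
   is what makes this factor less than 1. *)
apply: contraTneq B => ->; rewrite sub0r normcN normcM normc_Cpow//=.
rewrite powRr0 mul1r Gamma_Euler_real normc_real gtr0_norm// Ig -ltNge mulrA -[ltRHS]mul1r ltr_pM2r//.
have : 8 * y ^+ 2 / (x - 1) < 4^-1 by rewrite ltr_pdivrMr; lra.
lra.
Qed.

Lemma Gamma_neq0 z : ~ Gamma_pole z -> Gamma z != 0.
Proof.
move=> npole.
have [n Hn] := exists_nat_gt (1 + 32 * Im z ^+ 2 + `|Re z|).
have iter k : Gamma (z + k%:R) = \prod_(i < k) (z + i%:R) * Gamma z.
  elim: k => [|k IH]; first by rewrite addr0 big_ord0 mul1r.
  rewrite -natr1 addrA Gamma_rec.
    by rewrite IH big_ord_recr /= mulrA; congr (_ * _); rewrite mulrC.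
  by apply/eqP => zk; apply: npole; exists k; move/eqP: zk; rewrite addr_eq0 => /eqP.
have n0 : 0 < Re (z + n%:R) - (1 + 32 * Im z ^+ 2).
  by rewrite !ReImE; have := ler_norm (- Re z); rewrite normrN; lra.
have : Gamma (z + n%:R) != 0.
  rewrite (@GammaE 0) /Gamma_shifted; last by rewrite addr0; have := sqr_ge0 (Im z); lra.
  rewrite big_ord0 divr1 addr0.
  have -> : z + n%:R = Re (z + n%:R) +i* Im z.
    by apply: complex_ext; rewrite //= !ReImE addr0.
  by apply: Gamma_Euler_neq0_large; lra.
by rewrite iter; apply: contraNneq => ->; rewrite mulr0.
Qed.

End GammaFunction.

(** * H-functions as integrals along a line *)

Section Regularity.
Variable R : realType.
Implicit Types (F G : R[i] -> R[i]) (I : set R).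

Definition bounded_strips F := forall B : R, exists M : R, forall s : R[i],
  `|Re s| <= B -> 1 <= `|Im s| -> normc (F s) <= M.

Lemma C1atM F F' G G' z : C1at F F' z -> C1at G G' z ->
  C1at (fun w => F w * G w) (fun w => F' w * G w + F w * G' w) z.
Proof.
move=> [dF cF] [dG cG]; split; first exact: cderivativeM.
have cF1 := cderivative_continuous dF; have cG1 := cderivative_continuous dG.
exact: (ccontinuousD (ccontinuousM cF cG1) (ccontinuousM cF1 cG)).
Qed.

Lemma ccontinuous_cst (c z : R[i]) : {for z, continuous (fun _ : R[i] => c)}.
Proof. by have h := @cst_continuous R[i] R[i] c z; exact: h. Qed.

Lemma C1at_cst (c z : R[i]) : C1at (fun _ : R[i] => c) (fun _ : R[i] => 0) z.
Proof.
split; last exact: ccontinuous_cst.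
exists (fun _ : R[i] => 0); split; [by move=> w; rewrite subrr mul0r|exact: ccontinuous_cst|by []].
Qed.

Lemma C1at_comp_affine F F' (a b z : R[i]) : C1at F F' (a + b * z) ->
  C1at (fun w => F (a + b * w)) (fun w => F' (a + b * w) * b) z.
Proof.
move=> [dF cF]; have da := @cderivative_affine R a b z; split.
  exact: (cderivative_comp (G := fun w => a + b * w) dF da).
have c1 : {for z, continuous (fun w => F' (a + b * w))}.
  exact: (continuous_comp (cderivative_continuous da) cF).
have c2 : {for z, continuous (fun _ : R[i] => b)} by exact: ccontinuous_cst.
exact: (ccontinuousM c1 c2).
Qed.

Lemma C1at_inv z : z != 0 -> C1at (fun w : R[i] => w^-1) (fun w : R[i] => - w ^- 2) z.
Proof.
move=> z0; split; first exact: cderivative_inv.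
have c := cderivative_continuous (cderivative_inv z0).
have -> : (fun w : R[i] => - w ^- 2) = (fun w => (-1) * (w^-1 * w^-1)).
  by apply/funext => w; rewrite mulN1r expr2 invfM.
exact: (ccontinuousZ (c := -1) (ccontinuousM c c)).
Qed.

Lemma C1at_Cexp z : C1at (@Cexp R) (@Cexp R) z.
Proof. by split; [exact: cderivative_Cexp|exact: continuous_Cexp]. Qed.

Lemma regularM I F G : regular I F -> regular I G -> regular I (fun s => F s * G s).
Proof.
move=> rF rG B; have [f [f' Hf]] := rF B; have [g [g' Hg]] := rG B.
exists (fun s => f s * g s), (fun s => f' s * g s + f s * g' s) => s Bs.
move: (Hf s Bs) (Hg s Bs) => [e1 c1] [e2 c2].
by split; [rewrite e1 e2|exact: C1atM c1 c2].
Qed.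

Lemma eq_regular I F G : (forall s, Im s != 0 \/ I (Re s) -> F s = G s) -> regular I F -> regular I G.
Proof.
move=> FG rF B; have [f [f' Hf]] := rF B; exists f, f' => s Bs.
by have [Fs ?] := Hf s Bs; split => //; rewrite -FG//; case: Bs.
Qed.

Lemma regular_cst I (c : R[i]) : regular I (fun=> c).
Proof.
by move=> B; exists (fun=> c), (fun=> 0) => s _; split; [by []|exact: C1at_cst].
Qed.

Lemma regularX I F k : regular I F -> regular I (fun s => F s ^+ k).
Proof.
move=> rF; elim: k => [|k IH].
  by apply: eq_regular (regular_cst I 1) => s _; rewrite expr0.
by apply: eq_regular (regularM rF IH) => s _; rewrite exprS.
Qed.

(** Off the real axis the affine argument is not real, and over [I] its real part is positive; in
    both cases it avoids the poles of Gamma. *)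
Lemma slit_neq0 I (A sg : R) (s : R[i]) : sg != 0 -> (forall x, I x -> 0 < A + sg * x) ->
  Im s != 0 \/ I (Re s) -> forall i : nat, A%:C + sg%:C * s + i%:R != 0.
Proof.
move=> sg0 HI Hs i; apply/eqP => E.
have := congr1 (@complex.Re R) E; have := congr1 (@complex.Im R) E.
rewrite !ReImE /= !mul0r !addr0 !subr0 add0r => /eqP; rewrite mulf_eq0 (negbTE sg0) /= => /eqP im0 re0.
case: Hs => [|/HI h]; first by rewrite im0 eqxx.
by move: re0 => /eqP; rewrite gt_eqF// ltr_wpDr.
Qed.

Lemma regular_inv_affine I (A sg : R) : sg != 0 -> (forall x, I x -> 0 < A + sg * x) ->
  regular I (fun s => (A%:C + sg%:C * s)^-1).
Proof.
move=> sg0 HI B; exists (fun s => (A%:C + sg%:C * s)^-1).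
exists (fun s => - (A%:C + sg%:C * s) ^- 2 * sg%:C) => s [_ Hs]; split => //.
apply: (C1at_comp_affine (F := fun w : R[i] => w^-1) (F' := fun w : R[i] => - w ^- 2)); apply: C1at_inv.
by have := slit_neq0 sg0 HI Hs 0%N; rewrite addr0.
Qed.

Lemma regular_Cpow I (x : R) : regular I (Cpow x).
Proof.
move=> B; exists (fun s => Cexp (0 + (ln x)%:C * s)).
exists (fun s => Cexp (0 + (ln x)%:C * s) * (ln x)%:C) => s _.
split; first by rewrite CpowE add0r mulrC.
exact: (C1at_comp_affine (F := @Cexp R) (F' := @Cexp R) (C1at_Cexp _)).
Qed.

(* [Gamma_shifted N] is a product of affine factors and one Euler integral. *)
Lemma C1at_Gamma_shifted N : exists G' : R[i] -> R[i], forall z, 0 < Re z + N%:R ->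
  (forall i : nat, z + i%:R != 0) -> C1at (@Gamma_shifted R N) G' z.
Proof.
suff [P' HP] : exists P' : R[i] -> R[i], forall z, (forall i : nat, z + i%:R != 0) ->
    C1at (fun z => (\prod_(i < N) (z + i%:R))^-1) P' z.
  pose g := fun u : R => ln u * expR (- u).
  exists (fun z => Mellin g (N%:R + 1 * z) * 1 * (\prod_(i < N) (z + i%:R))^-1 +
     Gamma_Euler (N%:R + 1 * z) * P' z) => z zN zi.
  have E : @Gamma_shifted R N = fun z => Gamma_Euler (N%:R + 1 * z) * (\prod_(i < N) (z + i%:R))^-1.
    by apply/funext => w; rewrite /Gamma_shifted mul1r addrC.
  rewrite E; apply: C1atM; last exact: HP.
  apply: (C1at_comp_affine (F := @Gamma_Euler R) (F' := Mellin g)).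
  by apply: C1at_Gamma_Euler; rewrite mul1r ReD Re_nat addrC.
elim: N => [|N [P' HP]].
  exists (fun=> 0) => z _.
  have -> : (fun z : R[i] => (\prod_(i < 0) (z + i%:R))^-1) = fun=> 1.
    by apply/funext => w; rewrite big_ord0 invr1.
  exact: C1at_cst.
exists (fun z => P' z * (N%:R + 1 * z)^-1 + (\prod_(i < N) (z + i%:R))^-1 * (- (N%:R + 1 * z) ^- 2 * 1)) => z zi.
have -> : (fun z : R[i] => (\prod_(i < N.+1) (z + i%:R))^-1) =
    fun z => (\prod_(i < N) (z + i%:R))^-1 * (N%:R + 1 * z)^-1.
  by apply/funext => w; rewrite big_ord_recr /= invfM mul1r [w + _]addrC.
apply: C1atM; first exact: HP.
apply: (C1at_comp_affine (F := fun w : R[i] => w^-1) (F' := fun w : R[i] => - w ^- 2)); apply: C1at_inv.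
by rewrite mul1r addrC.
Qed.

Lemma affine_Re_bound (A sg B : R) (s : R[i]) : `|Re s| <= B ->
  `|Re (A%:C + sg%:C * s)| <= `|A| + `|sg| * B.
Proof.
move=> sB; rewrite !ReImE /= mul0r subr0; apply: le_trans (ler_normD _ _) _.
by rewrite lerD2l normrM ler_wpM2l.
Qed.

Lemma regular_Gamma I (A sg : R) : sg != 0 -> (forall x, I x -> 0 < A + sg * x) ->
  regular I (fun s => Gamma (A%:C + sg%:C * s)).
Proof.
(* In the strip the real part of the argument is at least minus this bound, so [N] shifts bring it
   to the right half-plane throughout. *)
move=> sg0 HI B; have [N HN] := exists_nat_gt (`|A| + `|sg| * B).
have [G' HG] := C1at_Gamma_shifted N.
exists (fun s => Gamma_shifted N (A%:C + sg%:C * s)), (fun s => G' (A%:C + sg%:C * s) * sg%:C) => s [sB Hs].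
have h : 0 < Re (A%:C + sg%:C * s) + N%:R.
  by have := affine_Re_bound A sg sB; rewrite ler_norml => /andP[]; lra.
split; first exact: GammaE.
apply: (C1at_comp_affine (F := @Gamma_shifted R N) (F' := G')); apply: HG => // i.
exact: slit_neq0 Hs i.
Qed.

(** After [N] shifts Gamma is an Euler integral with argument in a vertical strip to the right of 1,
    hence bounded, over [N] factors of modulus at least |sg Im s|. The summand 2 in the choice of
    [N] ensures N >= 2. *)
Lemma decay_Gamma (A sg : R) : sg != 0 -> quadratic_decay (fun s => Gamma (A%:C + sg%:C * s)).
Proof.
move=> sg0 B; have [N HN] := exists_nat_gt (`|A| + `|sg| * B + 2).
have [M HM] := @Gamma_Euler_bound R 1 (`|A| + `|sg| * B + N%:R) ltr01.
have sg1 : 0 < `|sg| by rewrite normr_gt0.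
exists (`|M| / `|sg| ^+ N) => s sB s1.
have hA := affine_Re_bound A sg sB; set z := A%:C + sg%:C * s in hA *.
have Imz : Im z = sg * Im s by rewrite /z !ReImE /= mul0r addr0 add0r.
move: (hA); rewrite ler_norml => /andP[h1 h2].
have B0 : 0 <= `|A| + `|sg| * B by apply: le_trans hA; exact: normr_ge0.
have N2 : (2 <= N)%N by rewrite -(ler_nat R); lra.
rewrite (@GammaE _ N); last by lra.
rewrite /Gamma_shifted normcM normcV normc_prod.
have s0 : 0 < `|Im s| by exact: lt_le_trans s1.
have hp : (`|sg| * `|Im s|) ^+ N <= \prod_(i < N) normc (z + i%:R).
  rewrite -[leLHS]/(_ ^+ N) -[X in _ ^+ X](card_ord N) -prodr_const.
  apply: ler_prod => i _; rewrite mulr_ge0//=.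
  by apply: le_trans (normc_Im _); rewrite ImD Im_nat addr0 Imz normrM.
have p0 : 0 < (`|sg| * `|Im s|) ^+ N by rewrite exprn_gt0// mulr_gt0.
have hM : normc (Gamma_Euler (z + N%:R)) <= `|M|.
  apply: le_trans (ler_norm _); apply: HM; rewrite ReD Re_nat; lra.
rewrite -[Im s ^+ 2]real_normK ?num_real//.
apply: (@le_trans _ _ (`|M| * ((`|sg| * `|Im s|) ^+ N)^-1 * `|Im s| ^+ 2)).
  rewrite ler_wpM2r ?sqr_ge0// ler_pM ?normc_ge0 ?invr_ge0 ?prodr_ge0//.
    by move=> i _; exact: normc_ge0.
  by rewrite lef_pV2 ?posrE//; exact: lt_le_trans hp.
rewrite (_ : _ * _ * _ = (`|M| / `|sg| ^+ N) * (`|Im s| ^+ 2 / `|Im s| ^+ N)); last first.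
  by rewrite exprMn invfM; ring.
rewrite ler_piMr ?divr_ge0 ?exprn_ge0//.
by rewrite ler_pdivrMr ?exprn_gt0// mul1r ler_weXn2l.
Qed.

Lemma decayM F G : quadratic_decay F -> bounded_strips G -> quadratic_decay (fun s => F s * G s).
Proof.
move=> dF bG B; have [M HM] := dF B; have [K HK] := bG B; exists (M * K) => s sB s1.
rewrite normcM mulrAC.
apply: ler_pM; [|exact: normc_ge0|exact: HM|exact: HK].
by apply: mulr_ge0; [exact: normc_ge0|exact: sqr_ge0].
Qed.

Lemma decay_bounded F : quadratic_decay F -> bounded_strips F.
Proof.
move=> dF B; have [M HM] := dF B; exists M => s sB s1; apply: le_trans (HM s sB s1).
by rewrite ler_peMr ?normc_ge0// -real_normK ?num_real// expr_ge1// ltW.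
Qed.

Lemma bounded_stripsM F G : bounded_strips F -> bounded_strips G -> bounded_strips (fun s => F s * G s).
Proof.
move=> bF bG B; have [M HM] := bF B; have [K HK] := bG B; exists (M * K) => s sB s1.
by rewrite normcM ler_pM ?normc_ge0 ?HM ?HK.
Qed.

Lemma bounded_stripsX F k : bounded_strips F -> bounded_strips (fun s => F s ^+ k).
Proof.
move=> bF; elim: k => [|k IH].
  by move=> B; exists 1 => s _ _; rewrite expr0 normc1.
by move=> B; have [M HM] := bounded_stripsM bF IH B; exists M => s sB s1; rewrite exprS; exact: HM.
Qed.

Lemma bounded_inv_affine (A sg : R) : sg != 0 -> bounded_strips (fun s => (A%:C + sg%:C * s)^-1).
Proof.
move=> sg0 B; exists `|sg|^-1 => s sB s1.
have sg1 : 0 < `|sg| by rewrite normr_gt0.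
have h : `|sg| <= normc (A%:C + sg%:C * s).
  apply: le_trans (normc_Im _); rewrite !ReImE /= mul0r addr0 add0r normrM.
  by rewrite ler_peMr.
by rewrite normcV lef_pV2 ?posrE//; exact: lt_le_trans h.
Qed.

Lemma bounded_Cpow (x : R) : 0 < x -> bounded_strips (Cpow x).
Proof.
move=> x0 B; exists (expR (B * `|ln x|)) => s sB s1.
rewrite normc_Cpow// /powR gt_eqF// ler_expR; apply: le_trans (ler_norm _) _.
by rewrite normrM ler_wpM2r.
Qed.

Lemma eq_decay F G : (forall s, Im s != 0 -> F s = G s) -> quadratic_decay F -> quadratic_decay G.
Proof.
move=> FG dF B; have [M HM] := dF B; exists M => s sB s1; rewrite -FG ?HM//.
by rewrite -normr_gt0 (lt_le_trans ltr01 s1).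
Qed.

(** All reciprocal Gammas of the kernels occur in such quotients, which turns their regularity and
    growth into those of 1 / z. *)
Lemma Gamma_ratio (z : R[i]) : (forall i : nat, z + i%:R != 0) -> Gamma z / Gamma (z + 1) = z^-1.
Proof.
move=> zi; have z0 : z != 0 by have := zi 0%N; rewrite addr0.
rewrite Gamma_rec// invfM mulrCA mulfV ?mulr1// Gamma_neq0// => -[nu znu].
by have := zi nu; rewrite znu addNr eqxx.
Qed.

End Regularity.

(** * Vertical lines in place of the chosen contour *)

Section FoxLine.
Variable R : realType.
Implicit Types (a b : seq (R * R)) (c : R -> R).

(* The real parts of the vertical lines that separate the poles. *)
Definition fox_strip m n a b : set R := [set x |
  (forall u, u \in take m b -> u.2 * x < u.1) /\ (forall u, u \in take n a -> u.1 - 1 < u.2 * x)].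

Lemma fox_strip_convex m n a b x y (t : R) : fox_strip m n a b x -> fox_strip m n a b y ->
  0 <= t -> t <= 1 -> fox_strip m n a b (x + t * (y - x)).
Proof.
move=> [x1 x2] [y1 y2] t0 t1; have t1' : 0 <= 1 - t by rewrite subr_ge0.
have E (p q k l : R) : p < q -> k < l -> (1 - t) * p + t * k < (1 - t) * q + t * l.
  by move=> pq kl; have [->|tn] := eqVneq t 1; [rewrite subrr !mul0r !add0r !mul1r|
    rewrite ltr_leD ?ler_wpM2l ?(ltW kl)// ltr_pM2l// subr_gt0 lt_neqAle tn].
split=> u ub.
  by have := E _ _ _ _ (x1 u ub) (y1 u ub); lra.
by have := E _ _ _ _ (x2 u ub) (y2 u ub); lra.
Qed.

Lemma fox_strip_separates m n a b (c0 : R) : (forall u, u \in take m b -> 0 < u.2) ->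
  (forall u, u \in take n a -> 0 < u.2) -> fox_strip m n a b c0 -> separates m n a b (fun=> c0).
Proof.
move=> b0 a0 [c1 c2]; split=> u s ub [nu E];
  have := congr1 (@complex.Re R) E; rewrite !ReImE /= => h; have nu0 : (0 : R) <= nu%:R by [].
- rewrite -(ltr_pM2l (b0 u ub)); apply: lt_le_trans (c1 u ub) _; lra.
- rewrite -(ltr_pM2l (a0 u ub)); apply: le_lt_trans (c2 u ub); lra.
Qed.

(** Separation is tested on the first pole of each family: it is real, so it is compared with the
    abscissa at which the contour crosses the real axis. *)
Lemma separates_fox_strip m n a b c : (forall u, u \in take m b -> 0 < u.2) ->
  (forall u, u \in take n a -> 0 < u.2) -> separates m n a b c -> fox_strip m n a b (c 0).
Proof.
move=> b0 a0 [c1 c2]; split=> u ub.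
- have u20 : u.2 != 0 by rewrite gt_eqF ?b0.
  suff h : c 0 < u.1 / u.2 by move: h; rewrite ltr_pdivlMr ?b0// mulrC.
  apply: (c1 u ((u.1 / u.2)%:C) ub).
  by exists 0%N; apply: complex_ext; rewrite !ReImE /=; [field|ring].
- have u20 : u.2 != 0 by rewrite gt_eqF ?a0.
  suff h : (u.1 - 1) / u.2 < c 0 by move: h; rewrite ltr_pdivrMr ?a0// mulrC.
  apply: (c2 u (((u.1 - 1) / u.2)%:C) ub).
  by exists 0%N; apply: complex_ext; rewrite !ReImE /=; [field|ring].
Qed.

Lemma fox_line_integrable m n a b (x c0 : R) : fox_strip m n a b c0 -> 0 < x ->
  regular (fox_strip m n a b) (foxH_kernel m n a b) -> quadratic_decay (foxH_kernel m n a b) ->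
  cintegrable setT (fun y : R => foxH_kernel m n a b (c0 +i* y) * Cpow x (c0 +i* y)).
Proof.
move=> Ic0 x0 rK dK.
have [cl [M HM]] := regular_line (regularM rK (@regular_Cpow _ (fox_strip m n a b) x))
  (decayM dK (bounded_Cpow x0)) Ic0.
apply: (cintegrable_le measurableT (cmeasurable_continuous cl)
  (integrableZl measurableT M (integrable_inv_sqr R))) => y _; exact: HM.
Qed.

Lemma foxH_line m n a b (x c0 : R) : (forall u, u \in take m b -> 0 < u.2) ->
  (forall u, u \in take n a -> 0 < u.2) -> fox_strip m n a b c0 -> 0 < x ->
  regular (fox_strip m n a b) (foxH_kernel m n a b) -> quadratic_decay (foxH_kernel m n a b) ->
  foxH m n a b x =
  Cintegral setT (fun y => foxH_kernel m n a b (c0 +i* y) * Cpow x (c0 +i* y)) / (2 * pi)%:C.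
Proof.
move=> b0 a0 Ic0 x0 rK dK.
(* The vertical line is itself a separating contour, so the choice made by [xget] is a genuine
   contour and not its default value. *)
have [ic sc] : [set c | is_contour c /\ separates m n a b c] (foxH_contour m n a b).
  apply: xgetPex; exists (fun=> c0); split; last exact: fox_strip_separates.
  split; first by move=> y; exact: derivable_cst.
  - have -> : derive1 (fun=> c0 : R) = fun=> 0 by apply/funext => y; rewrite derive1_cst.
    by move=> y; exact: cvg_cst.
  - exists `|c0| => y; rewrite derive1_cst normr0; split => //.
have Ic := separates_fox_strip b0 a0 sc.
rewrite /foxH (contour_shift (@fox_strip_convex m n a b) _ _ ic Ic0 Ic); last 2 first.
- by apply: regularM => //; exact: regular_Cpow.
- by apply: decayM => //; exact: bounded_Cpow.
have iF := fox_line_integrable Ic0 x0 rK dK.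
have -> : Cintegral setT (fun y : R => foxH_kernel m n a b (c0 +i* y) * Cpow x (c0 +i* y) * (0 +i* 1)) =
   (0 +i* 1) * Cintegral setT (fun y : R => foxH_kernel m n a b (c0 +i* y) * Cpow x (c0 +i* y)).
  by rewrite -CintegralZl//; apply: eq_Cintegral => y _; rewrite mulrC.
(* The i of ds = i dy cancels the one in 2 pi i. *)
have -> : (0 +i* (2 * pi) : R[i]) = (0 +i* 1) * (2 * pi)%:C.
  by apply: complex_ext; rewrite !ReImE /=; ring.
have i0 : (0 +i* 1 : R[i]) != 0 by rewrite eq_complex /= oner_eq0 andbF.
by rewrite invfM mulrACA mulfV// mul1r.
Qed.

End FoxLine.

(** * Mellin transforms *)

Section MellinTransform.
Variable R : realType.
Local Notation mu := (@lebesgue_measure R).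
Implicit Types (z s : R[i]) (f g w : R -> R).

Lemma eq_Rintegrable (D : set R) f g : measurable D -> (forall x, D x -> f x = g x) ->
  mu.-integrable D (EFin \o f) -> mu.-integrable D (EFin \o g).
Proof.
by move=> mD fg i; apply: eq_integrable i => // x /set_mem Dx /=; rewrite fg.
Qed.

Lemma le_Rintegrable (D : set R) f g : measurable D -> measurable_fun setT f ->
  mu.-integrable D (EFin \o g) -> (forall x, D x -> `|f x| <= g x) ->
  mu.-integrable D (EFin \o f).
Proof.
move=> mD mf i fg; apply: le_integrable i => //.
  by apply/measurable_EFinP; exact: measurable_funTS.
by move=> x Dx; rewrite /= lee_fin; apply: le_trans (fg x Dx) _; exact: ler_norm.
Qed.

Lemma Mellin_real g (c : R) :
  Mellin g c%:C = (Rintegral mu `]0, +oo[ (fun u => u `^ (c - 1) * g u))%:C.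
Proof.
rewrite -Cintegral_real; apply: eq_Cintegral => u /pos_itv u0.
by rewrite rmorphM /= -Cpow_real// rmorphB.
Qed.

Lemma eq_Mellin f g s : (forall x : R, 0 < x -> f x = g x) -> Mellin f s = Mellin g s.
Proof. by move=> fg; apply: eq_Cintegral => u /pos_itv u0; rewrite fg. Qed.

(** The substitution u = lam x^r. *)
Lemma Mellin_scale_power g (lam r : R) s : 0 < lam -> 0 < r -> measurable_fun setT g ->
  (forall u : R, 0 < u -> {for u, continuous g}) ->
  mu.-integrable `]0, +oo[ (EFin \o (fun u => u `^ (Re s / r - 1) * g u)) ->
  cintegrable `]0, +oo[ (fun x => Cpow x (s - 1) * (g (lam * x `^ r))%:C) /\
  Mellin (fun x => g (lam * x `^ r)) s =
  (r^-1)%:C * Cpow lam (- (s / r%:C)) * Mellin g (s / r%:C).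
Proof.
move=> lam0 r0 mg cg ig; set z := s / r%:C.
have r0' : r != 0 by rewrite gt_eqF.
have rC0 : r%:C != 0 :> R[i] by rewrite (inj_eq (@complexI R)).
have rez : Re z = Re s / r by rewrite /z -[r%:C^-1]fmorphV ReM /= mulr0 subr0.
pose phi (x : R) := lam * x `^ r; pose phi' (x : R) := lam * r * x `^ (r - 1).
have phi0 (x : R) : 0 < x -> 0 < phi x by move=> x0; rewrite mulr_gt0 ?powR_gt0.
have dphi (x : R) : 0 < x -> is_derive x 1 phi (phi' x).
  move=> x0; have d := is_deriveZ (lam * r) (is_derive_powR_div r0' x0).
  suff -> : phi = (lam * r) \*: (fun u : R => u `^ r / r) by exact: d.
  by apply/funext => u; rewrite /phi /= /GRing.scale /=; field.
have phi'0 (x : R) : 0 < x -> 0 < phi' x by move=> x0; rewrite !mulr_gt0 ?powR_gt0.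
have cphi' (x : R) : 0 < x -> {for x, continuous phi'}.
  move=> x0; have c := @continuous_powR R (r - 1) x x0.
  have h : lam * r * u `^ (r - 1) @[u --> x] --> lam * r * x `^ (r - 1).
    by apply: cvgM; [exact: cvg_cst|exact: c].
  exact: h.
have inv (y : R) : 0 < y -> 0 < (y / lam) `^ r^-1 /\ phi ((y / lam) `^ r^-1) = y.
  move=> y0; have yl : 0 < y / lam by rewrite divr_gt0.
  split; first by rewrite powR_gt0.
  by rewrite /phi -powRrM mulVf// powRr1 ?(ltW yl)// mulrC divfK// gt_eqF.
pose G (u : R) := Cpow u (z - 1) * (g u)%:C.
have cG (u : R) : 0 < u -> {for u, continuous G}.
  move=> u0; have c1 := path_derivative_continuous (path_derivative_Cpow (z - 1) u0).
  have c2 : {for u, continuous (fun u : R => (g u)%:C)} by exact: (cvg_real_complex (cg u u0)).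
  exact: (ccontinuousM c1 c2).
have iG : cintegrable `]0, +oo[ G by apply: cintegrable_Mellin => //; rewrite rez.
have [||i1 e1] := Csubstitution_pos phi0 dphi phi'0 cphi' _ _ cG iG.
- move=> y y0; have [] := inv (y / 2); first by rewrite divr_gt0.
  move=> x0 ex; exists ((y / 2 / lam) `^ r^-1) => //; rewrite ex; lra.
- move=> y; have [] := inv (`|y| + 1); first by rewrite ltr_wpDl.
  move=> x0 ex; exists (((`|y| + 1) / lam) `^ r^-1) => //; rewrite ex.
  by rewrite ltr_pwDr// ler_norm.
have E (x : R) : `]0, +oo[%classic x -> G (phi x) * (phi' x)%:C =
    (r%:C * Cpow lam z) * (Cpow x (s - 1) * (g (lam * x `^ r))%:C).
  move=> /pos_itv x0.
  rewrite /G /phi CpowM ?powR_gt0// Cpow_powR /phi' !rmorphM /= -(Cpow_real (r - 1) x0).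
  rewrite -(Cpow1 lam0).
  have -> : Cpow lam z = Cpow lam (z - 1) * Cpow lam 1 by rewrite -CpowD subrK.
  have -> : Cpow x (s - 1) = Cpow x (r%:C * (z - 1)) * Cpow x (r - 1)%:C.
    rewrite -CpowD; congr Cpow; rewrite rmorphB /= mulrBr mulr1 /z mulrC divfK//; ring.
  ring.
have k0 : r%:C * Cpow lam z != 0 by rewrite mulf_neq0// Cpow_neq0.
have i2 : cintegrable `]0, +oo[ (fun x => Cpow x (s - 1) * (g (lam * x `^ r))%:C).
  have := cintegrableZl (r%:C * Cpow lam z)^-1 (@measurable_pos R) (eq_cintegrable (@measurable_pos R) E i1).
  apply: eq_cintegrable; first exact: measurable_pos.
  by move=> x _; rewrite mulrA mulVf// mul1r.
split=> //; rewrite -[RHS]/(_ * Cintegral _ G) -e1 (eq_Cintegral E) CintegralZl//.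
rewrite CpowN [(r^-1)%:C]fmorphV -invfM mulrA mulVf ?mul1r//.
Qed.

Lemma Mellin_scale g (y : R) s : 0 < y -> measurable_fun setT g ->
  (forall u : R, 0 < u -> {for u, continuous g}) ->
  mu.-integrable `]0, +oo[ (EFin \o (fun u => u `^ (Re s - 1) * g u)) ->
  cintegrable `]0, +oo[ (fun x => Cpow x (s - 1) * (g (x * y))%:C) /\
  Mellin (fun x => g (x * y)) s = Cpow y (- s) * Mellin g s.
Proof.
move=> y0 mg cg ig; have := @Mellin_scale_power g y 1 s y0 ltr01 mg cg.
rewrite !divr1 invr1 mul1r => /(_ ig)[i e].
have E (x : R) : 0 < x -> g (y * x `^ 1) = g (x * y) by move=> x0; rewrite powRr1 ?(ltW x0)// mulrC.
split; last by rewrite -e; apply: eq_Mellin => x /E.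
by apply: (eq_cintegrable (@measurable_pos R) _ i) => x /pos_itv /E ->.
Qed.

Lemma Rintegral_scale g (y c : R) : 0 < y -> measurable_fun setT g ->
  (forall u : R, 0 < u -> {for u, continuous g}) ->
  mu.-integrable `]0, +oo[ (EFin \o (fun u => u `^ (c - 1) * g u)) ->
  mu.-integrable `]0, +oo[ (EFin \o (fun x => x `^ (c - 1) * g (x * y))) /\
  Rintegral mu `]0, +oo[ (fun x => x `^ (c - 1) * g (x * y)) =
  y `^ (- c) * Rintegral mu `]0, +oo[ (fun u => u `^ (c - 1) * g u).
Proof.
move=> y0 mg cg ig; have [[i _] e] := @Mellin_scale g y c%:C y0 mg cg ig.
split.
  apply: (eq_Rintegrable (@measurable_pos R) _ i).
  by move=> x /pos_itv x0; rewrite -rmorphB Cpow_real// -rmorphM.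
by move: e; rewrite !Mellin_real -rmorphN Cpow_real// -rmorphM => -[].
Qed.

(* Tonelli's theorem gives the integrability on the product that lets the two
   integrals be exchanged; the inner one is then a rescaled Mellin transform. *)
Lemma Mellin_convolution f w (D : set R) s : measurable D -> D `<=` `]0, +oo[%classic ->
  measurable_fun setT f -> measurable_fun setT w ->
  (forall u : R, 0 < u -> {for u, continuous f}) ->
  mu.-integrable `]0, +oo[ (EFin \o (fun u => u `^ (Re s - 1) * f u)) ->
  mu.-integrable D (EFin \o (fun y => y `^ (- Re s) * w y)) ->
  (forall x : R, 0 < x -> mu.-integrable D (EFin \o (fun y => w y * f (x * y)))) ->
  Mellin (fun x => Rintegral mu D (fun y => w y * f (x * y))) s =
  Mellin f s * Cintegral D (fun y => Cpow y (- s) * (w y)%:C).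
Proof.
move=> mD Dpos mf mw cf i1 i2 i3.
have mpos := @measurable_pos R.
pose h (x y : R) : R[i] := Cpow x (s - 1) * (w y * f (x * y))%:C.
have mh : cmeasurable setT (fun p : R * R => h p.1 p.2).
  apply: cmeasurableM.
    by apply: cmeasurable_Cpow; [exact: measurable_fst|exact: cmeasurable_cst].
  apply: cmeasurable_real; apply: measurable_funM.
    exact: (measurableT_comp mw measurable_snd).
  apply: (measurableT_comp mf).
  by apply: measurable_funM; [exact: measurable_fst|exact: measurable_snd].
have nf : forall u : R, 0 < u -> {for u, continuous (fun u => `|f u|)}.
  by move=> u u0; exact: (cvg_norm (cf u u0)).
have mnf : measurable_fun setT (fun u => `|f u|) by exact: measurableT_comp.
have i1n : mu.-integrable `]0, +oo[ (EFin \o (fun u => u `^ (Re s - 1) * `|f u|)).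
  apply: (eq_Rintegrable mpos _ (integrable_norm i1)) => u /pos_itv u0 /=.
  by rewrite normrM (ger0_norm (powR_ge0 _ _)).
pose A := Rintegral mu `]0, +oo[ (fun u => u `^ (Re s - 1) * `|f u|).
have nh (x y : R) : 0 < x -> normc (h x y) = `|w y| * (x `^ (Re s - 1) * `|f (x * y)|).
  move=> x0; rewrite /h normcM normc_real normc_Cpow// normrM.
  by rewrite ReD ReN /= mulrCA.
have ih : (mu \x mu)%E.-integrable (`]0, +oo[%classic `*` D) (EFin \o (fun p => normc (h p.1 p.2))).
  apply: prod_integrable21 => //; first exact: cmeasurable_normc.
  have iA : mu.-integrable D (EFin \o (fun y => A * `|y `^ (- Re s) * w y|)).
    by apply: (integrableZl _ A (integrable_norm i2)).
  have /integrableP[_] := iA; apply: le_lt_trans; rewrite le_eqVlt; apply/orP; left; apply/eqP.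
  apply: eq_integral => y /set_mem /Dpos /pos_itv y0.
  have [j1 j2] := @Rintegral_scale (fun u => `|f u|) y (Re s) y0 mnf nf i1n.
  transitivity (\int[mu]_(x in `]0%R, +oo[) (`|w y|%:E * (x `^ (Re s - 1) * `|f (x * y)|)%:E))%E.
    by apply: eq_integral => x /set_mem /pos_itv x0; rewrite /= nh// ger0_norm// !mulr_ge0 ?powR_ge0.
  rewrite integralZl//.
  have -> : (\int[mu]_(x in `]0%R, +oo[) (x `^ (Re s - 1) * `|f (x * y)|)%:E =
     (Rintegral mu `]0, +oo[ (fun x => x `^ (Re s - 1) * `|f (x * y)|))%:E)%E.
    by rewrite /Rintegral fineK//; exact: (integrable_fin_num _ j1).
  have A0 : 0 <= A by apply: Rintegral_ge0 => x _; rewrite mulr_ge0 ?powR_ge0.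
  rewrite j2 -/A -EFinM /= [`|A * _|]normrM normr_id (ger0_norm A0); congr (_%:E).
  by rewrite [`|_ * w y|]normrM (ger0_norm (powR_ge0 _ _)); ring.
have E1 (x : R) : `]0, +oo[%classic x -> Cpow x (s - 1) *
    (Rintegral mu D (fun y => w y * f (x * y)))%:C = Cintegral D (h x).
  move=> /pos_itv x0; rewrite -Cintegral_real -CintegralZl//.
  by split; [exact: i3|exact: integrable0].
have i2c : cintegrable D (fun y => Cpow y (- s) * (w y)%:C).
  apply: (cintegrable_le mD _ (integrable_norm i2)).
    apply: cmeasurableM; first by apply: cmeasurable_Cpow => //; exact: cmeasurable_cst.
    by apply: cmeasurable_real; exact: measurable_funTS.
  move=> y /Dpos /pos_itv y0; rewrite normcM normc_real normc_Cpow//.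
  by rewrite ReN /= normrM (ger0_norm (powR_ge0 _ _)).
transitivity (Cintegral `]0, +oo[ (fun x => Cintegral D (h x))); first exact: eq_Cintegral E1.
rewrite (Cfubini mpos mD mh ih) -CintegralZl//.
apply: eq_Cintegral => y /Dpos /pos_itv y0.
have [j1 j2] := @Mellin_scale f y s y0 mf cf i1.
transitivity (Cintegral `]0, +oo[ (fun x => (w y)%:C * (Cpow x (s - 1) * (f (x * y))%:C))).
  by apply: eq_Cintegral => x _; rewrite /h rmorphM /=; ring.
rewrite CintegralZl// -[Cintegral _ _]/(Mellin (fun x => f (x * y)) s) j2; ring.
Qed.

Lemma rG1 : rG (1 : R) = 1.
Proof.
have i : mu.-integrable `]0, +oo[ (EFin \o (fun u : R => expR (- u))).
  apply: (eq_Rintegrable (@measurable_pos R) _ (gamma_integrable (@ltr01 R))).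
  by move=> u /pos_itv u0; rewrite subrr powRr0 mul1r.
have -> : rG (1 : R) = Rintegral mu `]0, +oo[ (fun u : R => expR (- u)).
  by apply: eq_Rintegral => u /set_mem /pos_itv u0; rewrite subrr powRr0 mul1r.
rewrite -[RHS]opprK -[RHS]sub0r.
apply: (@Rintegral_pos_FTC R (fun u => - expR (- u)) (fun u => expR (- u)) 0 (-1)).
- move=> x _; have d := is_deriveN (is_derive_expRN x); apply: (is_derive_eq d); exact: opprK.
- by move=> x _; have [+ _] := is_derive_expRN x => /derivable1_diffP/differentiable_continuous.
- exact: i.
- apply: cvg_at_right_filter; rewrite -[X in _ --> X]/(- 1) -(@expR0 R) -[in X in _ --> X]oppr0.
  have [+ _] := is_derive_expRN (0 : R) => /derivable1_diffP/differentiable_continuous c.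
  by apply: cvgN; exact: c.
- by rewrite -oppr0; apply: cvgN; exact: cvgr_expR.
Qed.

Lemma Gamma_Euler_nat n : @Gamma_Euler R n.+1%:R = n`!%:R.
Proof.
elim: n => [|n IH].
  by have := @Gamma_Euler_real R 1; rewrite rG1 => ->.
rewrite -natr1 Gamma_Euler_rec ?IH ?factS ?natrM//.
by rewrite Re_nat.
Qed.

Lemma rGamma_nat k : (0 < k)%N -> @rGamma R k%:R = (k.-1)`!%:R.
Proof.
case: k => // k _; rewrite /rGamma rmorph_nat (@GammaE _ 0); last by rewrite Re_nat addr0 ltr0n.
by rewrite /Gamma_shifted big_ord0 divr1 addr0 Gamma_Euler_nat Re_nat.
Qed.

Let cexpRN (u : R) : {for u, continuous (fun u : R => expR (- u))}.
Proof. by have [+ _] := is_derive_expRN u => /derivable1_diffP/differentiable_continuous. Qed.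

Let i_expRN : mu.-integrable `]0, +oo[ (EFin \o (fun u : R => u `^ (1 - 1) * expR (- u))).
Proof. exact: (gamma_integrable (@ltr01 R)). Qed.

(** Exhibits 1 / (1 + x) as a multiplicative convolution of the exponential exp (- u) with itself,
    whence the product of two Gammas in its Mellin transform. *)
Lemma inv1D_integral (x : R) : 0 < x ->
  mu.-integrable `]0, +oo[ (EFin \o (fun y => expR (- y) * expR (- (x * y)))) /\
  Rintegral mu `]0, +oo[ (fun y => expR (- y) * expR (- (x * y))) = (1 + x)^-1.
Proof.
move=> x0; have x1 : 0 < 1 + x by rewrite addr_gt0.
have E (y : R) : 0 < y -> y `^ (1 - 1) * expR (- (y * (1 + x))) = expR (- y) * expR (- (x * y)).
  by move=> y0; rewrite subrr powRr0 mul1r -expRD; congr expR; ring.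
have [i e] := @Rintegral_scale (fun u => expR (- u)) (1 + x) 1 x1 (@measurable_expRN R)
  (fun u _ => @cexpRN u) i_expRN.
split.
  by apply: (eq_Rintegrable (@measurable_pos R) _ i) => y /pos_itv /E.
transitivity (Rintegral mu `]0, +oo[ (fun y => y `^ (1 - 1) * expR (- (y * (1 + x))))).
  by apply: eq_Rintegral => y /set_mem /pos_itv /E.
by rewrite e -/(rG 1) rG1 mulr1 powRN powRr1// (ltW x1).
Qed.

Lemma Mellin_inv1D z : 0 < Re z -> Re z < 1 ->
  Mellin (fun x => (1 + x)^-1) z = Gamma_Euler z * Gamma_Euler (1 - z).
Proof.
move=> z0 z1.
rewrite (@eq_Mellin _ (fun x => Rintegral mu `]0, +oo[ (fun y => expR (- y) * expR (- (x * y))))); last first.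
  by move=> x x0; rewrite (inv1D_integral x0).2.
rewrite (@Mellin_convolution (fun u => expR (- u)) (fun u => expR (- u))).
- congr (_ * _); rewrite /Gamma_Euler; apply: eq_Cintegral => u _; congr (Cpow _ _ * _); ring.
- exact: measurable_pos.
- exact: subset_refl.
- exact: measurable_expRN.
- exact: measurable_expRN.
- by move=> u _; exact: cexpRN.
- exact: gamma_integrable.
- have := @gamma_integrable R (1 - Re z); rewrite subr_gt0 => /(_ z1).
  by apply: (eq_Rintegrable (@measurable_pos R)) => u _; congr (_ `^ _ * _); ring.
- by move=> x x0; exact: (inv1D_integral x0).1.
Qed.

(** This is u / (1 + u), that is u times the derivative of ln (1 + u), for u > 0. The absolute
    values make it continuous, hence measurable, on the whole line. *)
Let ratio (u : R) := `|u| / (1 + `|u|).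

Let ratio_pos (u : R) : 0 < 1 + `|u|. Proof. by rewrite ltr_wpDr. Qed.

Let cratio (u : R) : {for u, continuous ratio}.
Proof.
have h : `|v| / (1 + `|v|) @[v --> u] --> `|u| / (1 + `|u|).
  apply: cvgM; first by apply: cvg_norm; exact: cvg_id.
  apply: cvgV; first by rewrite gt_eqF.
  by apply: cvgD; [exact: cvg_cst|apply: cvg_norm; exact: cvg_id].
exact: h.
Qed.

Let mratio : measurable_fun setT ratio.
Proof. by apply: continuous_measurable_fun => u; exact: cratio. Qed.

Let ratio_le1 u : `|ratio u| <= 1.
Proof.
have p := ratio_pos u.
rewrite ger0_norm ?divr_ge0 ?(ltW p)// ler_pdivrMr// mul1r; lra.
Qed.

Let ratio_le u : `|ratio u| <= `|u|.
Proof.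
have p := ratio_pos u; have n0 := normr_ge0 u.
rewrite ger0_norm ?divr_ge0 ?(ltW p)// ler_pdivrMr// ler_peMr//; lra.
Qed.

Let ratio_integrable (c : R) : -1 < c -> c < 0 ->
  mu.-integrable `]0, +oo[ (EFin \o (fun u => u `^ (c - 1) * ratio u)).
Proof.
move=> c1 c0; apply: (@mellin_integrable R ratio 1 (-1) 0) => //.
- by move=> u u0 _; rewrite opprK powRr1 ?(ltW u0)// mul1r; apply: le_trans (ratio_le u) _; rewrite gtr0_norm.
- by move=> u u1; rewrite oppr0 powRr0 mulr1.
Qed.

Lemma ln_le_powR (e z : R) : 0 < e -> 0 < z -> ln z <= z `^ e / e.
Proof.
move=> e0 z0; rewrite ler_pdivlMr// mulrC -ln_powR.
have p0 : 0 < z `^ e by rewrite powR_gt0.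
have -> : z `^ e = 1 + (z `^ e - 1) by ring.
apply: le_trans (le_ln1Dx _) _; lra.
Qed.

Lemma cvg_harmonic2_powR (x : R) : 0 < x -> (n.+2%:R^-1 : R) `^ x @[n --> \oo] --> (0 : R).
Proof.
move=> x0; have := cvg_harmonic_powR x0.
by rewrite -(cvg_shiftS (fun n => (n.+1%:R^-1 : R) `^ x)).
Qed.

Lemma measurable_unit : measurable (`]0, 1]%classic : set R).
Proof. exact: measurable_itv. Qed.

Lemma unit_itv (u : R) : `]0, 1]%classic u -> 0 < u /\ u <= 1.
Proof. by rewrite /= in_itv/= => /andP. Qed.

Lemma Nln_pow_le n (c y : R) : 0 < c -> 0 < y -> y <= 1 ->
  exists K : R, forall y : R, 0 < y -> y <= 1 -> y `^ c * (- ln y) ^+ n <= K * y `^ (c / 2).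
Proof.
(* Each of the n factors - ln y costs y^(- e); together they use up at most half of the exponent
   [c]. *)
move=> c0 _ _; pose e := c / (2 * n.+1%:R).
have n0 : (0 : R) < n.+1%:R by rewrite ltr0n.
have e0 : 0 < e by rewrite divr_gt0// mulr_gt0.
exists ((1 / e) ^+ n) => {}y y0 y1.
have l0 : 0 <= - ln y by rewrite oppr_ge0 ln_le0.
have h : - ln y <= 1 / e * y `^ (- e).
  have := @ln_le_powR e y^-1 e0; rewrite invr_gt0 => /(_ y0).
  by rewrite lnV ?posrE// -powR_inv1 ?(ltW y0)// -powRrM mulN1r mulrC div1r.
apply: (@le_trans _ _ (y `^ c * (1 / e * y `^ (- e)) ^+ n)).
  by rewrite ler_wpM2l ?powR_ge0// lerXn2r ?nnegrE// (le_trans l0 h).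
have K0 : 0 <= (1 / e) ^+ n by rewrite exprn_ge0// div1r invr_ge0 ltW.
rewrite exprMn mulrCA ler_wpM2l//.
rewrite -powR_mulrn ?powR_ge0// -powRrM -powRD ?(gt_eqF y0) ?implybT//.
rewrite /powR gt_eqF// ler_expR ler_wnM2r ?ln_le0//.
have : n%:R / (n.+1%:R : R) <= 1 by rewrite ler_pdivrMr// mul1r ler_nat.
have -> : - e * n%:R = - (c / 2 * (n%:R / n.+1%:R)) by rewrite /e; field; rewrite gt_eqF.
move=> nn; have h2 : c / 2 * (n%:R / n.+1%:R) <= c / 2 by rewrite ler_piMr// divr_ge0// ltW.
rewrite lerBrDr -lerBrDl; apply: le_trans h2 _; lra.
Qed.

(** The integral J_m satisfies z J_m = m J_(m - 1) for m > 0 and z J_0 = 1, by integration by parts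
    with the boundary term y^z (- ln y)^m. *)
Lemma Cintegral_Nln_pow n z : 0 < Re z ->
  cintegrable `]0, 1] (fun y => Cpow y (z - 1) * ((- ln y) ^+ n)%:C) /\
  Cintegral `]0, 1] (fun y => Cpow y (z - 1) * ((- ln y) ^+ n)%:C) = n`!%:R / z ^+ n.+1.
Proof.
move=> z0; have zn0 : z != 0 by apply: contraTneq z0 => ->; rewrite ltxx.
have mln : measurable_fun setT (fun y : R => - ln y).
  by apply: measurableT_comp => //; exact: measurable_ln.
pose j m (y : R) : R[i] := Cpow y (z - 1) * ((- ln y) ^+ m)%:C.
have int m : cintegrable `]0, 1] (j m).
  have [K HK] := @Nln_pow_le m (Re z) 1 z0 ltr01 (lexx _).
  have z20 : 0 < Re z / 2 by rewrite divr_gt0.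
  have iK : mu.-integrable `]0, 1] (EFin \o (fun y => K * y `^ (Re z / 2 - 1))).
    by apply: (integrableZl _ K (integrable_powR01 z20)); exact: measurable_unit.
  apply: (cintegrable_le measurable_unit _ iK).
    apply: cmeasurableM; first by apply: cmeasurable_Cpow => //; exact: cmeasurable_cst.
    by apply: cmeasurable_real; apply: measurable_funTS; exact: measurable_funX.
  move=> y /unit_itv[y0 y1]; rewrite normcM normc_real normc_Cpow//.
  have l0 : 0 <= - ln y by rewrite oppr_ge0 ln_le0.
  rewrite ReD ReN /= ger0_norm ?exprn_ge0//.
  have yy : y `^ (- 1) * y = 1 by rewrite powR_inv1 ?(ltW y0)// mulVf// gt_eqF.
  rewrite [Re z - 1]addrC [Re z / 2 - 1]addrC !powRD ?(gt_eqF y0) ?implybT//.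
  rewrite (_ : K * _ = y `^ (- 1) * (K * y `^ (Re z / 2))); last by ring.
  by rewrite -mulrA ler_wpM2l ?powR_ge0// HK.
have dCpow (w : R[i]) (y : R) := @path_derivative_Cpow R w y.
have dln m (y : R) : 0 < y -> is_derive y 1 (fun y : R => (- ln y) ^+ m) (- (m%:R * (- ln y) ^+ m.-1 * y^-1)).
  move=> y0; have d := is_deriveN (is_derive1_ln y0).
  have d2 := is_deriveX m d.
  have -> : (fun y : R => (- ln y) ^+ m) = (- @ln R) ^+ m.
    by apply/funext => u; elim: m {d2} => [|m IH]; rewrite ?expr0 ?exprS //= IH.
  by apply: (is_derive_eq d2); rewrite /GRing.scale /= mulrN.
have dF m (y : R) : 0 < y -> path_derivative (fun y => Cpow y z * ((- ln y) ^+ m)%:C) y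
    (z * j m y - m%:R * j m.-1 y).
  move=> y0; have := path_derivativeM (dCpow z y y0) (path_derivative_real (dln m y y0)).
  suff -> : z * Cpow y (z - 1) * ((- ln y) ^+ m)%:C +
      Cpow y z * (- (m%:R * (- ln y) ^+ m.-1 / y))%:C = z * j m y - m%:R * j m.-1 y by [].
  rewrite /j CpowD CpowN Cpow1// rmorphN !rmorphM /= fmorphV rmorph_nat; ring.
have cj m (y : R) : 0 < y -> {for y, continuous (j m)}.
  move=> y0; exact: (path_derivative_continuous
    (path_derivativeM (dCpow (z - 1) y y0) (path_derivative_real (dln m y y0)))).
have lim m : Cpow n.+2%:R^-1 z * ((- ln n.+2%:R^-1) ^+ m)%:C @[n --> \oo] --> (0 : R[i]).
  have [K HK] := @Nln_pow_le m (Re z) 1 z0 ltr01 (lexx _).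
  have z20 : 0 < Re z / 2 by rewrite divr_gt0.
  have l : K * (n.+2%:R^-1 : R) `^ (Re z / 2) @[n --> \oo] --> (0 : R).
    rewrite -[X in _ --> X](mulr0 K); apply: cvgM; first exact: cvg_cst.
    exact: cvg_harmonic2_powR.
  apply: (cvgy_normc0 (F := nbhs \oo) _ l); apply: nearW => k.
  have k0 : (0 : R) < k.+2%:R^-1 by rewrite invr_gt0.
  have k1 : (k.+2%:R^-1 : R) <= 1 by rewrite invf_le1// ler1n.
  rewrite normcM normc_real normc_Cpow// ger0_norm ?HK//.
  by rewrite exprn_ge0// oppr_ge0 ln_le0.
split; first exact: int.
(* At y = 1 the boundary term is 0 ^ m, which is 1 exactly when m = 0; in that case the coefficient
   m removes the spurious term with [m.-1 = 0]. *)
have step m : z * Cintegral `]0, 1] (j m) - m%:R * Cintegral `]0, 1] (j m.-1) = (m == 0%N)%:R.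
  have i1 := cintegrableZl z measurable_unit (int m).
  have i2 := cintegrableZl (- m%:R) measurable_unit (int m.-1).
  rewrite -(CintegralZl z measurable_unit (int m)) -mulNr.
  rewrite -(CintegralZl (- m%:R) measurable_unit (int m.-1)) -(CintegralD measurable_unit i1 i2).
  have l1 := cvgB (cvg_cst ((m == 0%N)%:R : R[i])) (lim m); rewrite subr0 in l1.
  apply: (@Cintegral_FTC R _ (fun n => n.+2%:R^-1) (fun=> 1) (fun y => Cpow y z * ((- ln y) ^+ m)%:C)).
  - exact: measurable_unit.
  - by move=> k; rewrite invf_lt1// ltr1n.
  - move=> k y /=; rewrite !in_itv/= => /andP[y1 ->]; rewrite andbT.
    by apply: lt_le_trans y1; rewrite invr_gt0.
  - move=> y /unit_itv[y0 y1]; near=> k; rewrite /= in_itv /= y1 andbT.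
    rewrite invf_ple ?posrE//; apply: (@le_trans _ _ k%:R); last by rewrite ler_nat -addn2 leq_addr.
    by near: k; exact: nbhs_infty_ger.
  - by move=> y /unit_itv[y0 _]; have := dF m y y0; rewrite -mulNr.
  - move=> y /unit_itv[y0 _].
    exact: (ccontinuousD (ccontinuousZ (c := z) (cj m y y0)) (ccontinuousZ (c := - m%:R) (cj m.-1 y y0))).
  - exact: (cintegrableD measurable_unit i1 i2).
  - have -> : (fun n => Cpow 1 z * ((- ln 1) ^+ m)%:C - Cpow n.+2%:R^-1 z * ((- ln n.+2%:R^-1) ^+ m)%:C) =
      (fun n => (m == 0%N)%:R - Cpow n.+2%:R^-1 z * ((- ln n.+2%:R^-1) ^+ m)%:C) :> (nat -> R[i]).
      apply/funext => k; congr (_ - _); rewrite Cpow1l mul1r ln1 oppr0 expr0n.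
      by case: (m == 0%N).
    exact: l1.
elim: n {lim} => [|n IH].
  have := step 0%N; rewrite mul0r subr0 => h.
  by apply: (mulfI zn0); rewrite h expr1 fact0 mulrC divfK.
have := step n.+1; rewrite [Cintegral _ (j n)]IH /= => /eqP; rewrite subr_eq0 => /eqP h.
apply: (mulfI zn0); rewrite h factS natrM [z ^+ n.+2]exprS invfM.
by rewrite [RHS]mulrCA (mulrA z) mulfV// mul1r mulrA.
Unshelve. all: by end_near. Qed.

(** The integrand is x / (1 + x y), the y-derivative of ln (1 + x y). This presents ln (1 + x) as
    the multiplicative convolution of [ratio] with 1 / y on the unit interval. *)
Lemma ln1D_integral (x : R) : 0 < x ->
  mu.-integrable `]0, 1] (EFin \o (fun y => y `^ (-1) * ratio (x * y))) /\
  Rintegral mu `]0, 1] (fun y => y `^ (-1) * ratio (x * y)) = ln (1 + x).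
Proof.
move=> x0.
have E (y : R) : `]0, 1]%classic y -> y `^ (-1) * ratio (x * y) = x / (1 + x * y).
  move=> /unit_itv[y0 _]; have xy0 : 0 < x * y by rewrite mulr_gt0.
  rewrite /ratio gtr0_norm// powR_inv1 ?(ltW y0)//; field.
  by rewrite (gt_eqF y0) gt_eqF// addr_gt0.
have mr : measurable_fun setT (fun y : R => y `^ (-1) * ratio (x * y)).
  apply: measurable_funM; first exact: measurable_powR.
  by apply: (measurableT_comp mratio); exact: measurable_funM.
have i : mu.-integrable `]0, 1] (EFin \o (fun y => y `^ (-1) * ratio (x * y))).
  have i01 : mu.-integrable `]0, 1] (EFin \o (fun y : R => x * y `^ (1 - 1))).
    by apply: (integrableZl _ x (integrable_powR01 ltr01)); exact: measurable_unit.
  apply: (le_Rintegrable measurable_unit mr i01) => y y01.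
  rewrite E// subrr powRr0 mulr1; have [y0 _] := unit_itv y01.
  have xy0 : 0 < x * y by rewrite mulr_gt0.
  rewrite normrM (gtr0_norm x0) ler_piMr ?(ltW x0)// gtr0_norm ?invr_gt0 ?addr_gt0//.
  by rewrite invf_le1 ?addr_gt0//; lra.
split=> //; apply: (@Rintegral_FTC R _ (fun n => n.+2%:R^-1) (fun=> 1) (fun y => ln (1 + x * y))).
- exact: measurable_unit.
- by move=> k; rewrite invf_lt1// ltr1n.
- move=> k y /=; rewrite !in_itv/= => /andP[y1 ->]; rewrite andbT.
  by apply: lt_le_trans y1; rewrite invr_gt0.
- move=> y /unit_itv[y0 y1]; near=> k; rewrite /= in_itv /= y1 andbT.
  rewrite invf_ple ?posrE//; apply: (@le_trans _ _ k%:R); last by rewrite ler_nat -addn2 leq_addr.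
  by near: k; exact: nbhs_infty_ger.
- move=> y y01; rewrite E//; have [y0 _] := unit_itv y01.
  have p : 0 < 1 + x * y by rewrite addr_gt0 ?mulr_gt0.
  have d1 : is_derive y 1 (fun y : R => 1 + x * y) x.
    have d := is_deriveD (is_derive_cst (1 : R) y 1) (is_deriveZ x (is_derive_id y 1)).
    by apply: (is_derive_eq d); rewrite add0r /GRing.scale /= mulr1.
  have d2 := @is_derive1_comp R (@ln R) _ y _ _ (is_derive1_ln p) d1.
  by apply: (is_derive_eq d2); rewrite mulrC.
- move=> y /unit_itv[y0 _]; have xy0 : 0 < x * y by rewrite mulr_gt0.
  have c1 := @continuous_powR R (-1) y y0.
  have h : v `^ (-1) * ratio (x * v) @[v --> y] --> y `^ (-1) * ratio (x * y).
    apply: cvgM; first exact: c1.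
    have c2 : x * v @[v --> y] --> x * y by apply: cvgM; [exact: cvg_cst|exact: cvg_id].
    exact: (continuous_comp (f := fun v : R => x * v) c2 (@cratio (x * y))).
  exact: h.
- exact: i.
- have c : {for (1 : R), continuous (@ln R)} by apply: continuous_ln.
  have l1 : (1 + x * (n.+2%:R^-1)) @[n --> \oo] --> (1 : R).
    rewrite -[X in _ --> X]addr0; apply: cvgD; first exact: cvg_cst.
    rewrite -(mulr0 x); apply: cvgM; first exact: cvg_cst.
    have := @cvg_harmonic2_powR 1 ltr01; apply: cvg_trans; apply: near_eq_cvg.
    by apply: nearW => k /=; rewrite powRr1.
  have l2 : ln (1 + x * (n.+2%:R^-1)) @[n --> \oo] --> ln (1 : R) := cvg_comp _ _ l1 c.
  have := cvgB (cvg_cst (ln (1 + x * 1))) l2.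
  by rewrite ln1 subr0 mulr1; apply.
Unshelve. all: by end_near. Qed.

Lemma Mellin_ln1D z : -1 < Re z -> Re z < 0 ->
  Mellin (fun x => ln (1 + x)) z = Gamma_Euler (1 + z) * Gamma_Euler (- z) / (- z).
Proof.
move=> z1 z0; have Nz0 : 0 < Re (- z) by rewrite ReN; lra.
rewrite (@eq_Mellin _ (fun x => Rintegral mu `]0, 1] (fun y => y `^ (-1) * ratio (x * y)))); last first.
  by move=> x x0; rewrite (ln1D_integral x0).2.
have [_ e] := @Cintegral_Nln_pow 0 (- z) Nz0.
rewrite (@Mellin_convolution ratio (fun y => y `^ (-1))).
- have -> : Cintegral `]0, 1] (fun y => Cpow y (- z) * (y `^ (-1))%:C) = (- z)^-1.
    transitivity (Cintegral `]0, 1] (fun y => Cpow y (- z - 1) * ((- ln y) ^+ 0)%:C)).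
      by apply: eq_Cintegral => y /unit_itv[y0 _]; rewrite -Cpow_real// expr0 mulr1 rmorphN -CpowD.
    by rewrite e expr1 fact0 mul1r.
  congr (_ / _).
  (* The extra factor u in [ratio] shifts the variable by 1, which carries the strip from ]0,
     1[ to ]-1, 0[. *)
  have -> : Mellin ratio z = Mellin (fun x => (1 + x)^-1) (1 + z).
    apply: eq_Cintegral => u /pos_itv u0; rewrite /ratio gtr0_norm//.
    have -> : 1 + z - 1 = 1 + (z - 1) by ring.
    by rewrite [Cpow u (1 + _)]CpowD Cpow1// rmorphM /=; ring.
  rewrite Mellin_inv1D; [|by rewrite ReD; have : Re (1 : R[i]) = 1 by []; lra|by rewrite ReD; have : Re (1 : R[i]) = 1 by []; lra].
  by congr (_ * Gamma_Euler _); ring.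
- exact: measurable_unit.
- by move=> y /unit_itv[y0 _]; rewrite /= in_itv/= y0.
- exact: mratio.
- exact: measurable_powR.
- by move=> u _; exact: cratio.
- exact: ratio_integrable.
- rewrite ReN in Nz0; apply: (eq_Rintegrable measurable_unit _ (integrable_powR01 Nz0)).
  by move=> y /unit_itv[y0 _]; rewrite powRD// (gt_eqF y0) implybT.
- by move=> x x0; exact: (ln1D_integral x0).1.
Qed.

Lemma ln1D_integrable (c : R) : -1 < c -> c < 0 ->
  mu.-integrable `]0, +oo[ (EFin \o (fun u => u `^ (c - 1) * ln (1 + u))).
Proof.
(* At infinity the logarithm is bounded by a multiple of u^e, which is integrable at [c] as soon as
   [c < - e]; here - e = c / 2. *)
move=> c1 c0; pose e := - c / 2; have e0 : 0 < e by rewrite /e; lra.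
have mln : measurable_fun setT (fun u : R => ln (1 + u)).
  by apply: (measurableT_comp (@measurable_ln R)); exact: measurable_funD.
have K0 : 0 <= 2 `^ e / e by rewrite divr_ge0 ?powR_ge0 ?ltW.
apply: (@mellin_integrable R (fun u => ln (1 + u)) (1 + 2 `^ e / e) (-1) (- e)) => //; last by rewrite /e; lra.
- move=> u u0 _; rewrite opprK powRr1 ?(ltW u0)// ger0_norm ?ln_ge0//; last by lra.
  by apply: le_trans (le_ln1Dx _) _; [lra|rewrite ler_peMl ?(ltW u0)//; lra].
- move=> u u1; rewrite opprK ger0_norm ?ln_ge0//; last by lra.
  apply: (@le_trans _ _ (ln (2 * u))); first by rewrite ler_ln ?posrE; lra.
  apply: le_trans (ln_le_powR e0 _) _; first by lra.
  rewrite powRM; [|lra|lra]; rewrite mulrAC ler_wpM2r ?powR_ge0//; lra.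
Qed.

End MellinTransform.

(** * The logarithm averaged over the fog gain *)

Lemma measurable_fine_integral d1 d2 (T1 : measurableType d1) (T2 : measurableType d2) (R : realType)
  (m2 : {sigma_finite_measure set T2 -> \bar R}) (h : T1 * T2 -> R) :
  measurable_fun setT h -> (forall p, 0 <= h p) ->
  measurable_fun setT (fun x => fine (\int[m2]_y (h (x, y))%:E)%E).
Proof.
move=> mh h0; apply: (measurableT_comp (f := fine)) => //.
have mE : measurable_fun setT (EFin \o h) by exact/measurable_EFinP.
exact: (measurable_fun_fubini_tonelli_F (m2 := m2) (EFin \o h) mE (fun p => h0 p)).
Qed.

Section Capacity.
Variable R : realType.
Local Notation mu := (@lebesgue_measure R).
Implicit Types (z s : R[i]).

Section LogGain.
Variables lam tau : R.
Hypotheses (lam0 : 0 < lam) (tau0 : 0 < tau).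

(* The absolute value makes the gain nonnegative on the whole line. *)
Definition log_gain (x : R) : R := ln (1 + lam * `|x| `^ tau).

Lemma log_gain_ge0 x : 0 <= log_gain x.
Proof. by rewrite ln_ge0// lerDl mulr_ge0 ?powR_ge0 ?(ltW lam0). Qed.

Lemma measurable_log_gain : measurable_fun setT log_gain.
Proof.
have mp : measurable_fun setT (fun x : R => x `^ tau) by exact: measurable_powR.
have mn : measurable_fun setT (fun x : R => `|x|).
  by apply: continuous_measurable_fun; exact: norm_continuous.
apply: (measurableT_comp (@measurable_ln R)); apply: measurable_funD => //.
by apply: measurable_funM => //; exact: (measurableT_comp mp mn).
Qed.

Lemma continuous_log_gain (u : R) : 0 < u -> {for u, continuous log_gain}.
Proof.
move=> u0; have nu0 : 0 < `|u| by rewrite gtr0_norm.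
have c1 : `|v| @[v --> u] --> `|u| by apply: cvg_norm; exact: cvg_id.
have c2 : `|v| `^ tau @[v --> u] --> `|u| `^ tau := cvg_comp _ _ c1 (@continuous_powR R tau _ nu0).
have c3 : 1 + lam * `|v| `^ tau @[v --> u] --> 1 + lam * `|u| `^ tau.
  by apply: cvgD; [exact: cvg_cst|apply: cvgM; [exact: cvg_cst|exact: c2]].
have p : 0 < 1 + lam * `|u| `^ tau by rewrite addr_gt0 ?mulr_gt0 ?powR_gt0.
have c4 : log_gain v @[v --> u] --> log_gain u := cvg_comp _ _ c3 (continuous_ln p).
exact: c4.
Qed.

(** Fog only attenuates, so each integrand averaged over the fog is dominated by the gain without
    fog. *)
Lemma log_gain_mul_le (x y : R) : 0 < y -> y <= 1 -> log_gain (x * y) <= log_gain x.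
Proof.
move=> y0 y1; rewrite /log_gain ler_ln ?posrE ?ltr_wpDr ?mulr_ge0 ?powR_ge0 ?(ltW lam0)//.
rewrite lerD2l ler_wpM2l ?(ltW lam0)// ge0_ler_powR ?nnegrE ?(ltW tau0)//.
by rewrite normrM (gtr0_norm y0) ler_piMr.
Qed.

Let g (u : R) := ln (1 + u).

Let mg : measurable_fun setT g.
Proof. by apply: (measurableT_comp (@measurable_ln R)); exact: measurable_funD. Qed.

Let cg (u : R) : 0 < u -> {for u, continuous g}.
Proof.
move=> u0; have c1 : 1 + v @[v --> u] --> 1 + u by apply: cvgD; [exact: cvg_cst|exact: cvg_id].
have p : 0 < 1 + u by rewrite addr_gt0.
have c2 : g v @[v --> u] --> g u := cvg_comp _ _ c1 (continuous_ln p).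
exact: c2.
Qed.

Let strip s : - tau < Re s -> Re s < 0 -> -1 < Re s / tau /\ Re s / tau < 0.
Proof. by move=> s1 s0; rewrite ltr_pdivlMr// mulN1r ltr_pdivrMr// mul0r. Qed.

Let gain s (s1 : - tau < Re s) (s0 : Re s < 0) :=
  let: conj a b := strip s1 s0 in
  @Mellin_scale_power R g lam tau s lam0 tau0 mg cg (ln1D_integrable a b).

Lemma log_gain_integrable (c : R) : - tau < c -> c < 0 ->
  mu.-integrable `]0, +oo[ (EFin \o (fun u => u `^ (c - 1) * log_gain u)).
Proof.
move=> c1 c0; have [[i _] _] := @gain c%:C c1 c0.
apply: (eq_Rintegrable (@measurable_pos R) _ i) => x /pos_itv x0.
by rewrite -rmorphB Cpow_real// -rmorphM /log_gain gtr0_norm.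
Qed.

Lemma Mellin_log_gain s : - tau < Re s -> Re s < 0 -> let z := s / tau%:C in
  Mellin log_gain s = (tau^-1)%:C * Cpow lam (- z) * (Gamma_Euler (1 + z) * Gamma_Euler (- z) / (- z)).
Proof.
move=> s1 s0 z; have [_ e] := @gain s s1 s0; have [a b] := strip s1 s0.
have rez : Re z = Re s / tau by rewrite /z -[tau%:C^-1]fmorphV ReM /= mulr0 subr0.
have e2 := @Mellin_ln1D R z; rewrite rez in e2.
transitivity (Mellin (fun x => g (lam * x `^ tau)) s).
  by apply: eq_Mellin => x x0; rewrite /log_gain gtr0_norm.
by rewrite e -/z; congr (_ * _); exact: e2.
Qed.

End LogGain.

Section Fog.
Variables (v : R) (k : nat).
Hypotheses (v0 : 0 < v) (k0 : (0 < k)%N).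
Local Notation w := (fog_density v k).

Lemma fog_densityE (y : R) : `]0, 1]%classic y ->
  w y = v ^+ k / (k.-1)`!%:R * (- ln y) ^+ k.-1 * y `^ (v - 1).
Proof.
move=> /unit_itv[y0 y1]; rewrite /fog_density y0 y1 rGamma_nat// div1r lnV//.
Qed.

Lemma fog_density0 (y : R) : ~ `]0, 1]%classic y -> w y = 0.
Proof. by rewrite /= in_itv/= /fog_density => /negP/negbTE ->. Qed.

Lemma fog_Mellin s : Re s < v ->
  cintegrable `]0, 1] (fun y => Cpow y (- s) * (w y)%:C) /\
  Cintegral `]0, 1] (fun y => Cpow y (- s) * (w y)%:C) = (v%:C / (v%:C - s)) ^+ k.
Proof.
move=> sv; have z0 : 0 < Re (v%:C - s) by rewrite ReD ReN subr_gt0.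
have [i e] := @Cintegral_Nln_pow R k.-1 _ z0.
have E (y : R) : `]0, 1]%classic y ->
    (* The fog density is a power of y times (- ln y)^(k - 1), so its transform is one of the
       integrals [Cintegral_Nln_pow]; the factorial (k - 1)! cancels Gamma k. *)
    (v ^+ k / (k.-1)`!%:R)%:C * (Cpow y (v%:C - s - 1) * ((- ln y) ^+ k.-1)%:C) = Cpow y (- s) * (w y)%:C.
  move=> y01; rewrite fog_densityE//; have [y0 _] := unit_itv y01.
  have -> : v%:C - s - 1 = - s + (v - 1)%:C by rewrite rmorphB /=; ring.
  by rewrite CpowD Cpow_real// [in RHS]rmorphM [in RHS]rmorphM /=; ring.
split; first by apply: (eq_cintegrable (@measurable_unit R) E); exact: (cintegrableZl _ (@measurable_unit R) i).
rewrite -(eq_Cintegral E) (CintegralZl _ (@measurable_unit R) i) e prednK//.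
have f0 : (k.-1)`!%:R != 0 :> R[i] by rewrite pnatr_eq0 -lt0n fact_gt0.
rewrite rmorphM fmorphV rmorphXn rmorph_nat expr_div_n mulrA divfK//.
Qed.

Lemma fog_integrable (c : R) : c < v ->
  mu.-integrable `]0, 1] (EFin \o (fun y => y `^ (- c) * w y)).
Proof.
move=> cv; have [[i _] _] := @fog_Mellin c%:C cv.
apply: (eq_Rintegrable (@measurable_unit R) _ i) => y /unit_itv[y0 _].
by rewrite -rmorphN Cpow_real// -rmorphM.
Qed.

End Fog.

Section FogGain.
Variables (lam tau v : R) (k : nat).
Hypotheses (lam0 : 0 < lam) (tau0 : 0 < tau) (v0 : 0 < v) (k0 : (0 < k)%N).
Hypotheses (mw : measurable_fun setT (fog_density v k)) (w0 : forall y, 0 <= fog_density v k y).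
Local Notation w := (fog_density v k).
Local Notation L := (log_gain lam tau).

(** The function W of the overview up to the factor 1 / ln 2, which is kept apart until the end. *)
Definition fog_gain (x : R) : R := Rintegral mu setT (fun y => w y * L (x * y)).

Lemma fog_gainE x : fog_gain x = Rintegral mu `]0, 1] (fun y => w y * L (x * y)).
Proof.
rewrite [RHS]Rintegral_mkcond; apply: eq_Rintegral => y _.
rewrite patchE; case: ifPn => // /negP ny.
by rewrite fog_density0 ?mul0r// => y01; apply: ny; exact/mem_set.
Qed.

Let iw : mu.-integrable `]0, 1] (EFin \o w).
Proof.
apply: (eq_Rintegrable (@measurable_unit R) _ (fog_integrable k0 v0)) => y _.
by rewrite oppr0 powRr0 mul1r.
Qed.

Let mL : measurable_fun setT L. Proof. exact: measurable_log_gain. Qed.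

Let mwL x : measurable_fun setT (fun y : R => w y * L (x * y)).
Proof.
have mx : measurable_fun setT (fun y : R => x * y) by exact: measurable_funM.
by apply: measurable_funM => //; exact: (measurableT_comp mL mx).
Qed.

Lemma fog_gain_integrable_unit x :
  mu.-integrable `]0, 1] (EFin \o (fun y => w y * L (x * y))).
Proof.
have i : mu.-integrable `]0, 1] (EFin \o (fun y => L x * w y)).
  by apply: (integrableZl _ (L x) iw); exact: (@measurable_unit R).
apply: (le_Rintegrable (@measurable_unit R) (mwL x) i) => y /unit_itv[y0 y1].
rewrite ger0_norm ?mulr_ge0 ?log_gain_ge0// mulrC ler_wpM2r// log_gain_mul_le//.
Qed.

Lemma fog_gain_integrand_integrable x :
  mu.-integrable setT (EFin \o (fun y => w y * L (x * y))).
Proof.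
have /integrable_mkcond := fog_gain_integrable_unit x => /(_ (@measurable_unit R)).
apply: eq_integrable => // y _; rewrite patchE; case: ifPn => // /negP ny.
by rewrite /= fog_density0 ?mul0r// => y01; apply: ny; exact/mem_set.
Qed.

Lemma fog_gain_ge0 x : 0 <= fog_gain x.
Proof. by apply: Rintegral_ge0 => y _; rewrite mulr_ge0 ?log_gain_ge0. Qed.

Lemma measurable_fog_gain : measurable_fun setT fog_gain.
Proof.
pose h (p : R * R) := w p.2 * L (p.1 * p.2).
have mh : measurable_fun setT h.
  apply: measurable_funM; first exact: (measurableT_comp mw measurable_snd).
  apply: (measurableT_comp mL).
  by apply: measurable_funM; [exact: measurable_fst|exact: measurable_snd].
have h0 p : 0 <= h p by rewrite mulr_ge0 ?log_gain_ge0.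
have mF := @measurable_fine_integral _ _ _ _ R (@lebesgue_measure R) h mh h0.
exact: mF.
Qed.

Lemma fog_gain_integrable (c : R) : - tau < c -> c < 0 ->
  mu.-integrable `]0, +oo[ (EFin \o (fun x => x `^ (c - 1) * fog_gain x)).
Proof.
move=> c1 c0; pose I := Rintegral mu `]0, 1] w.
have i : mu.-integrable `]0, +oo[ (EFin \o (fun u => I * (u `^ (c - 1) * L u))).
  by apply: (integrableZl _ I (log_gain_integrable lam0 tau0 c1 c0)); exact: measurable_pos.
apply: (le_Rintegrable (@measurable_pos R) _ i).
  by apply: measurable_funM; [exact: measurable_powR|exact: measurable_fog_gain].
move=> x /pos_itv x0; rewrite ger0_norm ?mulr_ge0 ?powR_ge0 ?fog_gain_ge0//.
rewrite mulrCA ler_wpM2l ?powR_ge0// fog_gainE.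
have -> : I * L x = Rintegral mu `]0, 1] (fun y => L x * w y).
  by rewrite RintegralZl// mulrC.
apply: le_Rintegral => //.
- exact: fog_gain_integrable_unit.
- by apply: (integrableZl _ (L x) iw); exact: (@measurable_unit R).
- by move=> y /unit_itv[y0 y1]; rewrite mulrC ler_wpM2r// log_gain_mul_le.
Qed.

Lemma Mellin_fog_gain s : - tau < Re s -> Re s < 0 ->
  Mellin fog_gain s = Mellin L s * (v%:C / (v%:C - s)) ^+ k.
Proof.
move=> s1 s0; have sv : Re s < v by apply: lt_trans v0.
rewrite (eq_Mellin (g := fun x => Rintegral mu `]0, 1] (fun y => w y * L (x * y)))); last first.
  by move=> x _; exact: fog_gainE.
rewrite (@Mellin_convolution R L w).
- by rewrite (fog_Mellin k0 sv).2.
- exact: (@measurable_unit R).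
- by move=> y /unit_itv[y0 _]; rewrite /= in_itv/= y0.
- exact: measurable_log_gain.
- exact: mw.
- by move=> u u0; exact: continuous_log_gain.
- exact: log_gain_integrable.
- exact: fog_integrable.
- by move=> x _; exact: fog_gain_integrable_unit.
Qed.

End FogGain.

(** * Parseval's formula on a vertical line *)

Section Parseval.
Variables (r : seq nat) (K : nat -> R[i] -> R[i]) (C zeta : nat -> R) (c1 phi : R) (W : R -> R).
Hypothesis C0 : forall l, l \in r -> 0 < C l.
Hypothesis cK : forall l, l \in r -> forall y : R, {for y, continuous (fun y : R => K l (c1 +i* y))}.
Hypothesis bK : forall l, l \in r ->
  exists M : R, forall y : R, normc (K l (c1 +i* y)) <= M * (y ^+ 2 + 1)^-1.
Hypothesis mW : measurable_fun setT W.
Hypothesis iW : mu.-integrable `]0, +oo[ (EFin \o (fun x => x `^ (c1 + phi - 1) * W x)).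

Let h (x y : R) := \sum_(l <- r) (zeta l)%:C * (K l (c1 +i* y) * Cpow (C l * x) (c1 +i* y)).

(** On the line the modulus of (C_l x)^s depends on x alone, so the bound separates x from y and
    provides the product majorant for the exchange of integrals. *)
Let h_bound : exists M : R, forall x y : R, 0 < x -> normc (h x y) <= x `^ c1 * (M * (y ^+ 2 + 1)^-1).
Proof.
rewrite /h; elim: r C0 bK => [|l r' IH] C0' bK'.
  by exists 0 => x y _; rewrite big_nil normc0 mul0r mulr0.
have [M HM] := IH (fun j jr => C0' j (mem_behead (s := l :: r') jr)) (fun j jr => bK' j (mem_behead (s := l :: r') jr)).
have [Ml Hl] := bK' l (mem_head _ _); have Cl := C0' l (mem_head _ _).
exists (`|zeta l| * C l `^ c1 * Ml + M) => x y x0; rewrite big_cons.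
apply: le_trans (normcD _ _) _.
have b1 : normc ((zeta l)%:C * (K l (c1 +i* y) * Cpow (C l * x) (c1 +i* y))) <=
    x `^ c1 * (`|zeta l| * C l `^ c1 * Ml * (y ^+ 2 + 1)^-1).
  rewrite CpowM// (normcM (zeta l)%:C) (normcM (K l _)).
  rewrite (normcM (Cpow (C l) _)) normc_real (normc_Cpow _ Cl) (normc_Cpow _ x0) /=.
  rewrite (_ : x `^ c1 * _ = `|zeta l| * (Ml * (y ^+ 2 + 1)^-1 * (C l `^ c1 * x `^ c1))); last by ring.
  by rewrite ler_wpM2l// ler_wpM2r ?mulr_ge0 ?powR_ge0// Hl.
have := lerD b1 (HM x y x0); rewrite -mulrDr -mulrDl; exact.
Qed.

Let cline : cmeasurable setT (fun y : R => c1 +i* y).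
Proof. by split => //=; exact: measurable_cst. Qed.

Let int_l l (x : R) : l \in r -> 0 < x ->
  cintegrable setT (fun y => K l (c1 +i* y) * Cpow (C l * x) (c1 +i* y)).
Proof.
move=> lr x0; have [M HM] := bK lr; have Cl := C0 lr.
have i : mu.-integrable setT (EFin \o (fun y : R => ((C l * x) `^ c1 * M) * (y ^+ 2 + 1)^-1)).
  exact: (integrableZl measurableT _ (integrable_inv_sqr R)).
apply: (cintegrable_le measurableT _ i).
  apply: cmeasurableM; first exact: (cmeasurable_continuous (cK lr)).
  by apply: cmeasurable_Cpow => //; exact: measurable_cst.
move=> y _; rewrite normcM normc_Cpow ?mulr_gt0//= mulrC -mulrA.
by rewrite ler_wpM2l ?powR_ge0.
Qed.

Lemma line_sum (x : R) : 0 < x ->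
  \sum_(l <- r) (zeta l)%:C * Cintegral setT (fun y => K l (c1 +i* y) * Cpow (C l * x) (c1 +i* y)) =
  Cintegral setT (h x).
Proof.
move=> x0; have [|_ ->] := @Cintegral_sum R _ r setT
   (fun l y => (zeta l)%:C * (K l (c1 +i* y) * Cpow (C l * x) (c1 +i* y))) measurableT.
  by move=> l lr; apply: cintegrableZl => //; exact: int_l.
rewrite big_seq [RHS]big_seq; apply: eq_bigr => l lr.
by rewrite CintegralZl//; exact: int_l.
Qed.

Let mh : cmeasurable setT (fun p : R * R => h p.1 p.2).
Proof.
apply: cmeasurable_sum => l lr; apply: cmeasurableM; first exact: cmeasurable_cst.
apply: cmeasurableM.
  exact: (cmeasurable_comp (cmeasurable_continuous (cK lr)) measurable_snd).
apply: cmeasurable_Cpow.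
  by apply: measurable_funM => //; exact: measurable_fst.
exact: (cmeasurable_comp cline measurable_snd).
Qed.

Lemma line_sum_bound : exists A : R, forall x : R, 0 < x -> normc (Cintegral setT (h x)) <= A * x `^ c1.
Proof.
have [M HM] := h_bound.
exists (2 * Rintegral mu setT (fun y : R => M * (y ^+ 2 + 1)^-1)) => x x0.
have i : mu.-integrable setT (EFin \o (fun y : R => x `^ c1 * (M * (y ^+ 2 + 1)^-1))).
  have j : mu.-integrable setT (EFin \o (fun y : R => M * (y ^+ 2 + 1)^-1)).
    exact: (integrableZl measurableT M (integrable_inv_sqr R)).
  exact: (integrableZl measurableT (x `^ c1) j).
have ih : cintegrable setT (h x).
  have [|j _] := @Cintegral_sum R _ r setT
     (fun l y => (zeta l)%:C * (K l (c1 +i* y) * Cpow (C l * x) (c1 +i* y))) measurableT.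
    by move=> l lr; apply: cintegrableZl => //; exact: int_l.
  exact: j.
apply: le_trans (normc_Cintegral measurableT ih i (fun y _ => HM x y x0)) _.
rewrite RintegralZl//; last exact: (integrableZl measurableT M (integrable_inv_sqr R)).
by rewrite le_eqVlt; apply/orP; left; apply/eqP; ring.
Qed.

Lemma Mellin_Parseval :
  Cintegral `]0, +oo[ (fun x => Cintegral setT (h x) * (x `^ (phi - 1) * W x)%:C) =
  Cintegral setT (fun y => (\sum_(l <- r) (zeta l)%:C * (K l (c1 +i* y) * Cpow (C l) (c1 +i* y)))
    * Mellin W ((c1 + phi) +i* y)).
Proof.
have mpos := @measurable_pos R.
pose H (x y : R) : R[i] := (x `^ (phi - 1) * W x)%:C * h x y.
have mH : cmeasurable setT (fun p : R * R => H p.1 p.2).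
  apply: cmeasurableM; last exact: mh.
  apply: cmeasurable_real; apply: measurable_funM.
    have mp : measurable_fun setT (fun x : R => x `^ (phi - 1)) by exact: measurable_powR.
    exact: (measurableT_comp mp measurable_fst).
  exact: (measurableT_comp mW measurable_fst).
have [M HM] := h_bound.
have ig2 : mu.-integrable setT (EFin \o (fun y : R => M * (y ^+ 2 + 1)^-1)).
  exact: (integrableZl measurableT M (integrable_inv_sqr R)).
have iH : (mu \x mu)%E.-integrable (`]0, +oo[%classic `*` setT) (EFin \o (fun p => normc (H p.1 p.2))).
  apply: (prod_integrable_bound mpos measurableT _ (integrable_norm iW) ig2).
    exact: cmeasurable_normc.
  move=> x y /pos_itv x0 _ /=.
  rewrite ger0_norm ?normc_ge0// normcM normc_real.
  have -> : x `^ (c1 + phi - 1) = x `^ (phi - 1) * x `^ c1.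
    by rewrite -powRD ?(gt_eqF x0) ?implybT//; congr (_ `^ _); ring.
  rewrite mulrAC [`|_ * x `^ c1|]normrM (ger0_norm (powR_ge0 x c1)) -mulrA.
  by rewrite ler_wpM2l// HM.
transitivity (Cintegral `]0, +oo[ (fun x => Cintegral setT (H x))).
  apply: eq_Cintegral => x /pos_itv x0; rewrite mulrC -CintegralZl//.
  have [|j _] := @Cintegral_sum R _ r setT
     (fun l y => (zeta l)%:C * (K l (c1 +i* y) * Cpow (C l * x) (c1 +i* y))) measurableT.
    by move=> l lr; apply: cintegrableZl => //; exact: int_l.
  exact: j.
rewrite (Cfubini mpos measurableT mH iH); apply: eq_Cintegral => y _.
have iM : cintegrable `]0, +oo[ (fun x => Cpow x (((c1 + phi) +i* y) - 1) * (W x)%:C).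
  exact: cintegrable_Mellin.
rewrite /Mellin -CintegralZl//; apply: eq_Cintegral => x /pos_itv x0.
rewrite /H /h mulr_sumr mulr_suml big_seq [RHS]big_seq; apply: eq_bigr => l lr.
rewrite CpowM ?C0//.
have -> : (c1 + phi) +i* y - 1 = (c1 +i* y) + (phi - 1)%:C.
  by apply: complex_ext; rewrite !ReImE /=; ring.
by rewrite [Cpow x (_ + _)]CpowD Cpow_real// rmorphM /=; ring.
Qed.

End Parseval.

End Capacity.

(** * Densities and independence *)

Section Density.
Context d (T : measurableType d) (R : realType).
Variables (mu nu : {measure set T -> \bar R}) (f : T -> R).
Hypotheses (mf : measurable_fun setT f) (f0 : forall x, 0 <= f x).
Hypothesis nuE : forall A, measurable A -> nu A = (\int[mu]_(x in A) (f x)%:E)%E.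

Let integral_density_indic E : measurable E ->
  (\int[nu]_x (\1_E x)%:E = \int[mu]_x ((f x)%:E * (\1_E x)%:E))%E.
Proof.
move=> mE; rewrite integral_indic//= setIT nuE// integral_mkcond.
apply: eq_integral => x _; rewrite patchE indicE; case: ifPn => xE; first by rewrite mule1.
by rewrite mule0.
Qed.

Import HBNNSimple.

Let integral_density_nnsfun (g : {nnsfun T >-> R}) :
  (\int[nu]_x (g x)%:E = \int[mu]_x ((f x)%:E * (g x)%:E))%E.
Proof.
under [LHS]eq_integral do rewrite fimfunE -fsumEFin//.
rewrite [LHS]ge0_integral_fsum//; last 2 first.
  - by move=> r; exact/measurable_EFinP/measurableT_comp.
  - by move=> n x _; rewrite EFinM nnfun_muleindic_ge0.
under [RHS]eq_integral.
  move=> x xD; rewrite fimfunE -fsumEFin// ge0_mule_fsumr; last first.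
    by move=> r; rewrite EFinM nnfun_muleindic_ge0.
  over.
rewrite [RHS]ge0_integral_fsum//; last 2 first.
  - move=> r; apply: emeasurable_funM; first exact/measurable_EFinP.
    by apply/measurable_EFinP; exact: measurableT_comp.
  - move=> n x _; rewrite EFinM mule_ge0//; first by rewrite lee_fin.
    by rewrite nnfun_muleindic_ge0.
apply: eq_fsbigr => r _.
rewrite integralZl_indic_nnsfun//= integral_density_indic//.
have [r0|r0] := ltP r 0.
  rewrite preimage_nnfun0// indic0 integral0_eq; last by move=> x _; rewrite mule0.
  by rewrite mule0 integral0_eq// => x _; rewrite mulr0 mule0.
rewrite -ge0_integralZl//.
- by apply: eq_integral => x _; rewrite EFinM muleCA.
- apply: emeasurable_funM; first exact/measurable_EFinP.
  by apply/measurable_EFinP; exact: measurable_indic.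
- by move=> x _; rewrite mule_ge0// lee_fin.
Qed.

(** Indicators, then simple functions, then monotone limits. *)
Lemma ge0_integral_density (g : T -> \bar R) : measurable_fun setT g -> (forall x, 0 <= g x)%E ->
  (\int[nu]_x g x = \int[mu]_x ((f x)%:E * g x))%E.
Proof.
move=> mg g0; pose g_ := nnsfun_approx measurableT mg.
transitivity (lim (\int[nu]_x (g_ n x)%:E @[n --> \oo])%E).
  rewrite -monotone_convergence//=.
  - apply: eq_integral => ? /[!inE] xD; apply/esym/cvg_lim => //=.
    exact: cvg_nnsfun_approx.
  - by move=> n; exact/measurable_EFinP/measurable_funTS.
  - by move=> n ? _; rewrite lee_fin.
  - by move=> ? _ ? ? mn; rewrite lee_fin; exact/lefP/nd_nnsfun_approx.
rewrite [RHS](_ : _ = lim (\int[mu]_x ((f x)%:E * (g_ n x)%:E) @[n --> \oo])%E).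
  by apply: congr_lim; apply/funext => n /=; exact: integral_density_nnsfun.
rewrite -monotone_convergence//=.
- apply: eq_integral => x /[!inE] xD; apply/esym/cvg_lim => //=.
  by apply: cvgeZl => //; exact: cvg_nnsfun_approx.
- move=> n; apply: emeasurable_funM; first exact/measurable_EFinP.
  exact/measurable_EFinP/measurable_funTS.
- by move=> n x _; rewrite mule_ge0// lee_fin.
- move=> x _ m n mn; rewrite lee_wpmul2l ?lee_fin//; exact/lefP/nd_nnsfun_approx.
Qed.

End Density.

Section JointLaw.
Context d (T : measurableType d) (R : realType) (P : probability T R).
Variables X Y : {RV P >-> R}.

Lemma ge0_expectation_independent (g : R * R -> \bar R) : independent_RV X Y ->
  measurable_fun setT g -> (forall p, 0 <= g p)%E ->
  (\int[P]_w g (X w, Y w) =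
   \int[distribution P X]_x \int[distribution P Y]_y g (x, y))%E.
Proof.
move=> XY mg g0.
have mXY : measurable_fun setT (fun w => (X w, Y w)) by exact: measurable_fun_pair.
have E1 : (\int[P]_w g (X w, Y w) = \int[pushforward P (fun w => (X w, Y w))]_p g p)%E.
  by rewrite ge0_integral_pushforward// => p _; exact: g0.
rewrite E1.
(* By independence the joint law agrees with the product of the marginal laws on rectangles, which
   determines it. *)
rewrite (eq_measure_integral (distribution P X \x distribution P Y)%E).
  by rewrite fubini_tonelli1.
move=> A mA _; apply/esym; by apply: product_measure_unique.
Qed.

End JointLaw.

(** * Kernels of the three models *)

Section Kernels.
Variable R : realType.
Implicit Types (a b : seq R) (s : R[i]).

Local Notation unit_slope a := [seq (u, 1) | u <- a].

(* The shift by [p] is what turns the kernel of the density into a factor of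
   the kernel of the capacity. *)
Definition kernel_regular m n a b := forall (I : set R) (p : R),
  (forall x, I x -> fox_strip m n (unit_slope a) (unit_slope b) (x - p)) ->
  regular I (fun s => foxH_kernel m n (unit_slope a) (unit_slope b) (s - p%:C)) /\
  quadratic_decay (fun s => foxH_kernel m n (unit_slope a) (unit_slope b) (s - p%:C)).

Let N1 : (-1 : R) != 0. Proof. by rewrite oppr_eq0 oner_eq0. Qed.

Let shift_num (u p : R) s : u%:C - 1%:C * (s - p%:C) = (u + p)%:C + (-1)%:C * s.
Proof. by rewrite rmorphD rmorphN /=; ring. Qed.

Let shift_den (u p : R) s : (u + 1)%:C - 1%:C * (s - p%:C) = (u + p)%:C + (-1)%:C * s + 1.
Proof. by rewrite !rmorphD rmorphN /=; ring. Qed.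

Let shift_left (u p : R) s : 1 - u%:C + 1%:C * (s - p%:C) = (1 - u - p)%:C + 1%:C * s.
Proof. by rewrite !rmorphB /=; ring. Qed.

(** The Gamma-Gamma and Málaga laws: the upper parameter, due to the pointing error, exceeds the
    first lower one by 1, so the kernel is two Gammas times 1 / (b1 - s). *)
Lemma kernel_regular_30 (b1 b2 b3 : R) : kernel_regular 3 0 [:: b1 + 1] [:: b1; b2; b3].
Proof.
move=> I p HI.
have hb (u : R) : u \in [:: b1; b2; b3] -> forall x, I x -> 0 < (u + p) + (-1) * x.
  move=> ub x /HI[hI _].
  have ub' : (u, 1 : R) \in [seq (u, 1 : R) | u <- [:: b1; b2; b3]] by rewrite (map_f (fun u : R => (u, 1 : R))).
  by have := hI (u, 1) ub'; rewrite /=; lra.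
have h1 := hb b1; have h2 := hb b2; have h3 := hb b3.
rewrite !inE !eqxx ?orbT /= in h1 h2 h3.
have {}h1 := h1 isT; have {}h2 := h2 isT; have {}h3 := h3 isT.
pose F s := Gamma ((b2 + p)%:C + (-1)%:C * s) * Gamma ((b3 + p)%:C + (-1)%:C * s)
  * ((b1 + p)%:C + (-1)%:C * s)^-1.
(* Used with [I] for regularity, and with the empty set for the decay, which concerns points off the
   real axis. *)
have FE J : (forall x, J x -> 0 < (b1 + p) + (-1) * x) -> forall s, Im s != 0 \/ J (Re s) ->
    F s = foxH_kernel 3 0 (unit_slope [:: b1 + 1]) (unit_slope [:: b1; b2; b3]) (s - p%:C).
  move=> HJ s Hs; rewrite /foxH_kernel /= !big_cons !big_nil shift_den !shift_num /F.
  rewrite -(Gamma_ratio (slit_neq0 N1 HJ Hs)) !mulr1; ring.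
split.
  apply: (eq_regular (FE I h1)); apply: regularM; last exact: regular_inv_affine.
  by apply: regularM; exact: regular_Gamma.
apply: (@eq_decay _ F).
  by move=> s s0; apply: (FE set0) => //; left.
apply: decayM; last exact: bounded_inv_affine.
by apply: decayM; [exact: decay_Gamma|apply: decay_bounded; exact: decay_Gamma].
Qed.

(** The Fisher-Snedecor law. Here [a1] contributes a numerator Gamma whose poles lie on the left, so
    the strip is bounded on both sides. *)
Lemma kernel_regular_21 (a1 b1 b2 : R) : kernel_regular 2 1 [:: a1; b2 + 1] [:: b1; b2].
Proof.
move=> I p HI.
have h1 x : I x -> 0 < (b1 + p) + (-1) * x.
  by move=> /HI[+ _] => /(_ (b1, 1)); rewrite /= !inE eqxx => /(_ isT); lra.
have h2 x : I x -> 0 < (b2 + p) + (-1) * x.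
  by move=> /HI[+ _] => /(_ (b2, 1)); rewrite /= !inE eqxx orbT => /(_ isT); lra.
have h3 x : I x -> 0 < (1 - a1 - p) + 1 * x.
  by move=> /HI[_ +] => /(_ (a1, 1)); rewrite /= !inE eqxx => /(_ isT); lra.
have n1 : (1 : R) != 0 by exact: oner_neq0.
pose F s := Gamma ((b1 + p)%:C + (-1)%:C * s) * Gamma ((1 - a1 - p)%:C + 1%:C * s)
  * ((b2 + p)%:C + (-1)%:C * s)^-1.
have FE J : (forall x, J x -> 0 < (b2 + p) + (-1) * x) -> forall s, Im s != 0 \/ J (Re s) ->
    F s = foxH_kernel 2 1 (unit_slope [:: a1; b2 + 1]) (unit_slope [:: b1; b2]) (s - p%:C).
  move=> HJ s Hs; rewrite /foxH_kernel /= !big_cons !big_nil shift_den !shift_num shift_left /F.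
  rewrite -(Gamma_ratio (slit_neq0 N1 HJ Hs)) !mulr1; ring.
split.
  apply: (eq_regular (FE I h2)); apply: regularM; last exact: regular_inv_affine.
  by apply: regularM; exact: regular_Gamma.
apply: (@eq_decay _ F).
  by move=> s s0; apply: (FE set0) => //; left.
apply: decayM; last exact: bounded_inv_affine.
by apply: decayM; [exact: decay_Gamma|apply: decay_bounded; exact: decay_Gamma].
Qed.

Lemma prod_nseq (T : Type) k (c : T) (F : T -> R[i]) : \prod_(u <- nseq k c) F u = F c ^+ k.
Proof. by elim: k => [|k IH]; rewrite ?big_nil ?expr0 //= big_cons IH exprS. Qed.

(** * The kernel of the capacity *)

Section CapacityKernel.
Variables (m n k : nat) (a b : seq R) (phi v r : R).
Hypotheses (mb : (m <= size b)%N) (na : (n <= size a)%N) (k0 : (0 < k)%N).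
Hypotheses (r0 : 0 < r) (okK : kernel_regular m n a b).

Let a' := [seq (phi + u, 1) | u <- take n a] ++ [:: (0, r); (1, r)] ++
  ([seq (phi + u, 1) | u <- drop n a] ++ nseq k (v + 1, 1)).
Let b' := ([seq (phi + u, 1) | u <- take m b] ++ nseq k (v, 1)) ++ [:: (0, r); (0, r)] ++
  [seq (phi + u, 1) | u <- drop m b].

Let tb : take (m + k + 2) b' = ([seq (phi + u, 1) | u <- take m b] ++ nseq k (v, 1)) ++ [:: (0, r); (0, r)].
Proof. by rewrite /b' catA take_size_cat// !size_cat size_map size_takel// size_nseq. Qed.

Let db : drop (m + k + 2) b' = [seq (phi + u, 1) | u <- drop m b].
Proof. by rewrite /b' catA drop_size_cat// !size_cat size_map size_takel// size_nseq. Qed.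

(** The order n + 1 cuts the upper row between (0, r) and (1, r): the former goes to the numerator,
    the latter to the denominator. *)
Let a'E : a' = ([seq (phi + u, 1) | u <- take n a] ++ [:: (0, r)]) ++
  (1, r) :: ([seq (phi + u, 1) | u <- drop n a] ++ nseq k (v + 1, 1)).
Proof. by rewrite /a' -catA. Qed.

Let ta : take (n + 1) a' = [seq (phi + u, 1) | u <- take n a] ++ [:: (0, r)].
Proof.
rewrite a'E.
by rewrite take_size_cat// !size_cat size_map size_takel.
Qed.

Let da : drop (n + 1) a' = (1, r) :: ([seq (phi + u, 1) | u <- drop n a] ++ nseq k (v + 1, 1)).
Proof.
rewrite a'E.
by rewrite drop_size_cat// !size_cat size_map size_takel.
Qed.

Lemma capacity_slopes_b u : u \in take (m + k + 2) b' -> 0 < u.2.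
Proof.
rewrite tb !mem_cat => /orP[/orP[/mapP[w _ ->]//|/nseqP[-> _]//]|].
by rewrite !inE orbb => /eqP ->.
Qed.

Lemma capacity_slopes_a u : u \in take (n + 1) a' -> 0 < u.2.
Proof. by rewrite ta mem_cat => /orP[/mapP[w _ ->]//|]; rewrite inE => /eqP ->. Qed.

Lemma capacity_stripP x : fox_strip (m + k + 2) (n + 1) a' b' x <->
  [/\ fox_strip m n (unit_slope a) (unit_slope b) (x - phi), x < v, r * x < 0 & -1 < r * x].
Proof.
rewrite /fox_strip /= tb ta -!map_take; split=> [[hb ha]|[[hb ha] xv rx0 rx1]].
- split.
  + split=> u /mapP[w wb ->] /=.
      have := hb (phi + w, 1); rewrite !mem_cat map_f//= => /(_ isT); lra.
    have := ha (phi + w, 1); rewrite !mem_cat map_f//= => /(_ isT); lra.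
  + by have := hb (v, 1); rewrite !mem_cat mem_nseq k0 eqxx orbT /= => /(_ isT); lra.
  + by have := hb (0, r); rewrite !mem_cat !inE eqxx !orbT => /(_ isT).
  + by have := ha (0, r); rewrite !mem_cat !inE eqxx !orbT => /(_ isT) /=; lra.
- split=> u; rewrite !mem_cat.
  + move=> /orP[/orP[/mapP[w wb ->]|/nseqP[-> _]]|]; rewrite /=.
    * by have := hb (w, 1); rewrite map_f//= => /(_ isT); lra.
    * by rewrite mul1r.
    * by rewrite !inE orbb => /eqP ->.
  + move=> /orP[/mapP[w wb ->]|]; rewrite /=.
      by have := ha (w, 1); rewrite map_f//= => /(_ isT); lra.
    by rewrite inE => /eqP -> /=; lra.
Qed.

(** Each new reciprocal Gamma meets its partner: (v + 1, 1) goes with (v, 1), and (1, r) with one of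
    the two lower pairs (0, r). The other lower pair and the upper (0, r) remain, as in the Mellin
    transform of ln (1 + x) at r s. *)
Lemma capacity_kernelE s : foxH_kernel (m + k + 2) (n + 1) a' b' s =
  foxH_kernel m n (unit_slope a) (unit_slope b) (s - phi%:C)
  * (Gamma (v%:C - s) / Gamma (v%:C - s + 1)) ^+ k
  * (Gamma (0%:C + (- r)%:C * s) * Gamma (1%:C + r%:C * s)
     * (Gamma (0%:C + (- r)%:C * s) / Gamma (0%:C + (- r)%:C * s + 1))).
Proof.
have e1 (u : R) : (phi + u)%:C - 1%:C * s = u%:C - 1%:C * (s - phi%:C) by rewrite rmorphD /=; ring.
have e2 (u : R) : 1 - (phi + u)%:C + 1%:C * s = 1 - u%:C + 1%:C * (s - phi%:C) by rewrite rmorphD /=; ring.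
rewrite /foxH_kernel tb ta db da -!map_take -!map_drop !big_cat !big_cons !big_nil big_cat !big_map !prod_nseq /=.
under eq_bigr do rewrite e1; under [X in _ * (X * _) / _]eq_bigr do rewrite e2.
under [X in _ / (_ * (X * _) * _)]eq_bigr do rewrite e1.
under [X in _ / (_ * X)]eq_bigr do rewrite e2.
have -> : v%:C - 1%:C * s = v%:C - s by rewrite mul1r.
have -> : (v + 1)%:C - 1%:C * s = v%:C - s + 1 by rewrite rmorphD /=; ring.
have -> : 0%:C - r%:C * s = 0%:C + (- r)%:C * s by rewrite rmorphN /=; ring.
have -> : 1%:C - r%:C * s = 0%:C + (- r)%:C * s + 1 by rewrite rmorphN /=; ring.
have -> : 1 - 0%:C + r%:C * s = 1%:C + r%:C * s by rewrite /=; ring.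
set P1 := \prod_(i <- take m b) _; set P2 := \prod_(i <- take n a) _.
set P3 := \prod_(i <- drop n a) _; set P4 := \prod_(i <- drop m b) _.
move: P1 P2 P3 P4 (Gamma (v%:C - s)) (Gamma (v%:C - s + 1)) => P1 P2 P3 P4 g g'.
move: (Gamma (0%:C + _)) (Gamma (1%:C + _)) (Gamma (_ + 1)) => q q1 q'.
rewrite expr_div_n !mulr1 !invfM.
move: P3^-1 P4^-1 (g' ^+ k)^-1 (g ^+ k) q'^-1 => i1 i2 i3 i4 i5; ring.
Qed.

Let F s := foxH_kernel m n (unit_slope a) (unit_slope b) (s - phi%:C)
  * ((v%:C + (-1)%:C * s)^-1) ^+ k
  * (Gamma (0%:C + (- r)%:C * s) * Gamma (1%:C + r%:C * s) * (0%:C + (- r)%:C * s)^-1).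

Let rN0 : - r != 0. Proof. by rewrite oppr_eq0 gt_eqF. Qed.
Let rn0 : r != 0. Proof. by rewrite gt_eqF. Qed.

(** The set [J] allows three uses: the strip of the capacity, the empty set for points off the real
    axis, and the points of the line of integration. *)
Lemma capacity_kernel_slit (J : set R) s : (forall x, J x -> x < v /\ r * x < 0) ->
  Im s != 0 \/ J (Re s) -> foxH_kernel (m + k + 2) (n + 1) a' b' s = F s.
Proof.
move=> HJ Hs.
have J1 x : J x -> 0 < v + (-1) * x by move=> /HJ[]; lra.
have J2 x : J x -> 0 < 0 + (- r) * x by move=> /HJ[]; rewrite mulNr; lra.
rewrite capacity_kernelE /F (Gamma_ratio (slit_neq0 rN0 J2 Hs)).
have e : v%:C - s = v%:C + (-1)%:C * s by rewrite rmorphN /= mulN1r.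
by rewrite e (Gamma_ratio (slit_neq0 N1 J1 Hs)).
Qed.

Lemma capacity_kernel_regular :
  regular (fox_strip (m + k + 2) (n + 1) a' b') (foxH_kernel (m + k + 2) (n + 1) a' b') /\
  quadratic_decay (foxH_kernel (m + k + 2) (n + 1) a' b').
Proof.
set I := fox_strip _ _ _ _.
have HI x : I x -> x < v /\ r * x < 0 by move=> /capacity_stripP[].
have [rK dK] := okK (fun x (Ix : I x) => let: And4 h _ _ _ := (capacity_stripP x).1 Ix in h).
split.
  apply: (eq_regular (F := F)); first by move=> s Hs; rewrite (capacity_kernel_slit HI Hs).
  apply: regularM; first apply: regularM => //.
    by apply: regularX; apply: regular_inv_affine => // x /HI[]; lra.
  have h x : I x -> 0 < 0 + (- r) * x by move=> /HI[]; rewrite mulNr; lra.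
  apply: regularM; last exact: regular_inv_affine.
  apply: regularM; first exact: regular_Gamma.
  by apply: regular_Gamma => // x /capacity_stripP[]; lra.
apply: (eq_decay (F := F)).
  by move=> s s0; rewrite (@capacity_kernel_slit set0)//; left.
apply: decayM; first apply: decayM => //.
  by apply: bounded_stripsX; exact: bounded_inv_affine.
apply: bounded_stripsM; last exact: bounded_inv_affine.
by apply: bounded_stripsM; apply: decay_bounded; exact: decay_Gamma.
Qed.

End CapacityKernel.

(** What the computation of the capacity uses of a model. The kernel of the density is evaluated at
    s - phi, so the line Re s = -1/2 of the capacity has abscissa -1/2 - phi there. *)
Definition tp_regular (pr : tp_params R) (l : nat) :=
  [/\ 0 < tp_C pr l, (tp_m pr <= size (tp_b pr l))%N, (tp_n pr <= size (tp_a pr l))%N,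
    kernel_regular (tp_m pr) (tp_n pr) (tp_a pr l) (tp_b pr l) &
    fox_strip (tp_m pr) (tp_n pr) (unit_slope (tp_a pr l)) (unit_slope (tp_b pr l)) (- 2^-1 - tp_phi pr)].

Lemma tp_model_regular pr l : tp_model pr -> (1 <= l < (tp_P pr).+1)%N -> tp_regular pr l.
Proof.
case=> [al be rho A0 al0 be0 rho0 A00|al be g Om rho A0 al0 be0 g0 Om0 rho0 A00|al be rho A0 al0 be0 rho0 A00] /andP[l1 lP];
  have rho20 : 0 < rho ^+ 2 by rewrite exprn_gt0.
- split => //=; first by rewrite divr_gt0// mulr_gt0.
    by have := @kernel_regular_30 (rho ^+ 2 - 1) (al - 1) (be - 1); rewrite subrK.
  split => [u|u]; last by rewrite in_nil.
  by rewrite !inE => /or3P[] /eqP -> /=; lra.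
- have be1 : (0 : R) < be%:R by rewrite ltr0n.
  have l0 : (0 : R) < l%:R by rewrite ltr0n.
  split => //=; first by rewrite divr_gt0 ?mulr_gt0 ?addr_gt0 ?mulr_gt0.
    exact: kernel_regular_30.
  split => [u|u]; last by rewrite in_nil.
  by rewrite !inE => /or3P[] /eqP -> /=; lra.
- split => //=; first by rewrite divr_gt0// mulr_gt0// subr_gt0.
    by have := @kernel_regular_21 (- be) (al - 1) (rho ^+ 2 - 1); rewrite subrK.
  split => u.
    by rewrite !inE => /orP[] /eqP -> /=; lra.
  by rewrite !inE => /eqP -> /=; lra.
Qed.

End Kernels.

(** * The capacity *)

Section CapacityFormula.
Variable R : realType.
Local Notation mu := (@lebesgue_measure R).
Local Notation unit_slope a := [seq (u, 1) | u <- a].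

Lemma Gamma_pos (z : R[i]) : 0 < Re z -> Gamma z = Gamma_Euler z.
Proof.
by move=> z0; rewrite (@GammaE _ 0) ?addr0// /Gamma_shifted big_ord0 divr1 addr0.
Qed.

Lemma Cpow_inv (x : R) (z : R[i]) : 0 < x -> Cpow (1 / x) z = Cpow x (- z).
Proof. by move=> x0; rewrite !CpowE div1r lnV ?posrE// rmorphN /= mulrN mulNr. Qed.

Variables (pr : tp_params R) (v : R) (k t : nat) (lam : R) (f : R -> R).
Hypothesis regpr : forall l, (1 <= l < (tp_P pr).+1)%N -> tp_regular pr l.
Hypotheses (v0 : 0 < v) (k0 : (0 < k)%N) (t0 : (0 < t)%N) (lam0 : 0 < lam).
Hypotheses (mf : measurable_fun setT f)
  (fE : forall x : R, 0 < x -> (f x)%:C = tp_density_expr pr x).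
Hypotheses (mw : measurable_fun setT (fog_density v k)) (w0 : forall y, 0 <= fog_density v k y).

Local Notation phi := (tp_phi pr).
Local Notation m := (tp_m pr).
Local Notation n := (tp_n pr).
Local Notation C := (tp_C pr).
Local Notation W := (fog_gain lam t%:R v k).
Local Notation a' l := (V1 pr l ++ [:: (0, t%:R^-1); (1, t%:R^-1)] ++ V2 pr v k l).
Local Notation b' l := (V3 pr v k l ++ [:: (0, t%:R^-1); (0, t%:R^-1)] ++ V4 pr l).

Let rr := index_iota 1 (tp_P pr).+1.
(* On this line all the strips of the three models and of the capacity meet. *)
Let c0 : R := - 2^-1.
Let c1 := c0 - phi.
Let K l := foxH_kernel m n (unit_slope (tp_a pr l)) (unit_slope (tp_b pr l)).
Let q := tp_psi pr / (2 * pi).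

Let reg l : l \in rr -> tp_regular pr l.
Proof. by rewrite mem_index_iota; exact: regpr. Qed.

Let tau0 : (0 : R) < t%:R. Proof. by rewrite ltr0n. Qed.
Let tau1 : (1 : R) <= t%:R. Proof. by rewrite ler1n. Qed.
Let r0 : (0 : R) < t%:R^-1. Proof. by rewrite invr_gt0. Qed.
Let r1 : t%:R^-1 <= (1 : R). Proof. by rewrite invf_le1. Qed.
Let c1phi : c1 + phi = c0. Proof. by rewrite /c1 subrK. Qed.
Let pi2 : 2 * pi != 0 :> R. Proof. by rewrite mulf_neq0// gt_eqF// pi_gt0. Qed.

Let C0 l : l \in rr -> 0 < C l. Proof. by move=> /reg[]. Qed.

Let regK l : l \in rr ->
  regular (fox_strip m n (unit_slope (tp_a pr l)) (unit_slope (tp_b pr l))) (K l) /\ quadratic_decay (K l).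
Proof.
move=> /reg[_ _ _ ok _].
have E : (fun s => K l (s - 0%:C)) = K l by apply/funext => s; rewrite subr0.
have [|r2 d2] := ok (fox_strip m n (unit_slope (tp_a pr l)) (unit_slope (tp_b pr l))) 0.
  by move=> x; rewrite subr0.
by rewrite -E.
Qed.

Let strip_c1 l : l \in rr -> fox_strip m n (unit_slope (tp_a pr l)) (unit_slope (tp_b pr l)) c1.
Proof. by move=> /reg[]. Qed.

Let cK l : l \in rr -> forall y : R, {for y, continuous (fun y : R => K l (c1 +i* y))}.
Proof. by move=> lr; have [rK dK] := regK lr; have [] := regular_line rK dK (strip_c1 lr). Qed.

Let bK l : l \in rr -> exists M : R, forall y : R, normc (K l (c1 +i* y)) <= M * (y ^+ 2 + 1)^-1.
Proof. by move=> lr; have [rK dK] := regK lr; have [] := regular_line rK dK (strip_c1 lr). Qed.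

Let mW : measurable_fun setT W. Proof. exact: measurable_fog_gain. Qed.

Let c0t : - t%:R < c0. Proof. by rewrite /c0; move: tau1; lra. Qed.
Let c00 : c0 < 0. Proof. by rewrite /c0; lra. Qed.

Let iW : mu.-integrable `]0, +oo[ (EFin \o (fun x => x `^ (c1 + phi - 1) * W x)).
Proof. by rewrite c1phi; exact: fog_gain_integrable. Qed.

Let h (x y : R) := \sum_(l <- rr) (tp_zeta pr l)%:C * (K l (c1 +i* y) * Cpow (C l * x) (c1 +i* y)).

Let meijerE l (x : R) : l \in rr -> 0 < x ->
  meijerG m n (tp_a pr l) (tp_b pr l) (C l * x) =
  Cintegral setT (fun y => K l (c1 +i* y) * Cpow (C l * x) (c1 +i* y)) / (2 * pi)%:C.
Proof.
move=> lr x0; have [rK dK] := regK lr.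
apply: foxH_line => //; [| |exact: strip_c1|by rewrite mulr_gt0 ?C0].
- by move=> u /mem_take /mapP[w _ ->].
- by move=> u /mem_take /mapP[w _ ->].
Qed.

Let densityE (x : R) : 0 < x ->
  (f x)%:C = q%:C * ((x `^ (phi - 1))%:C * Cintegral setT (h x)).
Proof.
move=> x0; rewrite fE// /tp_density_expr -(@line_sum R rr K C (tp_zeta pr) c1 C0 cK bK x x0).
rewrite -/rr mulr_sumr [in RHS]mulrA mulr_sumr big_seq [RHS]big_seq; apply: eq_bigr => l lr.
have qE : q%:C = (tp_psi pr)%:C * ((2 * pi)%:C)^-1 by rewrite /q rmorphM fmorphV.
rewrite meijerE// qE rmorphM /=.
move: (((2 * pi)%:C)^-1) (tp_psi pr)%:C (x `^ (phi - 1))%:C (tp_zeta pr l)%:C => i1 i2 i3 i4; ring.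
Qed.

(** The density is at most a constant times x^(c1 + phi - 1), because its line integral is O(x^c1);
    the claim thus follows from convergence of the Mellin integral of [W] at [c0]. *)
Lemma capacity_integrable : mu.-integrable `]0, +oo[ (EFin \o (fun x => f x * W x)).
Proof.
have [A HA] := @line_sum_bound R rr K C (tp_zeta pr) c1 C0 cK bK.
have i : mu.-integrable `]0, +oo[ (EFin \o (fun x => (`|q| * A) * (x `^ (c1 + phi - 1) * W x))).
  by apply: (integrableZl _ (`|q| * A) iW); exact: measurable_pos.
apply: (le_Rintegrable (@measurable_pos R) _ i); first exact: measurable_funM.
move=> x /pos_itv x0; have W0 : 0 <= W x by exact: fog_gain_ge0.
rewrite normrM (ger0_norm W0) mulrA ler_wpM2r// -normc_real densityE//.
rewrite (normcM q%:C) (normcM (x `^ (phi - 1))%:C) !normc_real.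
rewrite (ger0_norm (powR_ge0 _ _)) -mulrA ler_wpM2l//.
have -> : x `^ (c1 + phi - 1) = x `^ (phi - 1) * x `^ c1.
  by rewrite -powRD ?(gt_eqF x0) ?implybT//; congr (_ `^ _); ring.
by rewrite [leRHS]mulrCA ler_wpM2l ?powR_ge0// HA.
Qed.

(** Collects what the kernels leave over: [C l] to the power - phi from the shift by phi, v^k from
    the fog and 1 / t from the rescaling of the variable. *)
Let kappa l := tp_zeta pr l * C l `^ (- phi) * (v ^+ k / t%:R).
Let K' l := foxH_kernel (m + k + 2) (n + 1) (a' l) (b' l).
Let X l := C l * (1 / lam) `^ t%:R^-1.

Let X0 l : l \in rr -> 0 < X l.
Proof. by move=> lr; rewrite mulr_gt0 ?C0// powR_gt0// divr_gt0. Qed.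

Let strip_c0 l : l \in rr -> fox_strip (m + k + 2) (n + 1) (a' l) (b' l) c0.
Proof.
move=> lr; have [_ mb na ok st] := reg lr.
apply/(capacity_stripP _ _ _ mb na k0); split => //.
- by apply: lt_trans v0.
- by rewrite pmulr_rlt0.
- by have : t%:R^-1 * 2^-1 <= 1 * 2^-1 :> R; [rewrite ler_wpM2r|rewrite /c0; lra].
Qed.

Let regK' l : l \in rr -> regular (fox_strip (m + k + 2) (n + 1) (a' l) (b' l)) (K' l) /\ quadratic_decay (K' l).
Proof. by move=> /reg[_ mb na ok _]; exact: capacity_kernel_regular. Qed.

Let integrandE l (y : R) : l \in rr ->
  (tp_zeta pr l)%:C * (K l (c1 +i* y) * Cpow (C l) (c1 +i* y)) * Mellin W ((c1 + phi) +i* y) =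
  (kappa l)%:C * (K' l (c0 +i* y) * Cpow (X l) (c0 +i* y)).
Proof.
move=> lr; rewrite c1phi; set s := c0 +i* y.
have [Cl mb na ok st] := reg lr.
have res : Re s = c0 by [].
rewrite Mellin_fog_gain// Mellin_log_gain//.
have HJ (x : R) : [set x : R | x < v /\ t%:R^-1 * x < 0] x -> x < v /\ t%:R^-1 * x < 0 by [].
(* The point may be real (y = 0), so the membership goes through its real part. *)
have Hs : Im s != 0 \/ [set x : R | x < v /\ t%:R^-1 * x < 0] (Re s).
  by right; rewrite res; split; [exact: lt_trans v0|rewrite pmulr_rlt0].
have KE := @capacity_kernel_slit R m n k (tp_a pr l) (tp_b pr l) phi v t%:R^-1 mb na r0 _ s HJ Hs.
rewrite [K' l s]KE.
pose z := s / (t%:R : R)%:C.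
have zE : (t%:R^-1 : R)%:C * s = z by rewrite /z fmorphV mulrC.
have rez : Re z = t%:R^-1 * c0 by rewrite -zE ReM /= mul0r subr0.
have NzE : (0 : R)%:C + (- (t%:R^-1 : R))%:C * s = - z by rewrite rmorphN mulNr zE add0r.
rewrite NzE zE -/z.
have z1 : 0 < Re (1 + z).
  rewrite ReD rez; have -> : Re (1 : R[i]) = 1 by [].
  by have : t%:R^-1 * 2^-1 <= 1 * 2^-1 :> R; [rewrite ler_wpM2r|rewrite /c0; lra].
have z2 : 0 < Re (- z) by rewrite ReN rez oppr_gt0 pmulr_rlt0.
rewrite !Gamma_pos//.
have -> : s - phi%:C = c1 +i* y by apply: complex_ext; rewrite /s /c1 !ReImE /=; ring.
rewrite /X CpowM ?powR_gt0 ?divr_gt0// Cpow_powR zE Cpow_inv//.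
have -> : Cpow (C l) (c1 +i* y) = Cpow (C l) s * (C l `^ (- phi))%:C.
  rewrite -Cpow_real// -CpowD; congr Cpow.
  by apply: complex_ext; rewrite /s /c1 !ReImE /=; ring.
have -> : v%:C + (-1)%:C * s = v%:C - s by rewrite rmorphN /= mulN1r.
have -> : (1 : R)%:C + z = 1 + z by [].
rewrite expr_div_n -exprVn -rmorphXn /kappa !rmorphM /=.
move: (Gamma_Euler (1 + z)) (Gamma_Euler (- z)) ((- z)^-1) ((v%:C - s)^-1 ^+ k) => g1 g2 g3 g4.
rewrite /K; move: (Cpow lam _) (Cpow _ s) (foxH_kernel _ _ _ _ _) (t%:R^-1)%:C => g5 g6 g7 g8; ring.
Qed.

Theorem tp_capacity :
  (Rintegral mu `]0, +oo[ (fun x => f x * W x))%:C =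
  (tp_psi pr * v ^+ k / t%:R)%:C * \sum_(1 <= l < (tp_P pr).+1)
    (tp_zeta pr l * C l `^ (- phi))%:C *
    foxH (m + k + 2) (n + 1) (a' l) (b' l) (C l * (1 / lam) `^ t%:R^-1).
Proof.
have mpos := @measurable_pos R.
have psiE : tp_psi pr = q * (2 * pi) by rewrite /q divfK.
rewrite -Cintegral_real.
(* Integrability of the line integral against [W] is deduced below from that of [f x * W x] by
   dividing by [q], so the case q = 0 is settled apart. *)
have [q0|q0] := eqVneq q 0.
  rewrite psiE q0 !mul0r (@eq_Cintegral _ _ _ (fun=> 0)).
    by rewrite /Cintegral /= /Rintegral integral0.
  by move=> x /pos_itv x0; rewrite rmorphM /= densityE// q0 !mul0r.
have qC0 : q%:C != 0 by rewrite (inj_eq (@complexI R)).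
have E1 (x : R) : `]0, +oo[%classic x ->
    (f x * W x)%:C = q%:C * (Cintegral setT (h x) * (x `^ (phi - 1) * W x)%:C).
  by move=> /pos_itv x0; rewrite rmorphM /= densityE// [(_ * W x)%:C]rmorphM /=; ring.
have ifW : cintegrable `]0, +oo[ (fun x => (f x * W x)%:C).
  by split; [exact: capacity_integrable|exact: integrable0].
have iq : cintegrable `]0, +oo[ (fun x => Cintegral setT (h x) * (x `^ (phi - 1) * W x)%:C).
  apply: (eq_cintegrable mpos _ (cintegrableZl q%:C^-1 mpos ifW)) => x /E1 ->.
  by rewrite mulrA mulVf// mul1r.
rewrite (eq_Cintegral E1) CintegralZl//.
rewrite (@Mellin_Parseval R rr K C (tp_zeta pr) c1 phi W C0 cK bK mW iW).
have [|_ S] := @Cintegral_sum R _ rr setT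
    (fun l y => (kappa l)%:C * (K' l (c0 +i* y) * Cpow (X l) (c0 +i* y))) measurableT.
  move=> l lr; have [rK dK] := regK' lr.
  by apply: cintegrableZl => //; exact: (fox_line_integrable (strip_c0 lr) (X0 lr) rK dK).
transitivity (q%:C * \sum_(l <- rr) Cintegral setT
    (fun y => (kappa l)%:C * (K' l (c0 +i* y) * Cpow (X l) (c0 +i* y)))).
  congr (_ * _); rewrite -S; apply: eq_Cintegral => y _.
  by rewrite mulr_suml big_seq [RHS]big_seq; apply: eq_bigr => l lr; exact: integrandE.
rewrite -/rr !mulr_sumr big_seq [RHS]big_seq; apply: eq_bigr => l lr.
have [rK dK] := regK' lr; have [_ mb na _ _] := reg lr.
have pb := capacity_slopes_b mb r0; have pa := capacity_slopes_a na r0.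
rewrite (CintegralZl _ measurableT (fox_line_integrable (strip_c0 lr) (X0 lr) rK dK)).
rewrite (foxH_line (pb k phi v) (pa k phi v) (strip_c0 lr) (X0 lr) rK dK).
have cst : q * kappa l = (tp_psi pr * v ^+ k / t%:R) * (tp_zeta pr l * C l `^ (- phi)) * (2 * pi)^-1.
  by rewrite /q /kappa; move: ((2 * pi)^-1 : R) (t%:R^-1 : R) => i1 i2; ring.
rewrite mulrA -rmorphM cst (rmorphM _ (_ * _) (2 * pi)^-1) fmorphV rmorphM /=.
by rewrite -!mulrA [X in _ * (_ * X)]mulrC.
Qed.

End CapacityFormula.

(** * From the expectation to an integral against the density *)

Section Expectation.
Context d (T : measurableType d) (R : realType) (P : probability T R).
Local Notation mu := (@lebesgue_measure R).

Lemma ae_pos_density (X : {RV P >-> R}) (f : R -> R) : has_density X f ->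
  (forall x, x <= 0 -> f x = 0) -> {ae P, forall w, 0 < X w}.
Proof.
move=> [mf f0 Xf] fneg; exists (X @^-1` `]-oo, 0]); split.
- by rewrite -[X in measurable X]setTI; exact: (@measurable_funPT _ _ _ _ X).
- have -> : P (X @^-1` `]-oo, 0]) = distribution P X `]-oo, 0] by [].
  rewrite Xf; last exact: measurable_itv.
  by apply: integral0_eq => x; rewrite /= in_itv/= => x0; rewrite fneg.
- by move=> w /= /negP; rewrite -leNgt in_itv.
Qed.

Lemma ge0_integral_distribution_density (X : {RV P >-> R}) (f : R -> R) (g : R -> \bar R) :
  has_density X f -> measurable_fun setT g -> (forall x, 0 <= g x)%E ->
  (\int[distribution P X]_x g x = \int[mu]_x ((f x)%:E * g x))%E.
Proof.
move=> [mf f0 Xf] mg g0.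
(* [mu] and [distribution P X] carry different displays on the same sigma-algebra. *)
pose X' : T -> measurableTypeR R := X.
have mX : measurable_fun setT X' by exact: (@measurable_funPT _ _ _ _ X).
have mf' : measurable_fun setT (f : measurableTypeR R -> R) by exact: mf.
have mg' : measurable_fun setT (g : measurableTypeR R -> \bar R) by exact: mg.
have E1 : (\int[distribution P X]_x g x = \int[P]_w (g \o X) w)%E.
  by rewrite ge0_integral_distribution.
have E2 : (\int[pushforward P X']_x g x = \int[P]_w (g \o X) w)%E.
  by rewrite ge0_integral_pushforward// => y _; exact: g0.
have nuE (A : set (measurableTypeR R)) : measurable A ->
    pushforward P X' A = (\int[mu]_(x in A) (f x)%:E)%E.
  by move=> mA; exact: (Xf A mA).
have key := @ge0_integral_density _ (measurableTypeR R) R (@lebesgue_measure R) (pushforward P X') f mf' f0.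
by rewrite E1 -E2; exact: (key mX nuE g mg' g0).
Qed.

(** All integrands are nonnegative, so independence and the densities give an identity in the
    extended reals; integrability of f W then makes its value a real number. *)
Lemma capacity_expectation (X Y : {RV P >-> R}) (f : R -> R) (v lam : R) (k t : nat) :
  0 < v -> (0 < k)%N -> (0 < t)%N -> 0 < lam -> independent_RV X Y ->
  has_density X f -> has_density Y (fog_density v k) -> (forall x, x <= 0 -> f x = 0) ->
  mu.-integrable `]0, +oo[ (EFin \o (fun x => f x * fog_gain lam t%:R v k x)) ->
  ('E_P[fun w => log2 (1 + lam * (X w * Y w) ^+ t)] =
   ((ln 2)^-1 * Rintegral mu `]0, +oo[ (fun x => f x * fog_gain lam t%:R v k x))%:E)%E.
Proof.
move=> v0 k0 t0 lam0 XY Xf Yw fneg ifW.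
have tau0 : (0 : R) < t%:R by rewrite ltr0n.
have aX := ae_pos_density Xf fneg.
have aY : {ae P, forall w, 0 < Y w}.
  apply: (ae_pos_density Yw) => y y0; apply: fog_density0.
  by move=> /unit_itv[]; rewrite ltNge y0.
have [mf f0 Xd] := Xf; have [mw w0 Yd] := Yw.
have l20 : 0 <= (ln 2 : R)^-1 by rewrite invr_ge0 ln_ge0// ler1n.
(* Agrees with the logarithm of the statement where both gains are positive, hence almost surely,
   and is nonnegative everywhere, as Tonelli's theorem asks. *)
pose Psi (p : R * R) := (ln 2)^-1 * log_gain lam t%:R (p.1 * p.2).
have Psi0 p : 0 <= Psi p by rewrite mulr_ge0// log_gain_ge0.
have mPsi : measurable_fun setT Psi.
  apply: measurable_funM => //.
  have mL : measurable_fun setT (log_gain lam (t%:R : R)) by exact: measurable_log_gain.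
  apply: (measurableT_comp mL).
  by apply: measurable_funM; [exact: measurable_fst|exact: measurable_snd].
have mX : measurable_fun setT X by exact: (@measurable_funPT _ _ _ _ X).
have mY : measurable_fun setT Y by exact: (@measurable_funPT _ _ _ _ Y).
have mXY : measurable_fun setT (fun w => (X w, Y w)) by exact: measurable_fun_pair.
rewrite unlock.
transitivity (\int[P]_w (EFin \o Psi) (X w, Y w))%E.
  apply: ae_eq_integral => //.
  - apply/measurable_EFinP; rewrite /log2; apply: measurable_funM => //.
    apply: (measurableT_comp (@measurable_ln R)); apply: measurable_funD => //.
    by apply: measurable_funM => //; apply: measurable_funX; exact: measurable_funM.
  - by apply/measurable_EFinP; exact: (measurableT_comp mPsi mXY).
  - apply: filterS2 aX aY => w Xw Yw' _ /=; congr (_%:E).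
    rewrite /log2 /Psi /log_gain /= mulrC; congr (_ * ln (1 + lam * _)).
    by rewrite gtr0_norm ?mulr_gt0// powR_mulrn// mulr_ge0 ?ltW.
rewrite (ge0_expectation_independent (g := EFin \o Psi) XY); last 2 first.
- exact/measurable_EFinP.
- by move=> p; rewrite lee_fin.
have inner x : (\int[distribution P Y]_y (EFin \o Psi) (x, y) = ((ln 2)^-1 * fog_gain lam t%:R v k x)%:E)%E.
  have mPx : measurable_fun setT (fun y => (EFin \o Psi) (x, y)).
    by apply/measurable_EFinP; exact: (measurable_fun_pair2 x mPsi).
  have iw := fog_gain_integrand_integrable lam0 tau0 v0 k0 mw w0 x.
  rewrite (ge0_integral_distribution_density Yw mPx); last first.
    by move=> y; rewrite lee_fin.
  transitivity (\int[mu]_y (((ln 2)^-1)%:E * (fog_density v k y * log_gain lam t%:R (x * y))%:E))%E.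
    by apply: eq_integral => y _; rewrite /= -!EFinM mulrCA.
  by rewrite integralZl// EFinM /fog_gain /Rintegral fineK//; exact: (integrable_fin_num _ iw).
rewrite (eq_integral (fun x => ((ln 2)^-1 * fog_gain lam t%:R v k x)%:E)); last by move=> x _; exact: inner.
have mWE : measurable_fun setT (fun x : R => ((ln 2)^-1 * fog_gain lam t%:R v k x)%:E).
  by apply/measurable_EFinP; apply: measurable_funM => //; exact: measurable_fog_gain.
rewrite (ge0_integral_distribution_density Xf mWE); last first.
  by move=> x; rewrite lee_fin mulr_ge0// fog_gain_ge0.
transitivity (\int[mu]_(x in `]0%R, +oo[) (((ln 2)^-1)%:E * (f x * fog_gain lam t%:R v k x)%:E))%E.
  rewrite [RHS]integral_mkcond; apply: eq_integral => x _; rewrite patchE.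
  case: ifPn => [_|/negP nx]; first by rewrite -!EFinM mulrCA.
  rewrite fneg ?mul0e// leNgt; apply/negP => x0; apply: nx; apply/mem_set.
  by rewrite /= in_itv/= x0.
by rewrite integralZl// EFinM /Rintegral fineK//; exact: (integrable_fin_num _ ifW).
Qed.

End Expectation.

Theorem mainTheorem10 (R : realType) (d : measure_display)
  (T : measurableType d) (P : probability T R)
  (pr : tp_params R) (v : R) (k t : nat) (gamma0 : R)
  (htp hf : {RV P >-> R}) (ftp : R -> R) :
  tp_model pr ->
  0 < v -> (0 < k)%N -> t = 1%N \/ t = 2%N -> 0 < gamma0 ->
  independent_RV htp hf ->
  is_tp_density pr ftp -> has_density htp ftp ->
  has_density hf (fog_density v k) ->
  let h := fun w : T => htp w * hf w in
  let gamma := fun w : T => gamma0 * h w ^+ t in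
  let r : R := t%:R^-1 in
  exists eta : R,
    ('E_P[fun w => log2 (1 + mu_ R t * gamma w)] = eta%:E)%E /\
    eta%:C =
      (log2 (expR 1) * (tp_psi pr * v ^+ k / t%:R))%:C
      * \sum_(1 <= l < (tp_P pr).+1)
          (tp_zeta pr l * tp_C pr l `^ (- tp_phi pr))%:C
          * foxH (tp_m pr + k + 2) (tp_n pr + 1)
              (V1 pr l ++ [:: (0, r); (1, r)] ++ V2 pr v k l)
              (V3 pr v k l ++ [:: (0, r); (0, r)] ++ V4 pr l)
              (tp_C pr l * (1 / (mu_ R t * gamma0)) `^ r).
Proof.
move=> prm v0 k0 t12 g0 ind [fneg fpos] Xf Yw h gamma r.
have t0 : (0 < t)%N by case: t12 => ->.
have mu0 : 0 < mu_ R t.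
  by rewrite /mu_; case: ifP => // _; rewrite divr_gt0 ?expR_gt0// mulr_gt0// pi_gt0.
pose lam := mu_ R t * gamma0.
have lam0 : 0 < lam by rewrite mulr_gt0.
have reg l := @tp_model_regular R pr l prm.
have [mf _ _] := Xf; have [mw w0 _] := Yw.
exists ((ln 2)^-1 * Rintegral lebesgue_measure `]0, +oo[ (fun x => ftp x * fog_gain lam t%:R v k x)).
split.
  rewrite -(capacity_expectation v0 k0 t0 lam0 ind Xf Yw fneg).
    by congr expectation; apply/funext => w; rewrite /gamma /h mulrA.
  exact: (capacity_integrable reg v0 k0 t0 lam0 mf fpos mw w0).
rewrite rmorphM /= (tp_capacity reg v0 k0 t0 lam0 mf fpos mw w0) [LHS]mulrA -rmorphM.
(* The factor 1 / ln 2 is the binary logarithm of e. *)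
by congr (_%:C * _); rewrite /log2 expRK div1r.
Qed.
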